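(* For every integer $d\ge2$, as $n\to\infty$, $$\operatorname{lmp}_d(n)\le\left(\frac1{d!}+o_d(1)\right)\frac{n^{d-1}}{\lg n},$$ and there is a $d$-clique partition realizing this bound (for each $n$-vertex $d$-uniform hypergraph) in which the number of $d$-cliques is $O_d(n^d/\lg^3 n)$. Furthermore, a $d$-clique partition realizing this upper bound can be constructed deterministically in time $O(n^d/d!)$.
   Context: $\lg$ is the base-2 logarithm. A subscript $d$ in $o_d(\cdot)$ or $O_d(\cdot)$ means that the rate of convergence or implied constant may depend on $d$; asymptotics are as $n\to\infty$. A $d$-clique is a $d$-uniform hypergraph whose vertex set is a disjoint union $V_1\sqcup\dots\sqcup V_d$ and whose edges are exactly the sets $\{v_1,\dots,v_d\}$ with $v_i\in V_i$ for all $i$. A $d$-clique partition of a $d$-uniform hypergraph $H$ is a family of $d$-cliques that are subhypergraphs of $H$ and whose edge sets partition $E(H)$. $\operatorname{lmp}_d(H)$ is the least natural number $\ell$ such that $H$ has a $d$-clique partition in which every vertex belongs to at most $\ell$ of the $d$-cliques, and $\operatorname{lmp}_d(n)$ is the maximum of $\operatorname{lmp}_d(H)$ over all $d$-uniform hypergraphs $H$ on $n$ vertices. A partition ''realizes the bound'' if every vertex belongs to at most the stated number of $d$-cliques. Running times are in the standard word-RAM model with words of $\Theta(\lg n)$ bits. *)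

(* Defs.v *)
From HB Require Import structures.
From mathcomp Require Import all_boot all_order all_algebra.

Set Implicit Arguments.
Unset Strict Implicit.
Unset Printing Implicit Defensive.

Local Open Scope nat_scope.

Record hypergraph (d : nat) (T : finType) := Hypergraph {
  edges :> {set {set T}};
  edges_uniform : [forall e in edges, #|e| == d] }.

HB.instance Definition _ d T := [isSub for @edges d T].
HB.instance Definition _ d T := [Finite of hypergraph d T by <:].

(* A d-clique is given by its family of parts V_1, ..., V_d. *)
Definition parts (d : nat) (T : finType) := {ffun 'I_d -> {set T}}.

Section Cliques.
Variables (d : nat) (T : finType).
Implicit Types (V : parts d T) (Q : {set parts d T}) (H : hypergraph d T).

Definition is_clique V : bool :=
  [forall i, forall j, (i != j) ==> [disjoint V i & V j]].

Definition clique_vertices V : {set T} := \bigcup_i V i.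

Definition clique_edges V : {set {set T}} :=
  [set [set v i | i : 'I_d] | v : {ffun 'I_d -> T} & [forall i, v i \in V i]].

(* [partition] demands nonempty blocks, so every clique of the family has an
   edge; injectivity says that distinct members have distinct (hence disjoint)
   edge sets, which the image set alone would not see. *)
Definition clique_partition H Q : bool :=
  [&& [forall V in Q, is_clique V && (clique_edges V \subset edges H)],
      [forall V in Q, forall W in Q,
         (clique_edges V == clique_edges W) ==> (V == W)]
    & partition [set clique_edges V | V in Q] (edges H)].

Definition clique_degree Q (x : T) : nat :=
  #|[set V in Q | x \in clique_vertices V]|.

Definition lmp_le H (l : nat) : bool :=
  [exists Q : {set parts d T},
     clique_partition H Q && [forall x, clique_degree Q x <= l]].

Lemma edge_clique H (e : {set T}) : e \in edges H ->
  exists V, is_clique V && (clique_edges V == [set e]).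
Proof.
move=> eH; have /forall_inP/(_ _ eH)/eqP ce := edges_uniform H.
pose f (i : 'I_d) := enum_val (cast_ord (esym ce) i).
have f_inj : injective f by move=> i j /enum_val_inj /cast_ord_inj.
exists [ffun i => [set f i]]; apply/andP; split.
  apply/forallP => i; apply/forallP => j; apply/implyP => ij.
  by rewrite !ffunE disjoints1 inE (inj_eq f_inj).
have fe : [set f i | i : 'I_d] = e.
  apply/eqP; rewrite eqEcard card_imset // card_ord ce leqnn andbT.
  by apply/subsetP => _ /imsetP[i _ ->]; apply: enum_valP.
apply/eqP/setP => E; rewrite inE; apply/imsetP/eqP => [[v + ->]|->].
  rewrite inE => /forallP vP; rewrite -fe; apply: eq_imset => i.
  by have := vP i; rewrite ffunE inE => /eqP.
exists (finfun f).
  by rewrite inE; apply/forallP => i; rewrite !ffunE inE.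
by rewrite -fe; apply: eq_imset => i; rewrite ffunE.
Qed.

Lemma lmp_exists H : exists l, lmp_le H l.
Proof.
pose f (e : {set T}) := odflt [ffun=> set0]
  [pick V : parts d T | is_clique V && (clique_edges V == [set e])].
have fP e : e \in edges H -> is_clique (f e) /\ clique_edges (f e) = [set e].
  move=> /edge_clique[V0 V0P]; rewrite /f; case: pickP => [V|] /=.
    by case/andP=> ? /eqP.
  by move/(_ V0); rewrite V0P.
pose Q := [set f e | e in edges H]; exists #|Q|.
apply/existsP; exists Q; apply/andP; split; last first.
  apply/forallP => x; apply: subset_leq_card.
  by apply/subsetP => V; rewrite inE => /andP[].
apply/and3P; split.
- apply/forall_inP => _ /imsetP[e eH ->]; have [-> ->] := fP e eH.
  by rewrite sub1set.
- apply/forall_inP => _ /imsetP[e eH ->]; apply/forall_inP => _ /imsetP[g gH ->].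
  have [_ ->] := fP e eH; have [_ ->] := fP g gH.
  by apply/implyP => /eqP/set1_inj ->.
have -> : [set clique_edges V | V in Q] = [set [set e] | e in edges H].
  rewrite -imset_comp; apply: eq_in_imset => e eH /=.
  by have [] := fP e eH.
apply/and3P; split.
- rewrite cover_imset; apply/eqP/setP => e; apply/bigcupP/idP.
    by case=> g gH; rewrite inE => /eqP ->.
  by move=> eH; exists e; rewrite ?inE.
- apply/trivIsetP => _ _ /imsetP[e _ ->] /imsetP[g _ ->] ne.
  by rewrite disjoints1 inE; apply: contraNneq ne => ->.
- apply/negP => /imsetP[e _] /setP /(_ e).
  by rewrite !inE eqxx.
Qed.

Definition lmp H : nat := ex_minn (lmp_exists H).

End Cliques.

Definition lmp_max (d n : nat) : nat := \max_(H : hypergraph d 'I_n) lmp H.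

(* Word RAM with words of w bits: words are the naturals below 2 ^ w, memory
   is addressed by words, and every instruction takes one unit of time. *)
Variant wop := Add | Sub | Mul | Div | And | Or | Xor | Shl | Shr | Lt | Eq.

Variant instr :=
  | Const of nat & nat        (* Const r k    : r := k         *)
  | Op of wop & nat & nat & nat (* Op o r a b : r := a o b     *)
  | Read of nat & nat         (* Read r a     : r := mem[a]    *)
  | Store of nat & nat        (* Store a r    : mem[a] := r    *)
  | Jz of nat & nat.          (* Jz r l       : if r = 0 go to l *)

Definition program := seq instr.

Record config := Config { pc : nat; reg : nat -> nat; mem : nat -> nat }.

Definition eval_wop (w : nat) (o : wop) (a b : nat) : nat :=
  match o with
  | Add => (a + b) %% 2 ^ w
  | Sub => (a + (2 ^ w - b)) %% 2 ^ w
  | Mul => (a * b) %% 2 ^ w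
  | Div => a %/ b
  | And => Nat.land a b
  | Or => Nat.lor a b
  | Xor => Nat.lxor a b
  | Shl => (a * 2 ^ b) %% 2 ^ w
  | Shr => a %/ 2 ^ b
  | Lt => a < b
  | Eq => a == b
  end.

Definition exec (w : nat) (i : instr) (s : config) : config :=
  let: Config p r m := s in
  match i with
  | Const x k => Config p.+1 [eta r with x |-> k %% 2 ^ w] m
  | Op o x a b => Config p.+1 [eta r with x |-> eval_wop w o (r a) (r b)] m
  | Read x a => Config p.+1 [eta r with x |-> m (r a)] m
  | Store a x => Config p.+1 r [eta m with r a |-> r x]
  | Jz x l => Config (if r x == 0 then l else p.+1) r m
  end.

Definition halted (P : program) (s : config) : bool := size P <= pc s.

(* A halted configuration is a fixed point of [step]. *)
Definition step (w : nat) (P : program) (s : config) : config :=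
  if onth P (pc s) is Some i then exec w i s else s.

(* Initially register 0 holds n and the cells 0, ..., n ^ d - 1 hold the
   adjacency tensor of H: the cell with base-n digits v_1, ..., v_d contains 1
   if {v_1, ..., v_d} is an edge and 0 otherwise.  All else is 0. *)
Definition init (d n : nat) (H : hypergraph d 'I_n) : config :=
  Config 0 [fun _ : nat => 0 with 0 |-> n]
    (fun a => (a < n ^ d) &&
       ([set x : 'I_n | [exists i : 'I_d, (a %/ n ^ i) %% n == x]] \in edges H)).

(* A list of cliques is written as its length followed by the codes of its
   members; a clique as its d parts in turn, each as its size followed by its
   vertices, in any order. *)
Definition clique_code (d n : nat) (L : {ffun 'I_d -> seq 'I_n}) : seq nat :=
  flatten [seq size (L i) :: [seq nat_of_ord x | x <- L i] | i <- enum 'I_d].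

Definition output_code (d n : nat) (s : seq {ffun 'I_d -> seq 'I_n}) : seq nat :=
  size s :: flatten [seq clique_code L | L <- s].

Definition listed_parts (d n : nat) (L : {ffun 'I_d -> seq 'I_n}) : parts d 'I_n :=
  [ffun i => [set x in L i]].

(* Register 0 points to the output. *)
Definition outputs (w d n : nat) (s : config) (Q : {set parts d 'I_n}) : Prop :=
  exists Ls : seq {ffun 'I_d -> seq 'I_n},
    [/\ forall L, L \in Ls -> forall i, uniq (L i),
        uniq [seq listed_parts L | L <- Ls],
        Q = [set V in [seq listed_parts L | L <- Ls]],
        reg s 0 + size (output_code Ls) <= 2 ^ w
      & forall k, k < size (output_code Ls) ->
          mem s (reg s 0 + k) = nth 0 (output_code Ls) k].

Definition computes_within (w : nat) (P : program) (d n t : nat)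
    (H : hypergraph d 'I_n) (Q : {set parts d 'I_n}) : Prop :=
  let s := iter t (step w P) (init H) in halted P s /\ outputs w s Q.

From mathcomp Require Import all_classical all_reals all_analysis.
Import Order.TTheory GRing.Theory Num.Theory.

Section Bounds.
Variable R : realType.
Local Open Scope ring_scope.

Definition lg (n : nat) : R := ln n%:R / ln 2.

Definition lmp_bound (d : nat) (eps : nat -> R) (n : nat) : R :=
  (d`!%:R^-1 + eps n) * (n%:R ^+ d.-1 / lg n).

Definition realizes (d n : nat) (Q : {set parts d 'I_n}) (b : R) : Prop :=
  forall x : 'I_n, (clique_degree Q x)%:R <= b.

End Bounds.

(* Main.v *)
From mathcomp Require Import all_boot zify.
Require Import Defs.

(** Write [d = e + 2], and cut the vertices [0, .., n - 1] into blocks of [k]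
    consecutive ones, where [k] is about [lg n - 2 lg lg n].

    Every edge is split in one way into a set [U] of [e] vertices, a vertex [a]
    and a vertex [s]: the sum of the block indices of its vertices, modulo [d],
    is the rank of [a] in the edge; [s] is the largest of the other vertices,
    and [U] is the rest.  Fix [U] and a block, and record for every [a] the set
    of the [s] in the block for which [U], [a], [s] is the split of an edge.
    The vertices [a] that have the same nonempty set [T] form a part [A], and
    the vertices of [U], one by one, together with [A] and [T] are the parts of
    a clique.  Since the split is unique, these cliques partition the
    hypergraph ([clique_family_partition]).

    A vertex is in few cliques as a member of [U] or of [T], because there are
    at most [2 ^ k] sets [T] for each block and [2 ^ k] is at most about
    [n / (lg n) ^ 2].  As a member of [A] it is in at most one clique for each
    choice of [U] and the block.  The sum of the block indices is equidistributed
    modulo [d], so only one choice in [d] is possible ([count_qc]).  The sets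
    [U] together with a block, which is to the right of [U], number about
    [n ^ (d - 1) / ((d - 1)! k)]; hence the bound on the degree
    ([family_degree]).  The number of cliques is at most
    [n ^ e * (n / k + 1) * 2 ^ k] ([card_clique_family]).

    The algorithm runs through all [U], all blocks and all [a].  A check that
    does not look at the hypergraph rejects most triples; for the others, it
    reads the [k] entries of the adjacency tensor and computes the set [T] as a
    binary mask.  By the count above, about [n ^ d / d!] entries are read in
    all, and the rest of the work is smaller by a factor that tends to infinity
    ([time_numeric]).  The vertices [a] are put in linked lists, one for each
    mask, from which the cliques are written.  The program is written in a small
    structured language.  Its compiler is correct with exact running times
    ([compileP]); the program itself is verified by rules for total correctness
    with time bounds, up to [main_spec] and [main_computes]. *)

Set Implicit Arguments.
Unset Strict Implicit.
Unset Printing Implicit Defensive.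

Local Open Scope nat_scope.

(** * Digits *)

(** Least significant digit first: the numbers below [b ^ j] code the [j]-tuples
    over [0, .., b - 1], which is how the input tensor is addressed. *)
Fixpoint digs (b j x : nat) : seq nat :=
  if j is j'.+1 then x %% b :: digs b j' (x %/ b) else [::].

Definition undigs (b : nat) (l : seq nat) : nat :=
  foldr (fun v x => v + b * x) 0 l.

Lemma size_digs b j x : size (digs b j x) = j.
Proof. by elim: j x => //= j IH x; rewrite IH. Qed.

Lemma nth_digs b j x i : i < j -> nth 0 (digs b j x) i = (x %/ b ^ i) %% b.
Proof.
elim: j x i => // j IH x [|i] /= ij; first by rewrite expn0 divn1.
by rewrite IH // expnS divnMA.
Qed.

Lemma digs_rcons b j x : digs b j.+1 x = rcons (digs b j x) ((x %/ b ^ j) %% b).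
Proof.
elim: j x => [|j IH] x; first by rewrite /= expn0 divn1.
by rewrite [LHS]/= -/(digs b j.+1 (x %/ b)) IH /= expnS divnMA.
Qed.

Lemma digs_lt b j x : 0 < b -> all (fun v => v < b) (digs b j x).
Proof. by move=> b0; elim: j x => //= j IH x; rewrite ltn_mod b0 IH. Qed.

Lemma digs_undigs b l : all (fun v => v < b) l -> digs b (size l) (undigs b l) = l.
Proof.
elim: l => //= v l IH /andP[vb lb].
by rewrite addnC mulnC modnMDl modn_small // divnMDl 1?divn_small ?addn0 ?IH //; lia.
Qed.

Lemma undigs_lt b l : all (fun v => v < b) l -> undigs b l < b ^ size l.
Proof.
elim: l => //= v l IH /andP[vb /IH lb]; rewrite expnS.
apply: (@leq_trans (b * (undigs b l).+1)); first by rewrite mulnS ltn_add2r.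
by rewrite leq_mul2l lb orbT.
Qed.

Lemma undigs_digs b j x : x < b ^ j -> undigs b (digs b j x) = x.
Proof.
elim: j x => [|j IH] x /=; first by rewrite expn0; case: x.
rewrite expnS => xb; rewrite IH; first by rewrite addnC mulnC -divn_eq.
by rewrite ltn_divLR 1?mulnC //; case: b xb {IH}.
Qed.

Lemma digs_inj b j x y : x < b ^ j -> y < b ^ j -> digs b j x = digs b j y -> x = y.
Proof. by move=> hx hy h; rewrite -(undigs_digs hx) h undigs_digs. Qed.

Lemma digs_cat b i j x y : x < b ^ i ->
  digs b (i + j) (x + b ^ i * y) = digs b i x ++ digs b j y.
Proof.
elim: i x => [|i IH] x; first by rewrite expn0 mul1n; case: x.
rewrite expnS => xb /=; have b0 : 0 < b by case: b xb {IH}.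
have -> : x + b * b ^ i * y = (b ^ i * y) * b + x by lia.
by rewrite modnMDl divnMDl // [b ^ i * y + _]addnC IH // ltn_divLR // mulnC.
Qed.

(** * Binary masks *)

(** The number whose binary digits are [f 0, .., f (k - 1)]. *)
Definition mask_of (f : nat -> bool) (k : nat) : nat := \sum_(j < k) f j * 2 ^ j.

Lemma mask_ofS f k : mask_of f k.+1 = mask_of f k + f k * 2 ^ k.
Proof. by rewrite /mask_of big_ord_recr. Qed.

Lemma mask_of_lt f k : mask_of f k < 2 ^ k.
Proof.
elim: k => [|k IH]; first by rewrite /mask_of big_ord0.
by rewrite mask_ofS expnS; case: (f k); lia.
Qed.

Lemma mask_of_bit f k j : j < k -> odd (mask_of f k %/ 2 ^ j) = f j.
Proof.
elim: k => // k IH; rewrite ltnS leq_eqVlt mask_ofS => /predU1P[->|jk].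
  by rewrite addnC divnMDl ?expn_gt0 // divn_small ?mask_of_lt // addn0; case: (f k).
have -> : f k * 2 ^ k = f k * 2 ^ (k - j) * 2 ^ j.
  by rewrite -mulnA -expnD subnK // ltnW.
rewrite addnC divnMDl ?expn_gt0 // oddD IH //.
by rewrite oddM oddX subn_eq0 leqNgt jk andbF.
Qed.

Lemma mask_of_eq0 f k j : j < k -> mask_of f k = 0 -> f j = false.
Proof. by move=> jk h; rewrite -(mask_of_bit f jk) h div0n. Qed.

(** * Sets listed by naturals *)

Section Listed.
Variable n : nat.

Definition vs (l : seq nat) : {set 'I_n} := [set x : 'I_n | (x : nat) \in l].

Lemma mem_vs l l' : all (fun v => v < n) l -> all (fun v => v < n) l' ->
  vs l = vs l' -> l =i l'.
Proof.
move=> /allP h /allP h' E v.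
have sub l1 l2 : {in l1, forall u, u < n} -> vs l1 = vs l2 -> v \in l1 -> v \in l2.
  by move=> hl El vl; have /setP/(_ (Ordinal (hl _ vl))) := El; rewrite !inE vl /=.
by apply/idP/idP; apply: sub.
Qed.

Lemma card_vs l : all (fun v => v < n) l -> (#|vs l| == size l) = uniq l.
Proof.
move=> /allP h; pose s : seq 'I_n := pmap insub l.
have ls : [seq val x | x <- s] = l.
  rewrite /s (pmap_filter (insubK _)); apply/all_filterP/allP => v /h vn.
  by rewrite /= insubT.
rewrite -{2 3}ls size_map (map_inj_uniq val_inj).
have -> : #|vs l| = #|s| by apply: eq_card => x; rewrite inE -{1}ls (mem_map val_inj).
exact/eqP/card_uniqP.
Qed.

Lemma vs_perm l l' : perm_eq l l' -> vs l = vs l'.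
Proof. by move=> /perm_mem h; apply/setP => x; rewrite !inE h. Qed.

End Listed.

(** * The role rule *)

Section Role.
Variables (e k : nat).

Definition below (a : nat) (l : seq nat) : nat := count (fun v => v < a) l.
Definition blocks (l : seq nat) : nat := sumn [seq v %/ k | v <- l].

(** The rule that splits an edge: the rank of [a] is the sum of the block indices
    of all the vertices modulo their number, and [W] lists the others. *)
Definition role (W : seq nat) (a : nat) : bool :=
  sorted ltn W && (below a W == (blocks W + a %/ k) %% e.+2).

Lemma below_perm a l l' : perm_eq l l' -> below a l = below a l'.
Proof. by move=> /permP h; apply: h. Qed.

Lemma blocks_perm l l' : perm_eq l l' -> blocks l = blocks l'.
Proof. by move=> h; apply: perm_sumn; apply: perm_map. Qed.

(** If [x < y] are both in the list, then [x] itself is below [y] but not below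
    [x]; so ranks tell vertices apart. *)
Lemma below_inj l a b : a \in l -> b \in l -> below a l = below b l -> a = b.
Proof.
have lt x y : x \in l -> x < y -> below x l < below y l.
  move=> xl xy; rewrite /below.
  have -> : count (fun v => v < y) l =
      count (fun v => v < x) l + count (fun v => x <= v < y) l.
    rewrite -count_predUI [X in _ + X](_ : _ = 0) ?addn0.
      by apply: eq_count => v /=; lia.
    by apply/eqP; rewrite -leqn0 leqNgt -has_count; apply/hasPn => v _ /=; lia.
  rewrite -[X in X < _]addn0 ltn_add2l -has_count.
  by apply/hasP; exists x; rewrite // leqnn.
move=> al bl h; case: (ltngtP a b) => // /lt.
  by move=> /(_ al); rewrite h ltnn.
by move=> /(_ bl); rewrite h ltnn.
Qed.

(** The sum of the block indices does not depend on the split, so it determines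
    the rank of [a] in the edge, hence [a] itself and the sorted list of the
    other vertices. *)
Lemma role_uniq W W' a a' : uniq (a :: W) -> uniq (a' :: W') ->
  a :: W =i a' :: W' -> role W a -> role W' a' -> a = a' /\ W = W'.
Proof.
move=> uW uW' E /andP[sW /eqP rW] /andP[sW' /eqP rW'].
have pE := uniq_perm uW uW' E.
have ea : a = a'.
  apply: (@below_inj (a :: W)); rewrite ?mem_head //.
    by rewrite E mem_head.
  rewrite [RHS](below_perm _ pE) /below /= !ltnn !add0n.
  rewrite -/(below a W) -/(below a' W') rW rW'.
  by have := blocks_perm pE; rewrite /blocks /= addnC => ->; rewrite addnC.
split=> //; apply: (irr_sorted_eq ltn_trans ltnn) => //.
by apply: perm_mem; move: pE; rewrite ea perm_cons.
Qed.

(** A residue modulo the number of vertices is the rank of one of them. *)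
Lemma role_ex l : sorted ltn l -> size l = e.+2 ->
  exists W a, perm_eq (a :: W) l /\ role W a.
Proof.
move=> sl zl; pose r := blocks l %% e.+2.
have rl : r < size l by rewrite zl ltn_mod.
pose a := nth 0 l r; exists (take r l ++ drop r.+1 l), a.
have pl : perm_eq (a :: (take r l ++ drop r.+1 l)) l.
  rewrite -[X in perm_eq _ X](cat_take_drop r l) (drop_nth 0 rl) -/a.
  by rewrite -cat1s -(cat1s a (drop _ _)) perm_catCA perm_refl.
split=> //; apply/andP; split.
  apply: (subseq_sorted ltn_trans _ sl).
  rewrite -{3}(cat_take_drop r l); apply: cat_subseq => //.
  by rewrite (drop_nth 0 rl) subseq_cons.
have := blocks_perm pl; rewrite {1}/blocks /= addnC => ->; rewrite -/r.
rewrite /below count_cat.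
have lt i j : i < j -> j < size l -> nth 0 l i < nth 0 l j.
  move=> ij jl; apply: (sorted_ltn_nth ltn_trans) => //.
  by rewrite inE; apply: ltn_trans jl.
have -> : count (fun v => v < a) (take r l) = r.
  rewrite -[RHS](size_takel (ltnW rl)); apply/eqP; rewrite -all_count.
  apply/(all_nthP 0) => i; rewrite (size_takel (ltnW rl)) => ir.
  by rewrite nth_take // lt.
rewrite -[X in _ == X]addn0 eqn_add2l -leqn0 leqNgt -has_count -all_predC.
apply/(all_nthP 0) => i; rewrite size_drop => ir.
by rewrite nth_drop /= -leqNgt ltnW // lt; lia.
Qed.

End Role.

(** * Families of cliques that partition a hypergraph *)

(** A vertex common to two parts would be chosen twice by some transversal, which
    then has fewer than [d] vertices and is not an edge. *)
Lemma is_clique_sub d (T : finType) (H : hypergraph d T) (V : parts d T) :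
  (forall i, V i != set0) -> clique_edges V \subset edges H -> is_clique V.
Proof.
move=> V0 VH; apply/forallP => i; apply/forallP => j; apply/implyP => ij.
rewrite -setI_eq0; apply: contraNT ij => /set0Pn[x]; rewrite inE => /andP[xi xj].
have w0 l : exists y, y \in V l by apply/set0Pn.
pose v := [ffun l => if (l == i) || (l == j) then x else xchoose (w0 l)].
have vV l : v l \in V l.
  rewrite ffunE; case: eqP => [->//|_] /=; case: eqP => [->//|_].
  exact: (xchooseP (w0 l)).
have vE : [set v l | l : 'I_d] \in edges H.
  by apply: (subsetP VH); apply/imsetP; exists v; rewrite // inE; apply/forallP.
have /forall_inP/(_ _ vE)/eqP cE := edges_uniform H.
have /imset_injP vinj : #|[set v l | l : 'I_d]| == #|'I_d| by rewrite cE card_ord.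
by apply/eqP/vinj; rewrite // !ffunE !eqxx orbT.
Qed.

Lemma clique_partitionI d (T : finType) (H : hypergraph d T)
    (I : eqType) (K : seq I) (F : I -> parts d T) :
    {in K, forall c, clique_edges (F c) != set0} ->
    {in K, forall c, is_clique (F c)} ->
    {in K, forall c, clique_edges (F c) \subset edges H} ->
    {in K &, forall c c' E, E \in clique_edges (F c) -> E \in clique_edges (F c') ->
       c = c'} ->
    (forall E, E \in edges H -> exists2 c, c \in K & E \in clique_edges (F c)) ->
  clique_partition H [set V in [seq F c | c <- K]].
Proof.
move=> ne cl sub dis cov; apply/and3P; split.
- apply/forall_inP => V; rewrite inE => /mapP[c cK ->].
  by rewrite cl ?sub.
- apply/forall_inP => V; rewrite inE => /mapP[c cK ->].
  apply/forall_inP => W; rewrite inE => /mapP[c' cK' ->].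
  apply/implyP => /eqP h; have /set0Pn[E Ec] := ne _ cK.
  by rewrite (dis _ _ cK cK' E) // -h.
- apply/and3P; split.
  + rewrite cover_imset; apply/eqP/setP => E; apply/bigcupP/idP.
      by case=> V; rewrite inE => /mapP[c cK ->]; apply: (subsetP (sub _ cK)).
    by move=> /cov[c cK Ec]; exists (F c); rewrite // inE map_f.
  + apply/trivIsetP => A B /imsetP[V]; rewrite inE => /mapP[c cK ->] ->.
    move=> /imsetP[W]; rewrite inE => /mapP[c' cK' ->] ->.
    apply: contraNT; rewrite -setI_eq0 => /set0Pn[E]; rewrite inE => /andP[h h'].
    by rewrite (dis _ _ cK cK' E).
  + apply/imsetP => -[V]; rewrite inE => /mapP[c cK ->] /eqP.
    by rewrite eq_sym (negPf (ne _ cK)).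
Qed.

(** * The decomposition *)

Section Decomposition.
Variables (e n k : nat).
Hypothesis n_gt0 : 0 < n.
Hypothesis k_gt0 : 0 < k.
Variable H : hypergraph e.+2 'I_n.

(** The tuple coded by [mu], together with [a] and [s], is the split of an edge. *)
Definition bit (mu a s : nat) : bool :=
  [&& s < n, role e k (rcons (digs n e mu) s) a
    & vs n (a :: rcons (digs n e mu) s) \in edges H].

(** The neighbours of [a] in block [b] through the tuple [mu], as a binary mask. *)
Definition nbr_mask (mu b a : nat) : nat := mask_of (fun j => bit mu a (b * k + j)) k.

(** A clique is named by its tuple, the block of its last part, and the mask of
    that part. *)
Definition key := (nat * nat * nat)%type.

Definition members (c : key) : seq nat :=
  let: (mu, b, t) := c in [seq a <- iota 0 n | nbr_mask mu b a == t].

(** The members come in reverse order because the program collects them in a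
    linked list that grows at its head. *)
Definition part (c : key) (i : nat) : seq nat :=
  let: (mu, b, t) := c in
  if i < e then [:: nth 0 (digs n e mu) i]
  else if i == e then rev (members c)
  else [seq b * k + j | j <- iota 0 k & odd (t %/ 2 ^ j)].

Definition listing (c : key) : {ffun 'I_e.+2 -> seq 'I_n} :=
  [ffun i : 'I_e.+2 => pmap insub (part c i)].

Definition block_keys (mu b T : nat) : seq key :=
  [seq (mu, b, t) | t <- iota 0 T & (t != 0) && (members (mu, b, t) != [::])].

(** The last block may be incomplete or empty. *)
Definition n_blocks := n %/ k + 1.

Definition keys : seq key :=
  flatten [seq flatten [seq block_keys mu b (2 ^ k) | b <- iota 0 n_blocks]
          | mu <- iota 0 (n ^ e)].

Definition cliques : seq {ffun 'I_e.+2 -> seq 'I_n} := [seq listing c | c <- keys].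

Definition clique_family : {set parts e.+2 'I_n} :=
  [set V in [seq listed_parts L | L <- cliques]].

Lemma uniq_vs E l : E \in edges H -> all (fun v => v < n) l -> size l = e.+2 ->
  E = vs n l -> uniq l.
Proof.
move=> EH ln zl El; rewrite -(card_vs ln) zl -El.
by have /forall_inP := edges_uniform H; apply.
Qed.

Lemma digs_n mu : all (fun v => v < n) (digs n e mu).
Proof. exact: digs_lt. Qed.

Lemma bit_tuple mu a s : a < n -> bit mu a s ->
  all (fun v => v < n) (a :: rcons (digs n e mu) s) /\ uniq (a :: rcons (digs n e mu) s).
Proof.
move=> an /and3P[sn _ EH]; set l := a :: _.
have ln : all (fun v => v < n) l by rewrite /= all_rcons an sn digs_n.
by split=> //; apply: (uniq_vs EH ln) => //; rewrite /= size_rcons size_digs.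
Qed.

Lemma bit_uniq mu a s mu' a' s' : mu < n ^ e -> mu' < n ^ e -> a < n -> a' < n ->
  bit mu a s -> bit mu' a' s' ->
  vs n (a :: rcons (digs n e mu) s) = vs n (a' :: rcons (digs n e mu') s') ->
  [/\ mu = mu', a = a' & s = s'].
Proof.
move=> hmu hmu' an an' B B' E.
have [ln ul] := bit_tuple an B; have [ln' ul'] := bit_tuple an' B'.
have /and3P[_ R _] := B; have /and3P[_ R' _] := B'.
have [-> /rcons_inj[]] := role_uniq ul ul' (mem_vs ln ln' E) R R'.
by move=> /(digs_inj hmu hmu') -> ->.
Qed.

(** Sort the edge, split it by the rule, and code all but the largest of the other
    vertices. *)
Lemma edge_rep E : E \in edges H ->
  exists mu a s, [/\ mu < n ^ e, a < n, bit mu a s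
    & E = vs n (a :: rcons (digs n e mu) s)].
Proof.
move=> EH; have /forall_inP/(_ _ EH)/eqP cE := edges_uniform H.
pose l := sort leq [seq val x | x <- enum E].
have ul : uniq l by rewrite sort_uniq (map_inj_uniq val_inj) enum_uniq.
have sl : sorted ltn l by rewrite ltn_sorted_uniq_leq ul sort_sorted // => x y; apply: leq_total.
have zl : size l = e.+2 by rewrite size_sort size_map -cardE cE.
have El : E = vs n l.
  by apply/setP => x; rewrite inE mem_sort (mem_map val_inj) mem_enum.
have ln : all (fun v => v < n) l.
  by rewrite all_sort all_map; apply/allP => x _ /=.
have [W [a [pl rW]]] := role_ex k sl zl.
have : all (fun v => v < n) (a :: W) by rewrite (perm_all _ pl).
have zW : size W = e.+1 by have := perm_size pl; rewrite zl => -[].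
case: (lastP W) zW pl rW => // U s; rewrite size_rcons => -[zU] pl rW.
rewrite /= all_rcons => /and3P[an sn Un].
have dU : digs n e (undigs n U) = U by rewrite -zU digs_undigs.
exists (undigs n U), a, s; rewrite /bit !dU sn rW (vs_perm n pl) -El EH an.
by split=> //; rewrite -zU undigs_lt.
Qed.

Lemma mask_neq0 mu b a : (nbr_mask mu b a != 0) =
  [exists j : 'I_k, bit mu a (b * k + j)].
Proof.
apply/idP/existsP => [|[j Bj]]; last first.
  by apply/eqP => h; have := mask_of_eq0 (ltn_ord j) h; rewrite Bj.
move=> m0; apply/existsP; apply: contraNT m0 => /existsPn h.
by rewrite /nbr_mask /mask_of big1 // => j _; rewrite (negPf (h j)).
Qed.

Lemma mask_bit mu b a j : j < k -> odd (nbr_mask mu b a %/ 2 ^ j) = bit mu a (b * k + j).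
Proof. exact: mask_of_bit. Qed.

Lemma mem_keys mu b t : ((mu, b, t) \in keys) =
  [&& mu < n ^ e, b < n_blocks, t < 2 ^ k, t != 0 & members (mu, b, t) != [::]].
Proof.
apply/flatten_mapP/idP => [[mu' + /flatten_mapP[b' +]]|/and5P[hmu hb ht t0 ne]].
  rewrite !mem_iota /= !add0n => hmu hb /mapP[t' + [-> -> ->]].
  by rewrite mem_filter mem_iota => /andP[/andP[-> ->] /= ->]; rewrite hmu hb.
exists mu; first by rewrite mem_iota.
apply/flatten_mapP; exists b; first by rewrite mem_iota.
by apply: map_f; rewrite mem_filter mem_iota t0 ne.
Qed.

Lemma mem_members a mu b t : (a \in members (mu, b, t)) = (a < n) && (nbr_mask mu b a == t).
Proof. by rewrite mem_filter mem_iota andbC. Qed.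

Lemma keyP mu b t : (mu, b, t) \in keys ->
  exists a j, [/\ a < n, j < k, nbr_mask mu b a = t & bit mu a (b * k + j)].
Proof.
rewrite mem_keys => /and5P[_ _ _ t0].
case E : (members _) => [//|a l] _.
have : a \in members (mu, b, t) by rewrite E mem_head.
rewrite mem_members => /andP[an /eqP at_]; move: t0.
by rewrite -at_ mask_neq0 => /existsP[j Bj]; exists a, j.
Qed.

Lemma mem_listed c (i : 'I_e.+2) (x : 'I_n) :
  (x \in listed_parts (listing c) i) = ((x : nat) \in part c i).
Proof. by rewrite !ffunE inE mem_pmap_sub. Qed.

(** The mask [t] has bit [j] exactly if every member sees the vertex [b * k + j],
    so every transversal is an edge that is split in this way. *)
Lemma in_clique_edges mu b t E : (mu, b, t) \in keys ->
  E \in clique_edges (listed_parts (listing (mu, b, t))) <->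
  exists a j, [/\ a < n, j < k, nbr_mask mu b a = t, bit mu a (b * k + j)
    & E = vs n (a :: rcons (digs n e mu) (b * k + j))].
Proof.
move=> cK; split.
  move=> /imsetP[v]; rewrite inE => /forallP vP ->.
  have P i (ie : i < e.+2) := vP (Ordinal ie).
  have {}P i (ie : i < e.+2) : (v (Ordinal ie) : nat) \in part (mu, b, t) i.
    by have := P i ie; rewrite mem_listed.
  have he : e < e.+2 by [].
  have he1 : e.+1 < e.+2 by [].
  have := P e he; rewrite {1}/part ltnn eqxx mem_rev mem_members => /andP[an /eqP at_].
  have := P e.+1 he1.
  rewrite /part ltnNge leqnSn /= eqn_leq ltnn /= => /mapP[j].
  rewrite mem_filter mem_iota => /andP[+ /= jk] vj.
  rewrite -{1}at_ mask_bit // => B.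
  exists (v (Ordinal he)), j; split=> //.
  apply/setP => x; rewrite !inE mem_rcons inE -vj.
  apply/imsetP/or3P => [[i _ ->]|].
    have [ie|] := ltnP i e.
      apply: Or33; have := P i (ltn_ord i).
      have -> : Ordinal (ltn_ord i) = i by apply: val_inj.
      by rewrite /part ie inE => /eqP ->; rewrite mem_nth ?size_digs.
    rewrite leq_eqVlt => /predU1P[ei|ei].
      by apply: Or31; apply/eqP; congr (val (v _)); apply: val_inj.
    apply: Or32; apply/eqP; congr (val (v _)); apply: val_inj => /=.
    by have := ltn_ord i; lia.
  case=> [/eqP/val_inj ->|/eqP/val_inj ->|]; try by eexists.
  move=> /(nthP 0)[i]; rewrite size_digs => ie xi.
  have ie2 : i < e.+2 by lia.
  exists (Ordinal ie2) => //; apply: val_inj => /=; rewrite -xi.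
  by have := P i ie2; rewrite /part ie inE => /eqP ->.
case=> a [j [an jk at_ B ->]].
have [/= /andP[_ +] _] := bit_tuple an B; rewrite all_rcons => /andP[sn dn].
pose l := digs n e mu ++ [:: a; b * k + j].
have zl : size l = e.+2 by rewrite size_cat size_digs addn2.
have ln (i : 'I_e.+2) : nth 0 l i < n.
  have /(all_nthP 0) : all (fun v => v < n) l by rewrite all_cat dn /= an sn.
  by apply; rewrite zl.
apply/imsetP; exists [ffun i => Ordinal (ln i)].
  rewrite inE; apply/forallP => i; rewrite mem_listed ffunE /= /part.
  rewrite nth_cat size_digs; case: ltnP => [ie|ei]; first by rewrite inE.
  move: (ei); rewrite leq_eqVlt eq_sym; case: eqP => [->|_] /= ei'.
    by rewrite subnn mem_rev mem_members an at_ /=.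
  have -> : i = e.+1 :> nat by have := ltn_ord i; lia.
  rewrite subSn // subnn /=; apply: map_f.
  by rewrite mem_filter mem_iota jk -at_ mask_bit // B.
have -> : vs n (a :: rcons (digs n e mu) (b * k + j)) = vs n l.
  apply: vs_perm; rewrite /l -cats1 -cat1s perm_catCA /=.
  exact: perm_refl.
apply/setP => x; rewrite inE; apply/(nthP 0)/imsetP => [[i + xi]|[i _ ->]].
  rewrite zl => ie; exists (Ordinal ie) => //.
  by apply: val_inj; rewrite ffunE /= xi.
by exists i; rewrite ?zl // ffunE.
Qed.

Lemma n_blocksP s : s < n -> s %/ k < n_blocks.
Proof. by move=> sn; rewrite /n_blocks addn1 ltnS leq_div2r // ltnW. Qed.

Lemma part_neq0 c (i : 'I_e.+2) : c \in keys ->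
  listed_parts (listing c) i != set0.
Proof.
case: c => -[mu b] t cK; have [a [j [an jk at_ B]]] := keyP cK.
have : vs n (a :: rcons (digs n e mu) (b * k + j)) \in
    clique_edges (listed_parts (listing (mu, b, t))).
  by apply/in_clique_edges => //; exists a, j.
by move=> /imsetP[v]; rewrite inE => /forallP/(_ i) vi _; apply/set0Pn; exists (v i).
Qed.

Lemma clique_edges_neq0 : {in keys, forall c,
  clique_edges (listed_parts (listing c)) != set0}.
Proof.
case=> -[mu b] t cK; have [a [j [an jk at_ B]]] := keyP cK.
apply/set0Pn; exists (vs n (a :: rcons (digs n e mu) (b * k + j))).
by apply/in_clique_edges => //; exists a, j.
Qed.

(** An edge has one split, from which the key of its clique can be read off. *)
Lemma clique_edges_disjoint : {in keys &, forall c c' E,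
  E \in clique_edges (listed_parts (listing c)) ->
  E \in clique_edges (listed_parts (listing c')) -> c = c'}.
Proof.
case=> -[mu b] t [[mu' b'] t'] cK cK' E.
move=> /(in_clique_edges _ cK)[a [j [an jk at_ B EE]]].
move=> /(in_clique_edges _ cK')[a' [j' [an' jk' at_' B' EE']]].
move: (cK) (cK'); rewrite !mem_keys => /andP[hmu _] /andP[hmu' _].
have [|em ea es] := bit_uniq hmu hmu' an an' B B'; first by rewrite -EE -EE'.
have eb : b = b'.
  by move: (congr1 (divn^~ k) es); rewrite !divnMDl // !divn_small // !addn0.
by rewrite -at_ -at_' em ea eb.
Qed.

Theorem clique_family_partition : clique_partition H clique_family.
Proof.
rewrite /clique_family /cliques -map_comp.
have sub : {in keys, forall c, clique_edges (listed_parts (listing c)) \subset edges H}.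
  case=> -[mu b] t cK; apply/subsetP => E /(in_clique_edges _ cK)[a [j [an jk _ B ->]]].
  by case/and3P: B.
apply: clique_partitionI => //; first exact: clique_edges_neq0.
- move=> c cK; apply: (is_clique_sub (H := H)) (sub _ cK) => i.
  exact: part_neq0.
- exact: clique_edges_disjoint.
- move=> E EH; have [mu [a [s [hmu an B EE]]]] := edge_rep EH.
  pose b := s %/ k; have sE : s = b * k + s %% k := divn_eq s k.
  have jk : s %% k < k by rewrite ltn_mod.
  have sn : s < n by case/and3P: B.
  have cK : (mu, b, nbr_mask mu b a) \in keys.
    rewrite mem_keys hmu n_blocksP // mask_of_lt mask_neq0 /=.
    apply/andP; split; first by apply/existsP; exists (Ordinal jk); rewrite /= -sE.
    have : a \in members (mu, b, nbr_mask mu b a) by rewrite mem_members an eqxx.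
    by rewrite /members; case: (filter _ _).
  exists (mu, b, nbr_mask mu b a) => //; apply/(in_clique_edges _ cK).
  by exists a, (s %% k); rewrite -sE.
Qed.

Lemma uniq_flatten (I J : eqType) (f : I -> seq J) (r : seq I) : uniq r ->
  (forall i, uniq (f i)) ->
  (forall i i' x, x \in f i -> x \in f i' -> i = i') ->
  uniq (flatten [seq f i | i <- r]).
Proof.
move=> ur uf inj; elim: r ur => //= i r IH /andP[ir /IH ur].
rewrite cat_uniq uf ur andbT /=; apply/hasPn => x /flatten_mapP[i' i'r xi'].
by apply: contra ir => xi; rewrite (inj _ _ _ xi xi').
Qed.

Lemma uniq_keys : uniq keys.
Proof.
apply: uniq_flatten => [|mu|mu mu' x]; first exact: iota_uniq.
  apply: uniq_flatten => [|b|b b' x]; first exact: iota_uniq.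
    by rewrite map_inj_uniq ?filter_uniq ?iota_uniq // => ? ? [].
  by move=> /mapP[t _ ->] /mapP[t' _]; case=> ->.
by move=> /flatten_mapP[b _ /mapP[t _ ->]] /flatten_mapP[b' _ /mapP[t' _]]; case=> ->.
Qed.

Lemma uniq_cliques : uniq [seq listed_parts L | L <- cliques].
Proof.
rewrite /cliques -map_comp map_inj_in_uniq ?uniq_keys // => c c' cK cK' /= E.
have /set0Pn[x xc] := clique_edges_neq0 cK.
by apply: (clique_edges_disjoint cK cK' xc); rewrite -E.
Qed.

Lemma uniq_listing c i : uniq (listing c i).
Proof.
rewrite ffunE; apply: pmap_sub_uniq; case: c => -[mu b] t; rewrite /part.
case: ifP => // _; case: ifP => _; first by rewrite rev_uniq filter_uniq ?iota_uniq.
by rewrite map_inj_in_uniq ?filter_uniq ?iota_uniq // => ? ? _ _ /addnI.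
Qed.

Lemma part_lt c i : c \in keys -> all (fun v => v < n) (part c i).
Proof.
case: c => -[mu b] t cK; have [a [j [_ _ at_ _]]] := keyP cK; rewrite /part.
case: ifP => ie; first by rewrite /= andbT (all_nthP 0 (digs_n mu)) ?size_digs.
case: ifP => _.
  by rewrite all_rev; apply/allP => x; rewrite mem_members => /andP[].
apply/allP => s /mapP[i']; rewrite mem_filter mem_iota => /andP[+ /= i'k] ->.
by rewrite -at_ mask_bit // => /and3P[].
Qed.

Lemma val_listing c (i : 'I_e.+2) : c \in keys ->
  [seq nat_of_ord x | x <- listing c i] = part c i.
Proof.
move=> cK; rewrite ffunE (pmap_filter (insubK _)); apply/all_filterP.
by apply: sub_all (part_lt i cK) => v vn; rewrite /= insubT.
Qed.

Lemma size_listing c (i : 'I_e.+2) : c \in keys -> size (listing c i) = size (part c i).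
Proof. by move=> cK; rewrite -(val_listing i cK) size_map. Qed.

End Decomposition.

(** * Counting *)

Lemma sum_mul (F : nat -> nat) a b :
  \sum_(x < a * b) F x = \sum_(q < a) \sum_(r < b) F (q * b + r).
Proof.
elim: a => [|a IH]; first by rewrite mul0n !big_ord0.
rewrite big_ord_recr /= -IH mulSnr -!(big_mkord xpredT).
rewrite (@big_cat_nat _ _ _ (a * b)) ?leq_addr //=; congr (_ + _).
by rewrite -{1}[a * b]add0n big_addn addKn !big_mkord; apply: eq_bigr => r _; rewrite addnC.
Qed.

Lemma sum_eq_le1 N c : \sum_(i < N) ((i : nat) == c) <= 1.
Proof.
elim: N c => [|N IH] c; first by rewrite big_ord0.
rewrite big_ord_recr /=; case: eqP => [E|_]; last by rewrite addn0.
by rewrite big1 // => i _; rewrite -E ltn_eqF.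
Qed.

(** A window of [d] consecutive numbers meets a residue class at most once; cut the
    interval into windows. *)
Lemma sum_residue d c r N : 0 < d ->
  d * \sum_(i < N) ((c + i) %% d == r) <= N + d.
Proof.
move=> d0; have small N' : N' <= d -> \sum_(i < N') ((c + i) %% d == r) <= 1.
  elim: N' => [|N' IH] hN; first by rewrite big_ord0.
  rewrite big_ord_recr /=; case: eqP => [E|_]; last by rewrite addn0 IH // ltnW.
  rewrite big1 // => i _; apply/eqP; rewrite eqb0 -E eqn_modDl.
  by have iN := ltn_ord i; rewrite !modn_small; lia.
rewrite (divn_eq N d); set q := N %/ d; have := ltn_pmod N d0; set z := N %% d => zd.
rewrite -!(big_mkord xpredT (fun i => nat_of_bool ((c + i) %% d == r))).
rewrite (@big_cat_nat _ _ _ (q * d)) ?leq_addr //= !(big_mkord xpredT).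
rewrite (sum_mul (fun x => nat_of_bool ((c + x) %% d == r))).
have -> : \sum_(i < q) \sum_(j < d) ((c + (i * d + j)) %% d == r) =
    q * \sum_(j < d) ((c + j) %% d == r).
  rewrite -[X in X * _]card_ord -sum_nat_const; apply: eq_bigr => i _.
  by apply: eq_bigr => j _; rewrite addnCA modnMDl.
have h1 := small d (leqnn d).
have -> : \sum_(q * d <= i < q * d + z) ((c + i) %% d == r) = \sum_(j < z) ((c + j) %% d == r).
  rewrite -{1}[q * d]add0n big_addn addKn big_mkord; apply: eq_bigr => j _.
  by rewrite addnA addnC modnMDl.
have h2 := small z (ltnW zd).
rewrite mulnDr mulnCA mulnA; apply: leq_add; last by rewrite -[X in _ <= X]muln1 leq_mul2l h2 orbT.
by apply: leq_trans (leq_addr z _); rewrite -[X in _ <= X]muln1 leq_mul2l h1 orbT.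
Qed.

Lemma sum_residue_half d c r al m : 0 < d -> al < m ->
  d * \sum_(b < m) ((b <= al) && ((c + b) %% d == r)) <= al.+1 + d /\
  d * \sum_(b < m) ((al <= b) && ((c + b) %% d == r)) <= m - al + d.
Proof.
move=> d0 am; have am' := ltnW am; split.
  rewrite -(big_mkord xpredT (fun b => nat_of_bool ((b <= al) && ((c + b) %% d == r)))).
  rewrite (@big_cat_nat _ _ _ al.+1) //= [X in _ + X]big_nat_cond [X in _ + X]big1 ?addn0.
    rewrite big_mkord; apply: leq_trans (sum_residue c r al.+1 d0).
    rewrite leq_mul2l; apply/orP; right; apply: leq_sum => b _.
    by case: (b <= al).
  by move=> b; rewrite andbT => /andP[ab _]; rewrite leqNgt ab.
rewrite -(big_mkord xpredT (fun b => nat_of_bool ((al <= b) && ((c + b) %% d == r)))).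
rewrite (@big_cat_nat _ _ _ al) //= [X in X + _]big_nat_cond [X in X + _]big1 ?add0n.
  rewrite -{1}[al]add0n big_addn big_mkord; apply: leq_trans (sum_residue (c + al) r (m - al) d0).
  rewrite leq_mul2l; apply/orP; right; apply: leq_sum => b _.
  by rewrite leq_addl /= -addnA [al + b]addnC.
by move=> b; rewrite andbT => /andP[_ ab]; rewrite leqNgt ab.
Qed.

(** One more than the last entry, or 0: a lower bound for what may follow. *)
Definition top (l : seq nat) : nat := last 0 [seq v.+1 | v <- l].

Lemma top_rcons l x : top (rcons l x) = x.+1.
Proof. by rewrite /top map_rcons last_rcons. Qed.

Lemma sorted_rcons_top l x : sorted ltn (rcons l x) = sorted ltn l && (top l <= x).
Proof.
by case: l => [|y l] //=; rewrite rcons_path /top /= last_map.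
Qed.

Lemma sum_vs n l (f : nat -> nat) : all (fun v => v < n) l -> uniq l ->
  \sum_(x in vs n l) f x = sumn [seq f v | v <- l].
Proof.
move=> ln ul; pose s : seq 'I_n := pmap insub l.
have ls : [seq val x | x <- s] = l.
  rewrite /s (pmap_filter (insubK _)); apply/all_filterP; apply: sub_all ln => v vn.
  by rewrite /= insubT.
rewrite (eq_bigl (fun x => x \in s)); last by move=> x; rewrite inE -{1}ls (mem_map val_inj).
by rewrite -big_uniq ?pmap_sub_uniq //= sumnE -ls -map_comp big_map.
Qed.

Section Count.
Variables (e n k : nat).
Hypothesis n_gt0 : 0 < n.
Hypothesis k_gt0 : 0 < k.
Let d := e.+2.
Let nb := n_blocks n k.

Lemma sum_blocks (F : nat -> nat) :
  \sum_(w < n) F w <= \sum_(b < nb) \sum_(j < k) F (b * k + j).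
Proof.
rewrite -(sum_mul F) -!(big_mkord xpredT).
have h : n <= nb * k.
  rewrite /nb /n_blocks; have := divn_eq n k; have := ltn_pmod n k_gt0; lia.
by rewrite [X in _ <= X](@big_cat_nat _ _ _ n) //= leq_addr.
Qed.

Lemma div_block b j : j < k -> (b * k + j) %/ k = b.
Proof. by move=> jk; rewrite divnMDl // divn_small // addn0. Qed.

(** Given the other vertices, the rule prescribes the residue of the block of [w]:
    one residue to the left of [a], another to its right, where the rank of [a]
    is not raised by [w]. *)
Lemma role_blocks A B a : a < n ->
  d * \sum_(w < n) (A + (w < a) == (B + w %/ k + a %/ k) %% d) <= k * (nb + 1 + 2 * d).
Proof.
move=> an; set al := a %/ k; have aln : al < nb by apply: n_blocksP.
have d0 : 0 < d by [].
have [h1 _] := sum_residue_half (B + al) (A + 1) d0 aln.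
have [_ h2] := sum_residue_half (B + al) A d0 aln.
apply: leq_trans (_ : d * \sum_(b < nb) \sum_(j < k)
   (((b <= al) && ((B + al + b) %% d == A + 1)) + ((al <= b) && ((B + al + b) %% d == A))) <= _).
  rewrite leq_mul2l; apply/orP; right.
  apply: leq_trans (sum_blocks (fun w => (A + (w < a) == (B + w %/ k + al) %% d : nat))) _.
  apply: leq_sum => b _; apply: leq_sum => j _; rewrite div_block //.
  rewrite [B + b + al]addnAC eq_sym.
  case: (ltnP (b * k + j) a) => ha.
    suff -> : b <= al by rewrite leq_addr.
    rewrite /al leq_divRL //; lia.
  suff -> : al <= b by rewrite addn0 leq_addl.
  rewrite -ltnS /al ltn_divLR //; have := ltn_ord j; lia.
under eq_bigr => b _ do rewrite sum_nat_const card_ord.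
rewrite -big_distrr /= mulnCA leq_mul2l; apply/orP; right.
rewrite big_split /= mulnDr; apply: leq_trans (leq_add h1 h2) _. lia.
Qed.

(** The condition of [role] on the set [X] of the vertices other than [a].  It is
    symmetric: the largest vertex is not singled out. *)
Definition seen (a : nat) (X : {set 'I_n}) : bool :=
  \sum_(v in X) ((v : nat) < a) == (\sum_(v in X) (v %/ k) + a %/ k) %% d.

(** By symmetry any [w] in [X] may be taken for the last vertex.  Count the pairs
    of [X] and [w] by the [e]-set that remains, and apply [role_blocks]. *)
Lemma card_seen a : a < n ->
  d * (e.+1 * #|[set X : {set 'I_n} | (#|X| == e.+1) && seen a X]|) <=
  'C(n, e) * (k * (nb + 1 + 2 * d)).
Proof.
move=> an; set S := [set X | _].
pose ok (w : 'I_n) (Y : {set 'I_n}) := \sum_(v in Y) ((v : nat) < a) + (w < a) ==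
  (\sum_(v in Y) (v %/ k) + w %/ k + a %/ k) %% d.
have -> : e.+1 * #|S| = \sum_(w : 'I_n) #|[set X in S | w \in X]|.
  have -> : e.+1 * #|S| = \sum_(X in S) #|X|.
    rewrite mulnC -sum_nat_const; apply: eq_bigr => X.
    by rewrite inE => /andP[/eqP -> _].
  under eq_bigr => X _ do rewrite -sum1_card.
  rewrite (exchange_big_dep xpredT) //=; apply: eq_bigr => w _.
  by rewrite -sum1_card; apply: eq_bigl => X; rewrite !inE.
apply: leq_trans (_ : d * \sum_(w : 'I_n) #|[set Y : {set 'I_n} | (#|Y| == e) && ok w Y]| <= _).
  rewrite leq_mul2l; apply/orP; right; apply: leq_sum => w _.
  have inj : {in [set X in S | w \in X] &, injective (fun X : {set 'I_n} => X :\ w)}.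
    by move=> X X'; rewrite !inE => /andP[_ wX] /andP[_ wX'] h; rewrite -(setD1K wX) h setD1K.
  rewrite -(card_in_imset inj); apply: subset_leq_card; apply/subsetP => Y.
  move=> /imsetP[X]; rewrite !inE => /andP[/andP[/eqP cX]]; rewrite /seen => hX wX ->.
  move: cX; rewrite (cardsD1 w) wX add1n => -[->]; rewrite eqxx /=.
  by move: hX; rewrite /ok !(big_setD1 w wX) /= [X in X == _]addnC [w %/ k + _]addnC.
have -> : \sum_(w : 'I_n) #|[set Y : {set 'I_n} | (#|Y| == e) && ok w Y]| =
    \sum_(Y : {set 'I_n} | #|Y| == e) \sum_(w < n) ok w Y.
  rewrite exchange_big /=; apply: eq_bigr => w _.
  rewrite -sum1_card big_mkcond [RHS]big_mkcond /=.
  by apply: eq_bigr => Y _; rewrite inE; case: (_ == _).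
have <- : #|[set Y : {set 'I_n} | #|Y| == e]| = 'C(n, e) by rewrite card_draws card_ord.
rewrite big_distrr /= -sum_nat_const [X in _ <= X](eq_bigl (fun Y : {set 'I_n} => #|Y| == e)).
  by apply: leq_sum => Y _; apply: role_blocks.
by move=> Y; rewrite inE.
Qed.

(** The quick check: a condition, independent of the hypergraph, without which [a]
    sees no vertex of block [b] through [mu].  Within the block the rank of [a]
    depends only on the side of [a]; hence the test at both ends. *)
Definition qc (mu b a : nat) : bool :=
  let U := digs n e mu in
  let r := (blocks k U + a %/ k + b) %% d in
  [&& sorted ltn U, top U < b * k + k
    & (below a U + (b * k < a) == r) || (below a U + (b * k + k.-1 < a) == r)].

Lemma below_rcons a U s : below a (rcons U s) = below a U + (s < a).
Proof. by rewrite /below -cats1 count_cat /= addn0. Qed.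

Lemma blocks_rcons U s : blocks k (rcons U s) = blocks k U + s %/ k.
Proof. by rewrite /blocks map_rcons sumn_rcons. Qed.

Lemma role_rcons mu b a j : j < k ->
  role e k (rcons (digs n e mu) (b * k + j)) a =
  let U := digs n e mu in
  [&& sorted ltn U, top U <= b * k + j
    & below a U + (b * k + j < a) == (blocks k U + a %/ k + b) %% d].
Proof.
move=> jk; rewrite /role sorted_rcons_top below_rcons blocks_rcons div_block //.
by rewrite [_ + b + _]addnAC andbA.
Qed.

Lemma role_qc mu b a j : j < k ->
  role e k (rcons (digs n e mu) (b * k + j)) a -> qc mu b a.
Proof.
move=> jk; rewrite role_rcons // /qc => /and3P[-> tU rk] /=; apply/andP; split; first lia.
case: (ltnP (b * k + j) a) rk => ha.
  have -> : b * k < a by lia.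
  by move=> ->.
have -> : b * k + k.-1 < a = false by lia.
by move=> ->; rewrite orbT.
Qed.

Lemma role_good mu b a j : j < k -> b * k + k <= n -> top (digs n e mu) <= b * k ->
  b != a %/ k -> qc mu b a -> role e k (rcons (digs n e mu) (b * k + j)) a.
Proof.
move=> jk bn tU ba /and3P[sU _ hr]; rewrite role_rcons //= sU /=.
apply/andP; split; first lia.
have : (b * k < a) = (b * k + j < a) /\ (b * k + k.-1 < a) = (b * k + j < a).
  move: ba; rewrite neq_ltn => /orP[|].
    rewrite leq_divRL // mulSn => h; split; lia.
  by rewrite ltn_divLR // => h; split; apply/idP/idP; lia.
by case=> h1 h2; move: hr; rewrite h1 h2 orbb.
Qed.

(** In a good block the rule holds at every vertex. *)
Definition good mu b a :=
  [&& qc mu b a, top (digs n e mu) <= b * k, b * k + k <= n & b != a %/ k].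

(** Three blocks are exceptional: the one where the tuple ends, the incomplete one,
    and the one of [a]. *)
Lemma sum_qc mu a : \sum_(b < nb) qc mu b a <= 3 + \sum_(b < nb) good mu b a.
Proof.
apply: (@leq_trans (\sum_(b < nb) (((b : nat) == top (digs n e mu) %/ k) +
   ((b : nat) == n %/ k) + ((b : nat) == a %/ k) + good mu b a))).
  apply: leq_sum => b _; rewrite /good.
  case Q : (qc mu b a) => //=.
  case: (leqP (top _) (b * k)) => /= hU; last first.
    suff -> : top (digs n e mu) %/ k = b by rewrite eqxx.
    have /and3P[_ ht _] := Q; apply/eqP; rewrite eqn_leq.
    rewrite leq_divRL // -ltnS ltn_divLR // mulSn; lia.
  case: (leqP (b * k + k) n) => /= hn; last first.
    suff -> : n %/ k = b by rewrite eqxx addn1.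
    apply/eqP; rewrite eqn_leq -ltnS ltn_divLR // mulSn [k + _]addnC hn /=.
    by have := ltn_ord b; move: (nat_of_ord b) => x; rewrite /nb /n_blocks addn1 ltnS.
  by case: (_ == a %/ k) => /=; lia.
by rewrite !big_split /= leq_add2r -[3]/(1 + 1 + 1) !leq_add ?sum_eq_le1.
Qed.

(** Each vertex of a good block extends the tuple to a set that obeys the rule, and
    a sorted set determines the tuple and the vertex. *)
Lemma sum_good a : a < n ->
  k * \sum_(mu < n ^ e) \sum_(b < nb) good mu b a <=
  #|[set X : {set 'I_n} | (#|X| == e.+1) && seen a X]|.
Proof.
move=> an; apply: (@leq_trans (\sum_(mu < n ^ e) \sum_(s < n) role e k (rcons (digs n e mu) s) a)).
  rewrite big_distrr; apply: leq_sum => mu _ /=.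
  pose F s : nat := (s < n) && role e k (rcons (digs n e mu) s) a.
  have -> : \sum_(s < n) role e k (rcons (digs n e mu) s) a = \sum_(s < nb * k) F s.
    have h : n <= nb * k.
      rewrite /nb /n_blocks; have := divn_eq n k; have := ltn_pmod n k_gt0; lia.
    rewrite -[RHS](big_mkord xpredT) (@big_cat_nat _ _ _ n) //= [X in _ = _ + X]big_nat_cond.
    rewrite [X in _ = _ + X]big1 ?addn0.
      by rewrite big_mkord; apply: eq_bigr => s _; rewrite /F ltn_ord.
    by move=> s; rewrite /F andbT => /andP[ns _]; rewrite ltnNge ns.
  rewrite (sum_mul F) big_distrr; apply: leq_sum => b _ /=.
  case G : (good mu b a); last by rewrite muln0.
  have /and4P[hq ht hn hb] := G.
  rewrite muln1 -{1}(card_ord k) -sum1_card; apply: leq_sum => j _.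
  by rewrite /F role_good // andbT; have := ltn_ord j; lia.
have -> : \sum_(mu < n ^ e) \sum_(s < n) role e k (rcons (digs n e mu) s) a =
    #|[set p : 'I_(n ^ e) * 'I_n | role e k (rcons (digs n e p.1) p.2) a]|.
  rewrite pair_bigA /= -sum1_card [RHS]big_mkcond; apply: eq_bigr => p _ /=.
  by rewrite inE; case: role.
have ln mu (s : 'I_n) : all (fun v => v < n) (rcons (digs n e mu) s).
  by rewrite all_rcons ltn_ord digs_lt.
have inj : {in [set p : 'I_(n ^ e) * 'I_n | role e k (rcons (digs n e p.1) p.2) a] &,
    injective (fun p : 'I_(n ^ e) * 'I_n => vs n (rcons (digs n e p.1) p.2))}.
  move=> [mu s] [mu' s']; rewrite !inE /= => /andP[h _] /andP[h' _] E.
  have [] := rcons_inj (irr_sorted_eq ltn_trans ltnn h h' (mem_vs (ln _ _) (ln _ _) E)).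
  by move=> /(digs_inj (ltn_ord _) (ltn_ord _)) /val_inj -> /val_inj ->.
rewrite -(card_in_imset inj); apply: subset_leq_card; apply/subsetP => X.
move=> /imsetP[[mu s]]; rewrite !inE /= => /andP[h hr] ->.
set l := rcons _ _; have ul : uniq l := sorted_uniq ltn_trans ltnn h.
have -> : #|vs n l| == e.+1.
  have <- : size l = e.+1 by rewrite size_rcons size_digs.
  by rewrite card_vs ?ln.
rewrite /seen (sum_vs (fun v => nat_of_bool (v < a)) (ln _ _) ul).
rewrite (sum_vs (fun v => v %/ k) (ln _ _) ul).
by rewrite sumn_count.
Qed.

(** All but three blocks are good for a given tuple, and [card_seen] counts the good
    ones: dividing by [d] there is what the equidistribution of the residues saves. *)
Theorem count_qc a : a < n ->
  d`! * \sum_(mu < n ^ e) \sum_(b < nb) qc mu b a <=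
  n ^ e * (nb + 1 + 2 * d + 3 * d`!).
Proof.
move=> an; set G := \sum_(mu < n ^ e) \sum_(b < nb) good mu b a.
have h : \sum_(mu < n ^ e) \sum_(b < nb) qc mu b a <= 3 * n ^ e + G.
  apply: leq_trans (_ : \sum_(mu < n ^ e) (3 + \sum_(b < nb) good mu b a) <= _).
    by apply: leq_sum => mu _; apply: sum_qc.
  by rewrite big_split /= sum_nat_const card_ord mulnC.
have hG : d * (e.+1 * G) <= 'C(n, e) * (nb + 1 + 2 * d).
  rewrite -(leq_pmul2l k_gt0) [k * ('C(n, e) * _)]mulnCA.
  apply: leq_trans (card_seen an).
  by rewrite mulnCA leq_mul2l /= [k * _]mulnCA leq_mul2l /= sum_good.
have hb : 'C(n, e) * e`! <= n ^ e.
  rewrite bin_ffact; elim: e => // i IH.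
  by rewrite ffactnSr expnSr leq_mul // leq_subr.
have hG' : d`! * G <= n ^ e * (nb + 1 + 2 * d).
  have -> : d`! * G = d * (e.+1 * G) * e`! by rewrite /d !factS; nia.
  apply: leq_trans (_ : 'C(n, e) * (nb + 1 + 2 * d) * e`! <= _).
    by rewrite leq_mul2r hG orbT.
  by rewrite mulnAC leq_mul2r hb orbT.
apply: leq_trans (_ : d`! * (3 * n ^ e + G) <= _).
  by rewrite leq_mul2l h orbT.
rewrite mulnDr [n ^ e * (_ + _)]mulnDr addnC leq_add //.
by rewrite mulnA mulnC [d`! * 3]mulnC.
Qed.

End Count.

Section Degree.
Variables (e n k : nat).
Hypothesis n_gt0 : 0 < n.
Hypothesis k_gt0 : 0 < k.
Variable H : hypergraph e.+2 'I_n.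
Let nb := n_blocks n k.

Lemma mask_qc mu b a : nbr_mask k H mu b a != 0 -> qc e n k mu b a.
Proof.
by rewrite mask_neq0 => /existsP[j /and3P[_ hr _]]; apply: role_qc hr.
Qed.

Lemma count_keys (p : key -> bool) :
  count p (keys k H) =
  \sum_(mu < n ^ e) \sum_(b < nb) \sum_(t < 2 ^ k)
    [&& t != 0 :> nat, members k H (mu : nat, b : nat, t : nat) != [::] & p (mu : nat, b : nat, t : nat)].
Proof.
rewrite /keys count_flatten sumnE !big_map -{1}[n ^ e]subn0 big_mkord.
apply: eq_bigr => mu _; rewrite count_flatten sumnE !big_map -{1}[n_blocks n k]subn0 big_mkord.
apply: eq_bigr => b _.
rewrite /block_keys count_map count_filter -sum1_count -{1}[2 ^ k]subn0 big_mkord big_mkcond /=.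
by apply: eq_bigr => t _; rewrite andbC -andbA; case: ifP.
Qed.

Lemma size_keys : size (keys k H) <= n ^ e * (nb * 2 ^ k).
Proof.
rewrite -(count_predT (keys k H)) count_keys.
apply: leq_trans (_ : \sum_(mu < n ^ e) \sum_(b < nb) \sum_(t < 2 ^ k) 1 <= _).
  by do 3![apply: leq_sum => ? _]; case: (_ && _).
by rewrite !sum_nat_const !card_ord muln1.
Qed.

Lemma card_clique_family : #|clique_family k H| <= n ^ e * (nb * 2 ^ k).
Proof.
apply: leq_trans size_keys; rewrite cardsE.
by rewrite -(size_map (@listing e n k H)) -(size_map (@listed_parts _ _)) card_size.
Qed.

(** Each of the [e] digits is equal to [x] once in [n] times. *)
Lemma sum_mem_digs x : n * \sum_(mu < n ^ e) (x \in digs n e mu) <= e * n ^ e.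
Proof.
elim: (e) => [|j IH]; first by rewrite expn0 big_ord1 /= muln0.
rewrite expnSr (sum_mul (fun mu => nat_of_bool (x \in digs n j.+1 mu))).
apply: leq_trans (_ : n * \sum_(q < n ^ j) \sum_(r < n)
    (((r : nat) == x) + (x \in digs n j q)) <= _).
  rewrite leq_mul2l; apply/orP; right; apply: leq_sum => q _; apply: leq_sum => r _.
  rewrite [digs n j.+1 _]/= modnMDl divnMDl // modn_small // divn_small // addn0.
  by rewrite inE eq_sym; case: (_ == _); case: (_ \in _).
under eq_bigr => q _ do rewrite big_split /= sum_nat_const card_ord.
rewrite big_split /= -big_distrr /=.
rewrite mulSn mulnDr leq_add //.
  rewrite mulnC leq_mul2r; apply/orP; right.
  by rewrite -[X in _ <= X]muln1 -[X in X * 1]card_ord -sum_nat_const leq_sum // => q _; apply: sum_eq_le1.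
by rewrite [j * _]mulnA [X in _ <= X]mulnC leq_mul2l IH orbT.
Qed.

(** If [x] is a member, the mask of its clique is the one that it sees, so each tuple
    and block account for at most one clique, and only if the check is passed.  The
    second term bounds the cliques that have [x] in the tuple or in the last part. *)
Theorem family_degree (x : 'I_n) : nb <= n ->
  clique_degree (clique_family k H) x <=
  \sum_(mu < n ^ e) \sum_(b < nb) qc e n k mu b x + e.+1 * (n ^ e * 2 ^ k).
Proof.
move=> nbn; pose F c := listed_parts (listing k H c).
pose p (c : key) := [exists i : 'I_e.+2, (x : nat) \in part k H c i].
have h : clique_degree (clique_family k H) x <= count p (keys k H).
  rewrite /clique_degree -size_filter -(size_map F).
  apply: leq_trans (card_size _); apply: subset_leq_card; apply/subsetP => V.
  rewrite inE /clique_family inE /cliques -map_comp => /andP[/mapP[c cK ->]].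
  move=> /bigcupP[i _]; rewrite mem_listed => xi.
  by apply: (map_f F); rewrite mem_filter cK andbT; apply/existsP; exists i.
apply: leq_trans h _; rewrite count_keys.
pose G (mu b t : nat) := ((nbr_mask k H mu b x != 0) && (t == nbr_mask k H mu b x)) +
  ((x : nat) \in digs n e mu) + (b == x %/ k).
apply: leq_trans (_ : \sum_(mu < n ^ e) \sum_(b < nb) \sum_(t < 2 ^ k) G mu b t <= _).
  apply: leq_sum => mu _; apply: leq_sum => b _; apply: leq_sum => t _.
  case: and3P => // -[t0]; case E : (members _ _ _) => [//|a l] _ /existsP[i].
  have : a \in members k H (mu : nat, b : nat, t : nat) by rewrite E mem_head.
  rewrite mem_members => /andP[an /eqP at_] {E l}.
  rewrite /part /G; case: ltnP => [ie|ei].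
    by rewrite inE => /eqP ->; rewrite mem_nth ?size_digs // addn1.
  case: eqP => [_|/eqP ie].
    by rewrite mem_rev mem_members => /andP[_ /eqP ->]; rewrite t0 eqxx.
  move=> /mapP[j]; rewrite mem_filter mem_iota => /andP[_ /= jk] ->.
  by rewrite div_block // eqxx addn1.
have split mu b : \sum_(t < 2 ^ k) G mu b t <=
    qc e n k mu b x + 2 ^ k * ((x : nat) \in digs n e mu) + 2 ^ k * (b == x %/ k).
  rewrite /G !big_split /= !sum_nat_const !card_ord !leq_add2r.
  case: (boolP (_ != 0)) => [/mask_qc ->|_]; last by rewrite big1.
  exact: sum_eq_le1.
apply: leq_trans (_ : \sum_(mu < n ^ e) \sum_(b < nb) (qc e n k mu b x +
    2 ^ k * ((x : nat) \in digs n e mu) + 2 ^ k * ((b : nat) == x %/ k)) <= _).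
  by apply: leq_sum => mu _; apply: leq_sum => b _; apply: split.
under eq_bigr => mu _ do rewrite !big_split /= sum_nat_const card_ord -big_distrr /=.
rewrite !big_split /= -addnA leq_add2l mulSn addnC; apply: leq_add.
  apply: leq_trans (_ : \sum_(mu < n ^ e) 2 ^ k * 1 <= _).
    by apply: leq_sum => mu _; rewrite leq_mul2l sum_eq_le1 orbT.
  by rewrite sum_nat_const card_ord muln1.
rewrite -!big_distrr /=; have := sum_mem_digs x; set S := \sum_(_ < _) _ => hS.
rewrite mulnCA mulnA [e * _]mulnA [e * n ^ e * _]mulnC -mulnA leq_mul2l; apply/orP; right.
by apply: leq_trans hS; rewrite leq_mul2r nbn orbT.
Qed.

End Degree.

(** * A structured language for the word RAM *)

Inductive expr :=
  | Var of nat
  | Cst of nat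
  | Bin of wop & expr & expr
  | Fetch of expr.

Inductive stmt :=
  | Asg of nat & expr
  | Sto of expr & expr
  | Seq of stmt & stmt
  | When of expr & stmt
  | While of expr & stmt.

Definition state := ((nat -> nat) * (nat -> nat))%type.

Definition nat_op (o : wop) (a b : nat) : nat :=
  match o with
  | Add => a + b
  | Sub => a - b
  | Mul => a * b
  | Div => a %/ b
  | Lt => a < b
  | Eq => a == b
  | _ => 0
  end.

(** The result is the same as that of the machine, which works modulo [M]. *)
Definition safe_op (M : nat) (o : wop) (a b : nat) : bool :=
  match o with
  | Add => a + b < M
  | Sub => b <= a
  | Mul => a * b < M
  | Div | Lt | Eq => true
  | _ => false
  end.

Fixpoint eval (st : state) (e : expr) : nat :=
  match e with
  | Var x => st.1 x
  | Cst k => k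
  | Bin o a b => nat_op o (eval st a) (eval st b)
  | Fetch a => st.2 (eval st a)
  end.

Fixpoint safe (M : nat) (st : state) (e : expr) : bool :=
  match e with
  | Var _ => true
  | Cst k => k < M
  | Bin o a b =>
      [&& safe M st a, safe M st b & safe_op M o (eval st a) (eval st b)]
  | Fetch a => safe M st a
  end.

Fixpoint elen (e : expr) : nat :=
  match e with
  | Var _ | Cst _ => 1
  | Bin _ a b => elen a + elen b + 1
  | Fetch a => elen a + 1
  end.

Fixpoint slen (s : stmt) : nat :=
  match s with
  | Asg _ e => elen e + 1
  | Sto a e => elen a + elen e + 1
  | Seq s1 s2 => slen s1 + slen s2
  | When e s => elen e + 1 + slen s
  | While e s => elen e + 1 + slen s + 2
  end.

Definition upd (f : nat -> nat) (x v : nat) : nat -> nat :=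
  fun y => if y == x then v else f y.
Definition set_var (st : state) (x v : nat) : state :=
  (fun y => if y == x then v else st.1 y, st.2).
Definition set_mem (st : state) (a v : nat) : state := (st.1, upd st.2 a v).

(** The time is that of the compiled code. *)
Inductive run (M : nat) : stmt -> state -> nat -> state -> Prop :=
  | RunAsg x e st of safe M st e :
      run M (Asg x e) st (elen e + 1) (set_var st x (eval st e))
  | RunSto a e st of safe M st a & safe M st e :
      run M (Sto a e) st (elen a + elen e + 1)
        (set_mem st (eval st a) (eval st e))
  | RunSeq s1 s2 st1 st2 st3 t1 t2 of
      run M s1 st1 t1 st2 & run M s2 st2 t2 st3 :
      run M (Seq s1 s2) st1 (t1 + t2) st3
  | RunSkip e s st of safe M st e & eval st e = 0 :
      run M (When e s) st (elen e + 1) st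
  | RunWhen e s st st' t of safe M st e & eval st e != 0 & run M s st t st' :
      run M (When e s) st (elen e + 1 + t) st'
  | RunExit e s st of safe M st e & eval st e = 0 :
      run M (While e s) st (elen e + 1) st
  | RunLoop e s st st1 st2 t1 t2 of safe M st e & eval st e != 0 &
      run M s st t1 st1 & run M (While e s) st1 t2 st2 :
      run M (While e s) st (elen e + 1 + (t1 + (2 + t2))) st2.

(** Registers from [tmp] on are scratch space for evaluating expressions. *)
Definition tmp := 64.

Fixpoint wf_expr (e : expr) : bool :=
  match e with
  | Var x => x < tmp
  | Cst _ => true
  | Bin _ a b => wf_expr a && wf_expr b
  | Fetch a => wf_expr a
  end.

Fixpoint wf (s : stmt) : bool :=
  match s with
  | Asg x e => (x < tmp) && wf_expr e
  | Sto a e => wf_expr a && wf_expr e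
  | Seq s1 s2 => wf s1 && wf s2
  | When e s => wf_expr e && wf s
  | While e s => wf_expr e && wf s
  end.

Fixpoint cexp (j : nat) (e : expr) : program :=
  match e with
  | Var x => [:: Op Or j x x]
  | Cst k => [:: Const j k]
  | Bin o a b => cexp j a ++ cexp j.+1 b ++ [:: Op o j j j.+1]
  | Fetch a => cexp j a ++ [:: Read j j]
  end.

(** Jumps are absolute, so the code depends on the address [l] where it is placed. *)
Fixpoint compile (l : nat) (s : stmt) : program :=
  match s with
  | Asg x e => cexp tmp e ++ [:: Op Or x tmp tmp]
  | Sto a e => cexp tmp a ++ cexp tmp.+1 e ++ [:: Store tmp tmp.+1]
  | Seq s1 s2 => compile l s1 ++ compile (l + slen s1) s2
  | When e s => cexp tmp e ++ [:: Jz tmp (l + elen e + 1 + slen s)]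
      ++ compile (l + elen e + 1) s
  | While e s => cexp tmp e ++ [:: Jz tmp (l + elen e + 1 + slen s + 2)]
      ++ compile (l + elen e + 1) s ++ [:: Const tmp 0; Jz tmp l]
  end.

Lemma upd_eq f x v : upd f x v x = v.
Proof. by rewrite /upd eqxx. Qed.

Lemma upd_lt f x v y : y < x -> upd f x v y = f y.
Proof. by move=> yx; rewrite /upd ltn_eqF. Qed.

Lemma size_cexp e j : size (cexp j e) = elen e.
Proof. by elim: e j => //= [o a IHa b IHb|a IHa] j; rewrite !size_cat ?IHa ?IHb /=; lia. Qed.

Lemma size_comp s l : size (compile l s) = slen s.
Proof.
elim: s l => //= [x e|a e|s1 IH1 s2 IH2|e s IH|e s IH] l;
  rewrite !(size_cat, size_cexp) /= ?size_cat /= ?size_cexp ?IH1 ?IH2 ?IH; lia.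
Qed.

Section Compilation.
Variables (w : nat) (P : program).
Let M := 2 ^ w.
Hypothesis w_gt0 : 0 < w.

Definition code_at (l : nat) (c : program) : Prop :=
  forall i, i < size c -> onth P (l + i) = onth c i.

Lemma code_at_cat l c1 c2 : code_at l (c1 ++ c2) ->
  code_at l c1 /\ code_at (l + size c1) c2.
Proof.
move=> h; split=> i ic.
  by rewrite h ?size_cat ?onth_cat ?ic //; lia.
rewrite -addnA h ?size_cat ?ltn_add2l // onth_cat.
by rewrite ltnNge leq_addr /= addKn.
Qed.

Definition reach t (c c' : config) := iter t (step w P) c = c'.

Lemma reach_trans t1 t2 c1 c2 c3 :
  reach t1 c1 c2 -> reach t2 c2 c3 -> reach (t1 + t2) c1 c3.
Proof. by rewrite /reach addnC iterD => -> ->. Qed.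

Lemma reach1 l i r m : code_at l [:: i] ->
  reach 1 (Config l r m) (exec w i (Config l r m)).
Proof.
move=> /(_ 0 isT); rewrite addn0 => /= h.
by rewrite /reach /= /step /= h.
Qed.

Definition agree (r : nat -> nat) (st : state) := forall x, x < tmp -> r x = st.1 x.
Definition bounded (st : state) := (forall x, st.1 x < M) /\ (forall a, st.2 a < M).

Lemma M_gt1 : 1 < M.
Proof. by rewrite /M -{1}(expn0 2) ltn_exp2l. Qed.

Lemma bool_ltM (b : bool) : b < M.
Proof. by have := M_gt1; case: b; lia. Qed.

Lemma safe_opP o a b : a < M -> b < M -> safe_op M o a b ->
  eval_wop w o a b = nat_op o a b /\ nat_op o a b < M.
Proof.
have := M_gt1; rewrite /M => M1 aM bM; case: o => //= h.
- by rewrite modn_small.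
- have -> : a + (2 ^ w - b) = a - b + 2 ^ w by lia.
  by rewrite modnDr modn_small; lia.
- by rewrite modn_small.
- by split=> //; apply: leq_ltn_trans aM; apply: leq_div.
- by split=> //; apply: bool_ltM.
- by split=> //; apply: bool_ltM.
Qed.

Lemma eval_bounded st e : bounded st -> safe M st e -> eval st e < M.
Proof.
move=> [b1 b2]; elim: e => //= o a IHa b IHb /and3P[/IHa ha /IHb hb h].
by have [] := safe_opP ha hb h.
Qed.

Lemma lor_diag a : Nat.lor a a = a.
Proof. exact: PeanoNat.Nat.lor_diag. Qed.

(** The code at level [j] keeps the registers below [j], where the pending
    intermediate values are. *)
Lemma cexpP e l j st r : code_at l (cexp j e) -> tmp <= j -> wf_expr e ->
  agree r st -> bounded st -> safe M st e ->
  exists r', [/\ reach (elen e) (Config l r st.2) (Config (l + elen e) r' st.2),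
    forall y, y < j -> r' y = r y & r' j = eval st e].
Proof.
elim: e l j r => [x|k|o a IHa b IHb|a IHa] l j r /= hP hj hw hr hb hs.
- exists (upd r j (r x)); split => [|y yj|] /=.
  + by rewrite addn1; have := reach1 r st.2 hP; rewrite /= lor_diag.
  + by rewrite upd_lt.
  + by rewrite upd_eq hr.
- exists (upd r j k); split => [|y yj|] /=.
  + by rewrite addn1; have := reach1 r st.2 hP; rewrite /= modn_small.
  + by rewrite upd_lt.
  + by rewrite upd_eq.
- have /andP[wa wb] := hw; have /and3P[sa sb so] := hs.
  have [Pa /code_at_cat[Pb Po]] := code_at_cat hP; rewrite !size_cexp in Pb Po.
  have [r1 [R1 f1 v1]] := IHa _ _ _ Pa hj wa hr hb sa.
  have hr1 : agree r1 st by move=> x xj; rewrite f1 ?hr //; lia.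
  have [|r2 [R2 f2 v2]] := IHb _ _ _ Pb _ wb hr1 hb sb; first lia.
  exists (upd r2 j (nat_op o (eval st a) (eval st b))); split => [|y yj|] /=.
  + have -> : elen a + elen b + 1 = elen a + (elen b + 1) by lia.
    apply: reach_trans R1 (reach_trans R2 _).
    have := reach1 r2 st.2 Po; rewrite /= v2 f2 // v1.
    have [-> _] := safe_opP (eval_bounded hb sa) (eval_bounded hb sb) so.
    by congr reach; congr Config; lia.
  + by rewrite upd_lt // f2 ?f1 //; lia.
  + by rewrite upd_eq.
- have [Pa Pr] := code_at_cat hP; rewrite !size_cexp in Pr.
  have [r1 [R1 f1 v1]] := IHa _ _ _ Pa hj hw hr hb hs.
  exists (upd r1 j (st.2 (eval st a))); split => [|y yj|] /=.
  + apply: reach_trans R1 _; have := reach1 r1 st.2 Pr; rewrite /= v1.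
    by congr reach; congr Config; lia.
  + by rewrite upd_lt // f1.
  + by rewrite upd_eq.
Qed.

(** Variables live in the registers of the same number.  Values stay below [M]
    throughout, so safe operations agree with those of the machine. *)
Lemma compileP s st t st' : run M s st t st' ->
  forall l r, code_at l (compile l s) -> wf s -> agree r st -> bounded st ->
  exists r', [/\ reach t (Config l r st.2) (Config (l + slen s) r' st'.2),
    agree r' st' & bounded st'].
Proof.
elim=> {s st t st'}.
- move=> x e st he l r /= /code_at_cat[Pe Px] /andP[hx hw] hr hb.
  rewrite size_cexp in Px.
  have [r1 [R1 f1 v1]] := cexpP Pe (leqnn _) hw hr hb he.
  exists (upd r1 x (eval st e)); split.
  + apply: reach_trans R1 _; have := reach1 r1 st.2 Px; rewrite /= lor_diag v1.
    by congr reach; congr Config; lia.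
  + by move=> y yj; rewrite /= /upd; case: eqP => // _; rewrite f1 ?hr.
  + split=> [y|a] /=; last by case: hb.
    by rewrite /upd; case: eqP => _; [exact: eval_bounded | case: hb].
- move=> a e st ha he l r /= /code_at_cat[Pa /code_at_cat[Pe Px]] /andP[wa we] hr hb.
  rewrite !size_cexp in Pe Px.
  have [r1 [R1 f1 v1]] := cexpP Pa (leqnn _) wa hr hb ha.
  have hr1 : agree r1 st by move=> x xj; rewrite f1 ?hr.
  have [r2 [R2 f2 v2]] := cexpP Pe (leqnSn _) we hr1 hb he.
  exists r2; split.
  + have -> : elen a + elen e + 1 = elen a + (elen e + 1) by lia.
    apply: reach_trans R1 (reach_trans R2 _).
    have := reach1 r2 st.2 Px; rewrite /= v2 f2 // v1.
    by congr reach; congr Config; lia.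
  + by move=> y yj /=; rewrite f2 ?f1 ?hr //; lia.
  + split=> [y|b] /=; first by case: hb.
    by rewrite /upd; case: eqP => _; [exact: eval_bounded | case: hb].
- move=> s1 s2 st1 st2 st3 t1 t2 _ IH1 _ IH2 l r /=.
  move=> /code_at_cat[P1 P2] /andP[w1 w2] hr hb; rewrite size_comp in P2.
  have [r1 [R1 a1 b1]] := IH1 _ _ P1 w1 hr hb.
  have [r2 [R2 a2 b2]] := IH2 _ _ P2 w2 a1 b1.
  by exists r2; split=> //; rewrite addnA; apply: reach_trans R1 R2.
- move=> e s st he e0 l r /= /code_at_cat[Pe /(code_at_cat (c1 := [:: _]))[Pj _]].
  move=> /andP[we ws] hr hb; rewrite size_cexp in Pj.
  have [r1 [R1 f1 v1]] := cexpP Pe (leqnn _) we hr hb he.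
  exists r1; split=> //; last by move=> x xj; rewrite f1 ?hr.
  apply: reach_trans R1 _; have := reach1 r1 st.2 Pj; rewrite /= v1 e0 eqxx.
  by congr reach; congr Config; lia.
- move=> e s st st' t he e0 _ IH l r /= /code_at_cat[Pe /(code_at_cat (c1 := [:: _]))[Pj Ps]].
  move=> /andP[we ws] hr hb; rewrite size_cexp /= in Pj Ps.
  have [r1 [R1 f1 v1]] := cexpP Pe (leqnn _) we hr hb he.
  have hr1 : agree r1 st by move=> x xj; rewrite f1 ?hr.
  have [r2 [R2 a2 b2]] := IH _ _ Ps ws hr1 hb.
  exists r2; split=> //.
  rewrite -addnA; apply: reach_trans R1 _; apply: reach_trans (reach1 r1 st.2 Pj) _.
  rewrite /= v1 (negPf e0).
  by move: R2; congr reach; congr Config; lia.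
- move=> e s st he e0 l r /= /code_at_cat[Pe /(code_at_cat (c1 := [:: _]))[Pj _]].
  move=> /andP[we ws] hr hb; rewrite size_cexp in Pj.
  have [r1 [R1 f1 v1]] := cexpP Pe (leqnn _) we hr hb he.
  exists r1; split=> //; last by move=> x xj; rewrite f1 ?hr.
  apply: reach_trans R1 _; have := reach1 r1 st.2 Pj; rewrite /= v1 e0 eqxx.
  by congr reach; congr Config; lia.
- move=> e s st st1 st2 t1 t2 he e0 _ IH1 _ IH2 l r hP hw hr hb.
  have := hP => /= /code_at_cat[Pe /(code_at_cat (c1 := [:: _]))[Pj]].
  move=> /code_at_cat[Ps /(code_at_cat (c1 := [:: _]))[Pz Pl]].
  have /= /andP[we ws] := hw; rewrite size_comp size_cexp /= in Pj Ps Pz Pl.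
  have [r1 [R1 f1 v1]] := cexpP Pe (leqnn _) we hr hb he.
  have hr1 : agree r1 st by move=> x xj; rewrite f1 ?hr.
  have [r2 [R2 a2 b2]] := IH1 _ _ Ps ws hr1 hb.
  pose r3 := upd r2 tmp 0.
  have hr3 : agree r3 st1 by move=> x xj; rewrite /r3 upd_lt // a2.
  have [r4 [R4 a4 b4]] := IH2 l r3 hP hw hr3 b2.
  exists r4; split=> //.
  rewrite -addnA; apply: reach_trans R1 _; apply: reach_trans (reach1 r1 st.2 Pj) _.
  rewrite /= v1 (negPf e0); move: R2; rewrite {1}addn1 => R2.
  apply: reach_trans R2 _.
  have Z := reach1 r2 st1.2 Pz; have J := reach1 r3 st1.2 Pl.
  rewrite /= mod0n in Z; rewrite /= in J.
  apply: reach_trans R4; rewrite -[2]/(1 + 1); apply: reach_trans J.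
  by move: Z; congr reach; congr Config; lia.
Qed.

End Compilation.

(** * Reasoning about structured programs *)

Fixpoint mods (s : stmt) : seq nat :=
  match s with
  | Asg x _ => [:: x]
  | Sto _ _ => [::]
  | Seq s1 s2 => mods s1 ++ mods s2
  | When _ s | While _ s => mods s
  end.

Definition frame (X : seq nat) (st st' : state) : Prop :=
  forall x, x \notin X -> st'.1 x = st.1 x.

Lemma run_frame M s st t st' : run M s st t st' -> frame (mods s) st st'.
Proof.
elim=> {s st t st'} //=.
- by move=> x e st _ y; rewrite inE /= /upd => /negPf ->.
- move=> s1 s2 st1 st2 st3 t1 t2 _ IH1 _ IH2 x.
  by rewrite mem_cat negb_or => /andP[x1 x2]; rewrite IH2 // IH1.
- by move=> e s st st1 st2 t1 t2 _ _ _ IH1 _ IH2 x xs; rewrite IH2 // IH1.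
Qed.

Definition For (i b : nat) (s : stmt) : stmt :=
  Seq (Asg i (Cst 0))
    (While (Bin Lt (Var i) (Var b)) (Seq s (Asg i (Bin Add (Var i) (Cst 1))))).

Section Rules.
Variable M : nat.

(** Total correctness; the postcondition also sees the running time. *)
Definition tri (s : stmt) (st : state) (Q : nat -> state -> Prop) : Prop :=
  exists t st', run M s st t st' /\ Q t st'.

Implicit Types (Q : nat -> state -> Prop) (st : state).

Lemma tri_conseq s st Q Q' : tri s st Q ->
  (forall t st', frame (mods s) st st' -> Q t st' -> Q' t st') -> tri s st Q'.
Proof.
by move=> [t [st' [r q]]] h; exists t, st'; split=> //; apply: h q; apply: run_frame r.
Qed.

Lemma tri_seq s1 s2 st Q :
  tri s1 st (fun t1 st1 => tri s2 st1 (fun t2 => Q (t1 + t2))) ->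
  tri (Seq s1 s2) st Q.
Proof.
move=> [t1 [st1 [r1 [t2 [st2 [r2 q]]]]]].
by exists (t1 + t2), st2; split=> //; apply: RunSeq r1 r2.
Qed.

Lemma tri_asg x e v st Q : safe M st e -> eval st e = v ->
  Q (elen e + 1) (set_var st x v) -> tri (Asg x e) st Q.
Proof. by move=> hs <- q; exists (elen e + 1), (set_var st x (eval st e)); split=> //; apply: RunAsg. Qed.

Lemma tri_sto a e u v st Q : safe M st a -> safe M st e -> eval st a = u -> eval st e = v ->
  Q (elen a + elen e + 1) (set_mem st u v) -> tri (Sto a e) st Q.
Proof.
move=> ha he <- <- q.
by exists (elen a + elen e + 1), (set_mem st (eval st a) (eval st e)); split=> //; apply: RunSto.
Qed.

Lemma tri_asgS x e v s st Q : safe M st e -> eval st e = v ->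
  tri s (set_var st x v) (fun t => Q (elen e + 1 + t)) -> tri (Seq (Asg x e) s) st Q.
Proof. by move=> hs hv h; apply: tri_seq; apply: tri_asg hs hv h. Qed.

Lemma tri_stoS a e u v s st Q : safe M st a -> safe M st e -> eval st a = u -> eval st e = v ->
  tri s (set_mem st u v) (fun t => Q (elen a + elen e + 1 + t)) -> tri (Seq (Sto a e) s) st Q.
Proof. by move=> ha he hu hv h; apply: tri_seq; apply: tri_sto ha he hu hv h. Qed.

Lemma tri_when e s st Q : safe M st e ->
  (eval st e = 0 -> Q (elen e + 1) st) ->
  (eval st e != 0 -> tri s st (fun t => Q (elen e + 1 + t))) ->
  tri (When e s) st Q.
Proof.
move=> hs h0 h1; case: (altP (eval st e =P 0)) => [E|E].
  by exists (elen e + 1), st; split; [apply: RunSkip | apply: h0].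
have [t [st' [r q]]] := h1 E.
by exists (elen e + 1 + t), st'; split=> //; apply: RunWhen.
Qed.

Lemma tri_while e s st Q : safe M st e ->
  (eval st e = 0 -> Q (elen e + 1) st) ->
  (eval st e != 0 -> tri s st (fun t1 st1 =>
    tri (While e s) st1 (fun t2 => Q (elen e + 1 + (t1 + (2 + t2)))))) ->
  tri (While e s) st Q.
Proof.
move=> hs h0 h1; case: (altP (eval st e =P 0)) => [E|E].
  by exists (elen e + 1), st; split; [apply: RunExit | apply: h0].
have [t1 [st1 [r1 [t2 [st2 [r2 q]]]]]] := h1 E.
by exists (elen e + 1 + (t1 + (2 + t2))), st2; split=> //; apply: RunLoop r1 r2.
Qed.

Lemma tri_seqF s1 s2 st Q R : tri s1 st R ->
  (forall t st', frame (mods s1) st st' -> R t st' -> tri s2 st' (fun t' => Q (t + t'))) ->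
  tri (Seq s1 s2) st Q.
Proof. by move=> h1 h2; apply: tri_seq; apply: tri_conseq h1 h2. Qed.

(** A counted loop: [Inv j] holds when the counter has reached [j], and [f j]
    bounds the time of the iteration that starts then. *)
Lemma tri_for i b s st N (Inv : nat -> state -> Prop) (f : nat -> nat) Q :
  i \notin mods s -> b \notin i :: mods s -> st.1 b = N -> N < M -> 1 < M ->
  Inv 0 (set_var st i 0) ->
  (forall j st', j < N -> frame (i :: mods s) st st' -> st'.1 i = j -> Inv j st' ->
    tri s st' (fun t st'' => t <= f j /\ Inv j.+1 (set_var st'' i j.+1))) ->
  (forall t st', t <= \sum_(j < N) (f j + 10) + 6 -> frame (i :: mods s) st st' ->
    Inv N st' -> Q t st') ->
  tri (For i b s) st Q.
Proof.
move=> his hb stb NM M1 I0 Istep fin.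
have fr0 : frame (i :: mods s) st (set_var st i 0).
  by move=> x; rewrite inE negb_or => /andP[/negPf xi _]; rewrite /= /upd xi.
apply: (tri_asgS (v := 0)) => //=; first lia.
suff loop z j st' : j + z = N -> frame (i :: mods s) st st' -> st'.1 i = j -> Inv j st' ->
    tri (While (Bin Lt (Var i) (Var b)) (Seq s (Asg i (Bin Add (Var i) (Cst 1))))) st'
      (fun t st'' => [/\ t <= \sum_(j <= j' < N) (f j' + 10) + 4,
         frame (i :: mods s) st st'' & Inv N st'']).
  have [|t [st' [r [ht fr hI]]]] := loop N 0 _ (add0n _) fr0 _ I0; first by rewrite /= /upd eqxx.
  by exists t, st'; split=> //; apply: fin => //; rewrite big_mkord in ht; lia.
elim: z j st' => [|z IH] j st' jz fr sti hI.
  rewrite addn0 in jz; apply: tri_while => //= [E|]; last by rewrite sti fr // stb; lia.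
  by rewrite big_geq ?jz // -jz in hI *.
have jN : j < N by lia.
apply: tri_while => //= [|_]; first by rewrite sti fr // stb jN.
apply: tri_seq; have := Istep j st' jN fr sti hI => h.
apply: (tri_conseq h) => t1 st1 fr1 [ht1 hI1] {h}.
have st1i : st1.1 i = j by rewrite fr1.
apply: (tri_asg (v := j.+1)) => /=; rewrite ?st1i ?addn1 //; first lia.
have fr2 : frame (i :: mods s) st (set_var st1 i j.+1).
  move=> x; rewrite inE negb_or => /andP[/negPf xi xs]; rewrite /= /upd xi.
  by rewrite fr1 // fr // inE xi xs.
have h2 := IH j.+1 (set_var st1 i j.+1) _ fr2 _ hI1.
apply: tri_conseq (h2 _ _) _; rewrite /= ?/upd ?eqxx //; first lia.
move=> t st2 _ [ht2 fr3 hI2]; split=> //.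
by rewrite big_ltn //; lia.
Qed.

End Rules.

(** * The program *)

Declare Scope expr_scope.
Delimit Scope expr_scope with E.
Coercion Var : nat >-> expr.
Notation "a + b" := (Bin Add a b) : expr_scope.
Notation "a - b" := (Bin Sub a b) : expr_scope.
Notation "a * b" := (Bin Mul a b) : expr_scope.
Notation "a / b" := (Bin Div a b) : expr_scope.
Notation "a < b" := (Bin Lt a b) : expr_scope.
Notation "a == b" := (Bin Eq a b) : expr_scope.
Notation "# k" := (Cst k) (at level 1, format "# k") : expr_scope.
Notation "'M[' a ]" := (Fetch a) (format "'M[' a ]") : expr_scope.
Notation "x <~ a" := (Asg x a%E) (at level 90).
Notation "'M[' a ] <~ b" := (Sto a%E b%E) (at level 90, a at level 200).
Notation "s ;; t" := (Seq s t) (at level 95, right associativity).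

(* Registers that stay fixed once set up. *)
Local Notation xn := 0 (only parsing).    Local Notation xe := 1 (only parsing).
Local Notation xk := 2 (only parsing).    Local Notation xpk := 3 (only parsing).
Local Notation xne := 4 (only parsing).   Local Notation xnb := 5 (only parsing).
Local Notation xhd := 6 (only parsing).   Local Notation xnx := 7 (only parsing).
Local Notation xout := 8 (only parsing).
(* Registers of the main loops. *)
Local Notation xp := 9 (only parsing).    Local Notation xcnt := 10 (only parsing).
Local Notation xmu := 11 (only parsing).  Local Notation xb := 12 (only parsing).
Local Notation xa := 13 (only parsing).   Local Notation xt := 14 (only parsing).
Local Notation xi := 15 (only parsing).   Local Notation xx := 16 (only parsing).
Local Notation xok := 17 (only parsing).  Local Notation xtop := 18 (only parsing).
Local Notation xblk := 19 (only parsing). Local Notation xbel := 20 (only parsing).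
Local Notation xu := 21 (only parsing).   Local Notation xr := 22 (only parsing).
Local Notation xmask := 23 (only parsing). Local Notation xj := 24 (only parsing).
Local Notation xpw := 25 (only parsing).  Local Notation xs := 26 (only parsing).
Local Notation xptr := 27 (only parsing). Local Notation xp0 := 28 (only parsing).
Local Notation xbs := 29 (only parsing).  Local Notation xlg := 30 (only parsing).
Local Notation xlglg := 31 (only parsing). Local Notation xy := 32 (only parsing).

Definition log_code (x l : nat) : stmt :=
  xy <~ x ;; l <~ #0 ;; While (#1 < xy)%E (xy <~ xy / #2 ;; l <~ l + #1).

Definition power_code (x b i m : nat) : stmt :=
  x <~ #1 ;; For i m (x <~ x * b).

Definition setup_code (e : nat) : stmt :=
  log_code xn xlg ;; log_code xlg xlglg ;;
  xk <~ xlg - (xlglg + xlglg) ;;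
  xe <~ #e ;;
  xu <~ #2 ;; power_code xpk xu xi xk ;;
  power_code xne xn xi xe ;;
  xnb <~ xn / xk + #1 ;;
  xhd <~ xne * (xn * xn) ;;
  xnx <~ xhd + xn ;;
  xout <~ xnx + (xn + #1) ;;
  xp <~ xout + #1 ;; xcnt <~ #0.

(** One pass through the digits of the tuple decides whether it is increasing, and
    finds its end, the sum of its block indices and the rank of [a]. *)
Definition digits_code : stmt :=
  xx <~ xmu ;; xok <~ #1 ;; xtop <~ #0 ;; xblk <~ #0 ;; xbel <~ #0 ;;
  For xi xe (
    xu <~ xx - xx / xn * xn ;; xx <~ xx / xn ;;
    xok <~ xok * (xtop < xu + #1) ;; xtop <~ xu + #1 ;;
    xblk <~ xblk + xu / xk ;; xbel <~ xbel + (xu < xa)).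

Definition check_code (d : nat) : stmt :=
  xr <~ xblk + xa / xk + xb ;; xr <~ xr - xr / #d * #d ;; xmask <~ #0 ;;
  xu <~ xok * ((xtop < xbs + xk) *
    (#0 < (xbel + (xbs < xa) == xr) + (xbel + (xbs + (xk - #1) < xa) == xr))).

(** Beyond the last vertex the word that is read is not part of the input, but it
    is multiplied by 0. *)
Definition mask_code : stmt :=
  xpw <~ #1 ;; xs <~ xbs ;;
  For xj xk (
    xmask <~ xmask + (((xs < xn) * ((xtop < xs + #1) * (xbel + (xs < xa) == xr))) *
       M[xmu + xne * (xa + xn * xs)]) * xpw ;;
    xpw <~ xpw + xpw ;; xs <~ xs + #1).

(** The successor cell of [a] is indexed by [a + 1], since 0 marks the end of a list. *)
Definition push_code : stmt :=
  M[xnx + (xa + #1)] <~ M[xhd + xmask] ;; M[xhd + xmask] <~ xa + #1.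

Definition vertex_code (d : nat) : stmt :=
  digits_code ;; check_code d ;; When xu mask_code ;; When xmask push_code.

Definition emit_tuple_code : stmt :=
  xx <~ xmu ;;
  For xi xe (M[xp] <~ #1 ;; M[xp + #1] <~ xx - xx / xn * xn ;;
    xx <~ xx / xn ;; xp <~ xp + #2).

(** The size is written when the length of the list is known. *)
Definition emit_members_code : stmt :=
  xp0 <~ xp ;; xp <~ xp + #1 ;;
  While xptr (M[xp] <~ xptr - #1 ;; xp <~ xp + #1 ;; xptr <~ M[xnx + xptr]) ;;
  M[xp0] <~ xp - (xp0 + #1).

(** Every vertex of the block is written, but the output pointer advances only if
    its bit is set; otherwise the next write overwrites it. *)
Definition emit_block_code : stmt :=
  xp0 <~ xp ;; xp <~ xp + #1 ;; xx <~ xt ;; xs <~ xbs ;;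
  For xj xk (M[xp] <~ xs ;; xp <~ xp + (xx - xx / #2 * #2) ;;
    xx <~ xx / #2 ;; xs <~ xs + #1) ;;
  M[xp0] <~ xp - (xp0 + #1).

Definition bucket_code : stmt :=
  xptr <~ M[xhd + xt] ;;
  When xptr (M[xhd + xt] <~ #0 ;; xcnt <~ xcnt + #1 ;;
    emit_tuple_code ;; emit_members_code ;; emit_block_code).

Definition block_code (d : nat) : stmt :=
  xbs <~ xb * xk ;; For xa xn (vertex_code d) ;; For xt xpk bucket_code.

(** The cell before the first clique receives their number last. *)
Definition main_code (d : nat) : stmt :=
  setup_code d.-2 ;; For xmu xne (For xb xnb (block_code d)) ;;
  M[xout] <~ xcnt ;; xn <~ xout.

Lemma wf_main d : wf (main_code d).
Proof. by []. Qed.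

Local Arguments digs : simpl never.

Ltac lk := rewrite /set_var /set_mem /=.

Section Verification.
Variables (e n k M : nat).
Hypothesis n_gt0 : 0 < n.
Hypothesis k_gt0 : 0 < k.
Hypothesis k_small : 2 ^ k <= n.
Variable H : hypergraph e.+2 'I_n.
Let d := e.+2.
Let D := n ^ e * (n * n).
Let nb := n_blocks n k.
Variable out_max : nat.
Hypothesis M_big : 16 * (e.+2 * D) + out_max < M.

(** The values of registers 0 to 8 after the setup. *)
Definition consts : seq nat :=
  [:: n; e; k; 2 ^ k; n ^ e; nb; D; D + n; D + n + (n + 1)].

Definition ready (st : state) : Prop := forall x, x < 9 -> st.1 x = nth 0 consts x.

Lemma ready_frame X st st' : frame X st st' -> ready st -> all (fun x => 8 < x) X -> ready st'.
Proof.
move=> fr hr /allP hX x x9; rewrite fr ?hr //.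
by apply/negP => /hX; rewrite ltnNge -ltnS x9.
Qed.

Lemma k_lt_n : k < n.
Proof. by apply: leq_trans k_small; apply: ltn_expl. Qed.

Lemma ne_gt0 : 0 < n ^ e. Proof. by rewrite expn_gt0 n_gt0. Qed.

Lemma bounds : [/\ n <= D, n * n <= D, n ^ e <= D, n ^ e * n <= D
  & [/\ n + k < M, 1 < M, e * n < M & 4 * D + 4 * n + 4 * k + 4 * e < M] ].
Proof.
have ne0 := ne_gt0; have kn := k_lt_n.
have h1 : n <= n * n by rewrite leq_pmull.
have h2 : n * n <= D by rewrite /D leq_pmull.
have h3 : n ^ e * n <= D by rewrite /D leq_mul2l h1 orbT.
have h4 : n ^ e <= n ^ e * n by rewrite leq_pmulr.
have h5 : e * n <= e * D by rewrite leq_mul2l (leq_trans h1 h2) orbT.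
have h6 : e <= e * D by rewrite leq_pmulr //; lia.
by split; rewrite ?andbT; [lia|lia|lia|lia|split; lia].
Qed.

Lemma ready_set st x v : ready st -> 8 < x -> ready (set_var st x v).
Proof. by move=> hr x8 y y9; lk; rewrite (ltn_eqF (leq_trans y9 x8)) hr. Qed.

Lemma ready_mem st a v : ready st -> ready (set_mem st a v).
Proof. by []. Qed.

Ltac rdy := do ?[by [] | apply: ready_set => // | apply: ready_mem].

Lemma boolM (b : bool) : b < M.
Proof. by have [_ _ _ _ [_ ? _ _]] := bounds; case: b; lia. Qed.

Lemma blocks_le j mu : blocks k (digs n j mu) <= j * n.
Proof.
rewrite -{2}(size_digs n j mu) /blocks; have := digs_lt j mu n_gt0.
elim: (digs n j mu) => //= u l IH /andP[un /IH hl]; rewrite mulSn leq_add //.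
by apply: leq_trans (leq_div _ _) (ltnW un).
Qed.

Lemma below_le j mu a : below a (digs n j mu) <= j.
Proof. by rewrite -{2}(size_digs n j mu) count_size. Qed.

Lemma top_le j mu : top (digs n j mu) <= n.
Proof.
have := digs_lt j mu n_gt0; case: (lastP (digs n j mu)) => // l x.
by rewrite all_rcons top_rcons => /andP[].
Qed.

Lemma digits_spec mu a st : mu < n ^ e -> ready st -> st.1 xmu = mu -> st.1 xa = a ->
  tri M digits_code st (fun t st' => t <= 60 * e.+1 /\
    let U := digs n e mu in
    [/\ st'.2 = st.2, st'.1 xok = sorted ltn U, st'.1 xtop = top U,
     st'.1 xblk = blocks k U & st'.1 xbel = below a U]).
Proof.
move=> hmu hr hm ha; have [nD nnD neD nenD [nkM M1 enM big]] := bounds.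
apply: (tri_asgS (v := mu)) => //=.
apply: (tri_asgS (v := 1)) => //=.
apply: (tri_asgS (v := 0)) => //=; first lia.
apply: (tri_asgS (v := 0)) => //=; first lia.
apply: (tri_asgS (v := 0)) => //=; first lia.
set st0 := (X in tri _ _ X _).
have hr0 : ready st0 by rdy.
apply: (tri_for (N := e) (f := fun=> 40) (Inv := fun j st' =>
   [/\ st'.2 = st.2, st'.1 xx = mu %/ n ^ j, st'.1 xok = sorted ltn (digs n j mu),
    st'.1 xtop = top (digs n j mu) & st'.1 xblk = blocks k (digs n j mu) /\
    st'.1 xbel = below a (digs n j mu)])) => //.
- by rewrite hr0.
- lia.
- by split; lk => //; rewrite expn0 divn1.
- move=> j st1 je fr sti [m1 x1 ok1 top1 [blk1 bel1]].
  have hr1 : ready st1 by apply: ready_frame fr hr0 isT.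
  have N : st1.1 xn = n by rewrite hr1.
  have K : st1.1 xk = k by rewrite hr1.
  have A : st1.1 xa = a by rewrite fr.
  pose v := (mu %/ n ^ j) %% n.
  have vn : v < n by rewrite ltn_mod.
  have xM : mu %/ n ^ j <= D by apply: leq_trans (leq_div _ _) (leq_trans (ltnW hmu) neD).
  have jn : j.+1 * n < M by apply: leq_ltn_trans enM; rewrite leq_mul2r je orbT.
  have bl := blocks_le j mu; have be := below_le j mu a.
  have vk : v %/ k <= n by apply: leq_trans (leq_div _ _) (ltnW vn).
  have xE : mu %/ n ^ j = mu %/ n ^ j %/ n * n + v := divn_eq _ _.
  have [U eU] : exists U, U = digs n j.+1 mu by eexists.
  move: (eU); rewrite digs_rcons -/v => eU'.
  apply: (tri_asgS (v := v)); [by lk; rewrite x1 N; lia | by lk; rewrite x1 N; lia | ].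
  apply: (tri_asgS (v := mu %/ n ^ j.+1)); [by [] | by lk; rewrite x1 N expnSr divnMA | ].
  apply: (tri_asgS (v := sorted ltn U)).
  + by lk; rewrite ok1 top1 mulnb boolM andbT; lia.
  + by lk; rewrite ok1 top1 eU' sorted_rcons_top addn1 ltnS; case: sorted; rewrite ?mul1n.
  apply: (tri_asgS (v := top U)); [by lk; lia | by lk; rewrite eU' top_rcons addn1 | ].
  apply: (tri_asgS (v := blocks k U)); [by lk; rewrite blk1 K; lia | | ].
    by lk; rewrite blk1 K eU' blocks_rcons.
  apply: (tri_asg (v := below a U)); [by lk; rewrite bel1 A; lia | | ].
    by lk; rewrite bel1 A eU' below_rcons.
  by rewrite -eU'; lk.
- move=> t st' ht _ [m1 x1 ok1 top1 [blk1 bel1]]; split=> //.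
  by move: ht; rewrite sum_nat_const card_ord; lia.
Qed.

Lemma block_le b : b < nb -> b * k <= n.
Proof.
rewrite /nb /n_blocks addn1 ltnS => h; apply: leq_trans (leq_divM n k).
by rewrite leq_mul2r h orbT.
Qed.

Lemma check_spec a b (ok : bool) tp B L st : a < n -> b < nb -> ready st ->
  tp <= n -> B <= e * n -> L <= e ->
  st.1 xa = a -> st.1 xb = b -> st.1 xbs = b * k -> st.1 xok = ok ->
  st.1 xtop = tp -> st.1 xblk = B -> st.1 xbel = L ->
  tri M (check_code d) st (fun t st' => t <= 60 /\
    let r := (B + a %/ k + b) %% d in
    [/\ st'.2 = st.2, st'.1 xr = r, st'.1 xmask = 0
    & st'.1 xu = [&& ok, tp < b * k + k
        & (L + (b * k < a) == r) || (L + (b * k + k.-1 < a) == r)]]).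
Proof.
move=> an hb hr htp hB hL ha hxb hbs hok hxt hxB hxL.
have [nD nnD neD nenD [nkM M1 enM big]] := bounds.
have bk := block_le hb; have kn := k_lt_n.
have N : st.1 xn = n := hr 0 isT.
have K : st.1 xk = k := hr 2 isT.
have ak : a %/ k <= n by apply: leq_trans (leq_div _ _) (ltnW an).
have bn : b <= n by apply: leq_trans bk; rewrite leq_pmulr.
have eD : e * n <= e * D by rewrite leq_mul2l nD orbT.
pose z := B + a %/ k + b; have zE : z = z %/ d * d + z %% d := divn_eq _ _.
have dM : d < M by rewrite /d; lia.
apply: (tri_asgS (v := z)); [by lk; rewrite hxB hxb ha K; lia | by lk; rewrite hxB hxb ha K | ].
apply: (tri_asgS (v := z %% d)); [by lk; move: zE dM; rewrite /d; lia | by lk; move: zE; rewrite /d; lia | ].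
set r := z %% d.
apply: (tri_asgS (v := 0)); [by lk; lia | by [] | ].
apply: (tri_asg (v := [&& ok, tp < b * k + k
        & (L + (b * k < a) == r) || (L + (b * k + k.-1 < a) == r)])).
- lk; rewrite hbs hxL ha K hok hxt !mulnb !boolM.
  have -> : 0 < M by lia.
  have -> : k - 1 = k.-1 by lia.
  have s2 (x y : bool) : x + y < M by case: x; case: y; lia.
  by rewrite s2; case: (b * k < a); case: (b * k + k.-1 < a) => /=; lia.
- lk; rewrite hbs hxL ha K hok hxt !mulnb subn1.
  have s2 (x y : bool) : (0 < x + y) = x || y by case: x; case: y.
  by rewrite s2.
by lk; split; last by split.
Qed.

Definition cell (x : nat) : bool := vs n (digs n d x) \in edges H.
Definition inp (m : nat -> nat) : Prop := forall x, x < D -> m x = cell x.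

Lemma address_lt mu a s : mu < n ^ e -> a < n -> s < n -> mu + n ^ e * (a + n * s) < D.
Proof.
move=> hmu an sn; have h : a + n * s < n * n.
  apply: (@leq_trans (n * s.+1)); first by rewrite mulnS ltn_add2r.
  by rewrite leq_mul2l sn orbT.
apply: (@leq_trans (n ^ e * (a + n * s).+1)); first by rewrite mulnS ltn_add2r.
by rewrite leq_mul2l h orbT.
Qed.

Lemma cellE mu a s : mu < n ^ e -> a < n -> s < n ->
  cell (mu + n ^ e * (a + n * s)) = (vs n (a :: rcons (digs n e mu) s) \in edges H).
Proof.
move=> hmu an sn; have E : digs n d (mu + n ^ e * (a + n * s)) = digs n e mu ++ [:: a; s].
  rewrite /d -addn2 digs_cat // /digs mulnC addnC modnMDl divnMDl //.
  by rewrite divn_small // addn0 !modn_small.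
have -> : vs n (a :: rcons (digs n e mu) s) = vs n (digs n e mu ++ [:: a; s]).
  by apply: vs_perm; rewrite -cats1 -cat1s perm_catCA perm_refl.
by rewrite /cell E.
Qed.

Lemma mask_spec mu a b st : mu < n ^ e -> a < n -> b < nb -> ready st -> inp st.2 ->
  let U := digs n e mu in sorted ltn U ->
  st.1 xmu = mu -> st.1 xa = a -> st.1 xbs = b * k -> st.1 xtop = top U ->
  st.1 xbel = below a U -> st.1 xr = (blocks k U + a %/ k + b) %% d -> st.1 xmask = 0 ->
  tri M mask_code st (fun t st' =>
    [/\ t <= 100 * k + 20, st'.2 = st.2 & st'.1 xmask = nbr_mask k H mu b a]).
Proof.
move=> hmu an hb hr hm U sU hxm ha hbs hxt hxL hxr hmask.
have [nD nnD neD nenD [nkM M1 enM big]] := bounds.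
have bk := block_le hb; have kn := k_lt_n.
apply: (tri_asgS (v := 1)) => //=.
apply: (tri_asgS (v := b * k)) => //=.
set st0 := (X in tri _ _ X _).
have hr0 : ready st0 by rdy.
pose f j := bit k H mu a (b * k + j).
apply: (tri_for (N := k) (f := fun=> 80) (Inv := fun j st' =>
   [/\ st'.2 = st.2, st'.1 xmask = mask_of f j, st'.1 xpw = 2 ^ j & st'.1 xs = b * k + j])) => //.
- by rewrite hr0.
- by lia.
- by split; lk; rewrite ?hmask ?addn0 // /mask_of big_ord0.
- move=> j st1 jk fr sti [m1 mk1 pw1 s1].
  have hr1 : ready st1 by apply: ready_frame fr hr0 isT.
  have N : st1.1 xn = n := hr1 0 isT.
  have NE : st1.1 xne = n ^ e := hr1 4 isT.
  have A : st1.1 xa = a by rewrite fr.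
  have MU : st1.1 xmu = mu by rewrite fr.
  have T : st1.1 xtop = top U by rewrite fr.
  have L : st1.1 xbel = below a U by rewrite fr.
  have R : st1.1 xr = (blocks k U + a %/ k + b) %% d by rewrite fr.
  have pwn : 2 ^ j.+1 <= n by apply: leq_trans k_small; rewrite leq_exp2l.
  have ml := mask_of_lt f j.+1; have mS := mask_ofS f j.
  rewrite expnS in pwn ml; have pw0 : 0 < 2 ^ j by rewrite expn_gt0.
  set s := b * k + j in s1.
  have hs : s <= 2 * n by rewrite /s; lia.
  have ad : mu + n ^ e * (a + n * s) <= 4 * D.
    have h : n ^ e * (a + n * s) <= n ^ e * (n + n * (2 * n)).
      by rewrite leq_mul2l leq_add ?orbT ?(ltnW an) // leq_mul2l hs orbT.
    by move: h nenD; rewrite /D; lia.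
  have ns : n * s <= 2 * D.
    apply: (@leq_trans (n * (2 * n))); first by rewrite leq_mul2l hs orbT.
    by rewrite mulnCA leq_mul2l nnD.
  have beM : below a U + 1 < M.
    by have := below_le e mu a; rewrite -/U; lia.
  have ld : ((s < n) && ((top U < s + 1) && (below a U + (s < a) == (blocks k U + a %/ k + b) %% d)))
      * st1.2 (mu + n ^ e * (a + n * s)) = f j.
    (* If [s >= n] both sides are 0, whatever is read. *)
    rewrite m1 /f /bit -/s; case: (ltnP s n) => sn //=.
    have -> : role e k (rcons (digs n e mu) s) a =
        (top U <= s) && (below a U + (s < a) == (blocks k U + a %/ k + b) %% d).
      by rewrite /s role_rcons //= (sU : is_true (sorted ltn (digs n e mu))).
    by rewrite hm ?address_lt // cellE // addn1 ltnS mulnb.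
  have s1M : s + 1 < M by clear -hs big n_gt0; lia.
  have beM' : below a U + (s < a) < M by clear -beM; case: (s < a); lia.
  have fM : f j * 2 ^ j < M by clear -pwn nkM pw0; case: (f j); lia.
  have maskM : mask_of f j.+1 < M by clear -ml pwn nkM; lia.
  have nsM : n * s < M by clear -ns big; lia.
  have adM1 : a + n * s < M by clear -an ns big; lia.
  have adM3 : mu + n ^ e * (a + n * s) < M by clear -ad big; lia.
  have adM2 : n ^ e * (a + n * s) < M by clear -adM3; lia.
  apply: (tri_asgS (v := mask_of f j.+1)).
  + lk; rewrite s1 N T L A R MU NE mk1 pw1 !mulnb !boolM ld.
    by rewrite -mS maskM fM s1M nsM adM1 adM2 adM3 M1 beM' boolM.
  + by lk; rewrite s1 N T L A R MU NE mk1 pw1 !mulnb ld mS.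
  apply: (tri_asgS (v := 2 ^ j.+1)).
  + by lk; rewrite pw1; lia.
  + by lk; rewrite pw1 expnS; lia.
  apply: (tri_asg (v := s.+1)).
  + by lk; rewrite s1 s1M M1.
  + by lk; rewrite s1 addn1.
  by lk; split; last by split; rewrite // addnS.
- move=> t st' ht _ [m1 mk1 _ _]; split=> //.
  by move: ht; rewrite sum_nat_const card_ord /=; lia.
Qed.

End Verification.

Ltac rdy := do ?[by [] | apply: ready_set => // | apply: ready_mem].

(** * Buckets *)

Lemma upd_neq f x v y : y != x -> upd f x v y = f y.
Proof. by rewrite /upd => /negPf ->. Qed.

Section Chains.
Variable nx : nat.

(** The linked list with successor cells [nx + 1, nx + 2 ..] that starts at [p]. *)
Fixpoint chain (m : nat -> nat) (p : nat) (l : seq nat) : Prop :=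
  if l is v :: l' then p = v.+1 /\ chain m (m (nx + v.+1)) l' else p = 0.

Lemma eq_chain m m' p l : (forall v, v \in l -> m' (nx + v.+1) = m (nx + v.+1)) ->
  chain m p l -> chain m' p l.
Proof.
elim: l p => //= v l IH p h [pv c]; split=> //.
by rewrite h ?mem_head //; apply: IH c => u ul; rewrite h // inE ul orbT.
Qed.

End Chains.

Definition holds (m : nat -> nat) (B : nat) (l : seq nat) : Prop :=
  forall i, i < size l -> m (B + i) = nth 0 l i.

Lemma holds_eq m m' B l : (forall x, B <= x < B + size l -> m' x = m x) ->
  holds m B l -> holds m' B l.
Proof. by move=> h hl i il; rewrite h ?hl //; lia. Qed.

Lemma holds_rcons m B l v : holds m B l -> holds (upd m (B + size l) v) B (rcons l v).
Proof.
move=> h i; rewrite size_rcons ltnS leq_eqVlt nth_rcons /upd eqn_add2l.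
case: eqP => [-> _|_ /= il]; first by rewrite ltnn.
by rewrite il h.
Qed.

Section Buckets.
Variables (e n k M : nat).
Hypothesis n_gt0 : 0 < n.
Hypothesis k_gt0 : 0 < k.
Hypothesis k_small : 2 ^ k <= n.
Variable H : hypergraph e.+2 'I_n.
Let d := e.+2.
Let D := n ^ e * (n * n).
Let nb := n_blocks n k.
Variable out_max : nat.
Hypothesis M_big : 16 * (e.+2 * D) + out_max < M.
Let B := D + n + (n + 1) + 1.
Let nx := D + n.

(** Mask 0 has no list. *)
Definition bucket (mu b A t : nat) : seq nat :=
  if t == 0 then [::] else rev [seq a <- iota 0 A | nbr_mask k H mu b a == t].

Lemma bucketS mu b A t : bucket mu b A.+1 t =
  if (nbr_mask k H mu b A == t) && (t != 0) then A :: bucket mu b A t else bucket mu b A t.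
Proof.
rewrite /bucket; case: (t == 0); first by rewrite andbF.
by rewrite -addn1 iotaD filter_cat rev_cat andbT /=; case: ifP.
Qed.

Lemma mem_bucket mu b A t a : a \in bucket mu b A t -> a < A.
Proof. by rewrite /bucket; case: ifP => // _; rewrite mem_rev mem_filter mem_iota => /andP[]. Qed.

Definition buckets (m : nat -> nat) (mu b A : nat) : Prop :=
  forall t, t < 2 ^ k -> chain nx m (m (D + t)) (bucket mu b A t).

Lemma push_spec mu a b out st : a < n -> ready e n k st -> st.1 xa = a ->
  st.1 xmask = nbr_mask k H mu b a -> nbr_mask k H mu b a != 0 ->
  inp H st.2 -> buckets st.2 mu b a -> holds st.2 B out ->
  tri M push_code st (fun t st' => [/\ t <= 30, inp H st'.2,
    buckets st'.2 mu b a.+1 & holds st'.2 B out]).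
Proof.
move=> an hr ha hmask m0 hi hb ho; set v := nbr_mask k H mu b a in hmask m0.
have [nD nnD neD nenD [nkM M1 enM big]] := bounds n_gt0 k_gt0 k_small M_big.
rewrite -/D in nD nnD neD nenD big.
have vk : v < 2 ^ k by apply: mask_of_lt.
have vn : v < n := leq_trans vk k_small.
have HD : st.1 xhd = D := hr 6 isT.
have NX : st.1 xnx = nx := hr 7 isT.
apply: (tri_stoS (u := nx + a.+1) (v := st.2 (D + v))).
- by lk; rewrite NX ha /nx; lia.
- by lk; rewrite HD hmask; lia.
- by lk; rewrite NX ha addn1.
- by lk; rewrite HD hmask.
apply: (tri_sto (u := D + v) (v := a.+1)).
- by lk; rewrite HD hmask; lia.
- by lk; rewrite ha; lia.
- by lk; rewrite HD hmask.
- by lk; rewrite ha addn1.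
lk; pose m1 := upd st.2 (nx + a.+1) (st.2 (D + v)); pose m2 := upd m1 (D + v) a.+1.
rewrite -/m1 -/m2.
have E x : x != D + v -> x != nx + a.+1 -> m2 x = st.2 x.
  by move=> h1 h2; rewrite /m2 upd_neq // /m1 upd_neq.
split=> //.
- by move=> x xD; rewrite E ?hi // /nx; rewrite -/D in xD; lia.
- move=> t tk; rewrite bucketS -/v.
  have tl := leq_trans tk k_small.
  have c : chain nx m2 (st.2 (D + t)) (bucket mu b a t).
    apply: eq_chain (hb t tk) => u /mem_bucket ua.
    by rewrite E //; rewrite /nx; lia.
  case: (altP (v =P t)) => [vt|vt] /=.
    rewrite -vt m0 /=; split; first by rewrite /m2 /upd eqxx.
    have -> : m2 (nx + a.+1) = st.2 (D + v).
      by rewrite /m2 upd_neq ?/m1 /upd ?eqxx // /nx; lia.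
    by rewrite vt.
  by rewrite E //; rewrite /nx; lia.
- by apply: holds_eq ho => x /andP[xB _]; rewrite E //; move: xB; rewrite /B /nx; lia.
Qed.

Lemma vertex_spec mu a b out st : mu < n ^ e -> a < n -> b < nb -> ready e n k st ->
  st.1 xmu = mu -> st.1 xa = a -> st.1 xb = b -> st.1 xbs = b * k ->
  inp H st.2 -> buckets st.2 mu b a -> holds st.2 B out ->
  tri M (vertex_code d) st (fun t st' =>
    [/\ t <= 180 * e.+1 + 120 * k * qc e n k mu b a, inp H st'.2,
    buckets st'.2 mu b a.+1 & holds st'.2 B out]).
Proof.
move=> hmu an hb hr hxm ha hxb hbs hi hbk ho.
have dig := digits_spec n_gt0 k_gt0 k_small M_big hmu hr hxm ha.
apply: (tri_seqF dig) => t1 st1 fr1 [ht1 [m1 ok1 top1 blk1 bel1]].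
set U := digs n e mu in ok1 top1 blk1 bel1.
have hr1 : ready e n k st1 by apply: ready_frame fr1 hr isT.
have chk := check_spec n_gt0 k_gt0 k_small M_big an hb hr1 (top_le n_gt0 e mu)
  (blocks_le k n_gt0 e mu) (below_le n e mu a).
apply: (tri_seqF (chk _ _ _ _ ok1 top1 blk1 bel1)); try by rewrite fr1.
move=> t2 st2 fr2 [ht2 [m2 r2 mk2 u2]].
have hr2 : ready e n k st2 by apply: ready_frame fr2 hr1 isT.
have eqc : st2.1 xu = qc e n k mu b a by [].
apply: (tri_seqF (R := fun t st' => [/\ t <= 2 + (100 * k + 20) * qc e n k mu b a,
   st'.2 = st.2 & st'.1 xmask = nbr_mask k H mu b a])).
  apply: tri_when => //= [E|E].
    rewrite m2 m1; split=> //; rewrite mk2.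
    by case: (altP (nbr_mask k H mu b a =P 0)) => [//|/(mask_qc n_gt0 k_gt0) Q]; move: E; rewrite eqc Q.
  have sU : sorted ltn U by move: E; rewrite eqc; case: (qc _ _ _ _ _ _) / and3P => // -[].
  have E1 : qc e n k mu b a = true by move: E; rewrite eqc; case: qc.
  have hi2 : inp H st2.2 by rewrite m2 m1.
  have top2 : st2.1 xtop = top U by rewrite fr2.
  have bel2 : st2.1 xbel = below a U by rewrite fr2.
  have mu2 : st2.1 xmu = mu by rewrite fr2 // fr1.
  have a2 : st2.1 xa = a by rewrite fr2 // fr1.
  have bs2 : st2.1 xbs = b * k by rewrite fr2 // fr1.
  have mks := mask_spec n_gt0 k_gt0 k_small M_big hmu an hb hr2 hi2 sU mu2 a2 bs2 top2 bel2 r2 mk2.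
  apply: (tri_conseq mks).
  move=> t st' _ [ht h2 h3]; rewrite E1 h2 m2 m1; split=> //; lia.
move=> t3 st3 fr3 [ht3 m3 mk3].
have hr3 : ready e n k st3 by apply: ready_frame fr3 hr2 isT.
have tt : t1 + t2 + t3 <= 150 * e.+1 + 120 * k * qc e n k mu b a.
  by move: ht1 ht2 ht3 k_gt0; clear; case: qc; lia.
apply: tri_when => //= [E|E].
  rewrite m3; split=> //; first by lia.
  move=> t tk; rewrite bucketS; case: eqP => [tE|_]; last exact: hbk.
  have t0 : t = 0 by rewrite -tE -mk3.
  have -> : (t != 0) = false by rewrite t0.
  by rewrite andbF; apply: hbk.
have ha3 : st3.1 xa = a by rewrite fr3 // fr2 // fr1.
rewrite mk3 in E.
have := push_spec (out := out) an hr3 ha3 mk3 E; rewrite m3 => /(_ hi hbk ho) ps.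
apply: tri_conseq ps _ => t st' _ [h1 h2 h3 h4]; split=> //; lia.
Qed.

End Buckets.

(** * Output *)

Definition low (B : nat) (m m' : nat -> nat) : Prop := forall x, x < B -> m' x = m x.

Lemma low_upd B m m' p v : low B m m' -> B <= p -> low B m (upd m' p v).
Proof. by move=> h Bp x xB; rewrite upd_neq ?h // neq_ltn (leq_trans xB). Qed.

Lemma low_trans B m1 m2 m3 : low B m1 m2 -> low B m2 m3 -> low B m1 m3.
Proof. by move=> h1 h2 x xB; rewrite h2 ?h1. Qed.

Lemma low_le B B' m m' : B' <= B -> low B m m' -> low B' m m'.
Proof. by move=> BB h x xB; apply: h; apply: leq_trans BB. Qed.

Lemma holds_cons m B l v l2 : holds m B l -> m (B + size l) = v ->
  holds m (B + size l).+1 l2 -> holds m B (l ++ v :: l2).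
Proof.
move=> h1 hv h2 i; rewrite size_cat nth_cat /= => il.
case: ltnP => [/h1 //|li]; case E : (i - size l) => [|z].
  by have -> : i = size l by lia.
by rewrite /= -h2; [congr m; lia | lia].
Qed.

Lemma holds_skip m B l v : holds m B l -> holds (upd m (B + size l) v) B l.
Proof. by move=> h i il; rewrite upd_neq ?h // eqn_add2l ltn_eqF. Qed.

Definition tuple_code (U : seq nat) : seq nat := flatten [seq [:: 1; v] | v <- U].

Lemma tuple_code_rcons U v : tuple_code (rcons U v) = tuple_code U ++ [:: 1; v].
Proof. by rewrite /tuple_code map_rcons flatten_rcons. Qed.

Lemma size_tuple_code U : size (tuple_code U) = 2 * size U.
Proof. by elim: U => //= v U IH; rewrite -/(tuple_code U) IH; lia. Qed.

Section Emit.
Variables (e n k M : nat).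
Hypothesis n_gt0 : 0 < n.
Hypothesis k_gt0 : 0 < k.
Hypothesis k_small : 2 ^ k <= n.
Let d := e.+2.
Let D := n ^ e * (n * n).
Let nb := n_blocks n k.
Variable out_max : nat.
Hypothesis M_big : 16 * (e.+2 * D) + out_max < M.
Let B := D + n + (n + 1) + 1.
Let nx := D + n.

Lemma out_lt z : z <= out_max -> B + z < M.
Proof.
have [nD _ _ _ _] := bounds n_gt0 k_gt0 k_small M_big.
have h : D <= e.+2 * D by rewrite leq_pmull.
by move: nD M_big; rewrite -/D /B; lia.
Qed.

Lemma emit_tuple_spec mu l st : mu < n ^ e -> ready e n k st -> st.1 xmu = mu ->
  st.1 xp = B + size l -> size l + 2 * e <= out_max -> holds st.2 B l ->
  tri M emit_tuple_code st (fun t st' => let l' := l ++ tuple_code (digs n e mu) in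
    [/\ t <= 50 * e.+1, st'.1 xp = B + size l', holds st'.2 B l' & low B st.2 st'.2]).
Proof.
move=> hmu hr hxm hp hl ho.
have [nD nnD neD nenD [nkM M1 enM big]] := bounds n_gt0 k_gt0 k_small M_big.
apply: (tri_asgS (v := mu)) => //=.
set st0 := (X in tri _ _ X _); have hr0 : ready e n k st0 by rdy.
pose L j := l ++ tuple_code (digs n j mu).
have sL j : size (L j) = size l + 2 * j by rewrite size_cat size_tuple_code size_digs.
apply: (tri_for (N := e) (f := fun=> 30) (Inv := fun j st' =>
   [/\ st'.1 xx = mu %/ n ^ j, st'.1 xp = B + size (L j), holds st'.2 B (L j)
     & low B st.2 st'.2])) => //.
- by rewrite hr0.
- by lia.
- by rewrite /L /tuple_code cats0 expn0 divn1; split.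
- move=> j st1 je fr sti [x1 p1 h1 lo1].
  have hr1 : ready e n k st1 by apply: ready_frame fr hr0 isT.
  have N : st1.1 xn = n := hr1 0 isT.
  pose v := (mu %/ n ^ j) %% n.
  have xE : mu %/ n ^ j = mu %/ n ^ j %/ n * n + v := divn_eq _ _.
  have xM : mu %/ n ^ j <= D by apply: leq_trans (leq_div _ _) (leq_trans (ltnW hmu) neD).
  have pM : B + (size l + 2 * j + 2) < M.
    by apply: out_lt; lia.
  rewrite sL in p1.
  set p := B + (size l + 2 * j) in p1.
  apply: (tri_stoS (u := p) (v := 1)); [by [] | by lk | by lk | by lk | ].
  apply: (tri_stoS (u := p + 1) (v := v)).
  + by lk; rewrite p1 /p; lia.
  + by lk; rewrite x1 N; lia.
  + by lk; rewrite p1.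
  + by lk; rewrite x1 N; lia.
  apply: (tri_asgS (v := mu %/ n ^ j.+1)); [by [] | by lk; rewrite x1 N expnSr divnMA | ].
  apply: (tri_asg (v := p + 2)); [by lk; rewrite p1 /p; lia | by lk; rewrite p1 | ].
  have h2 : holds (upd (upd st1.2 p 1) (p + 1) v) B (L j.+1).
    rewrite /L digs_rcons tuple_code_rcons catA -/(L j) -/v -cat_rcons cats1.
    have E1 : p = B + size (L j) by rewrite sL.
    have E2 : p + 1 = B + size (rcons (L j) 1) by rewrite size_rcons sL /p; lia.
    by rewrite E2; apply: holds_rcons; rewrite E1; apply: holds_rcons.
  lk; split=> //; split=> //; first by rewrite sL /p; lia.
  by do 2![apply: low_upd; last by rewrite /p; lia].
- move=> t st' ht _ [x1 p1 h1 lo1]; split=> //.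
  by move: ht; rewrite sum_nat_const card_ord /=; lia.
Qed.

(** By induction on the rest [r] of the list, when [q] has been written. *)
Lemma members_loop_spec p0 r q st : ready e n k st -> chain nx st.2 (st.1 xptr) r ->
  all (fun v => v < n) r -> B <= p0 -> p0 + size q + size r + 2 < M ->
  st.1 xp = p0.+1 + size q -> holds st.2 p0.+1 q ->
  tri M (While xptr (M[xp] <~ xptr - #1 ;; xp <~ xp + #1 ;; xptr <~ M[xnx + xptr])) st
    (fun t st' => [/\ t <= 40 * size r + 10, st'.1 xp = p0.+1 + size (q ++ r),
      holds st'.2 p0.+1 (q ++ r) & low p0.+1 st.2 st'.2]).
Proof.
move=> + + + Bp0; elim: r q st => [|v r IH] q st hr hc rn pM hp ho.
  by rewrite cats0; apply: tri_while; rewrite //= hc.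
have [cv c2] := hc; have /= /andP[vn rn2] := rn.
have NX : st.1 xnx = nx := hr 7 isT.
rewrite /= in pM.
apply: tri_while; rewrite //= cv // => _.
have pB : nx + v.+1 < B by rewrite /B /nx; lia.
have vM : nx + v.+1 < M by lia.
apply: (tri_stoS (u := p0.+1 + size q) (v := v)); [by [] | | by lk | by lk; rewrite cv subn1 | ].
  by lk; rewrite cv; lia.
apply: (tri_asgS (v := p0.+1 + size (rcons q v))).
- by lk; rewrite hp; lia.
- by lk; rewrite hp size_rcons; lia.
apply: (tri_asg (v := st.2 (nx + v.+1))).
- by lk; rewrite NX cv.
- by lk; rewrite NX cv upd_neq //; lia.
set st2 := set_var _ _ _.
have hr2 : ready e n k st2 by rdy.
have lo2 : low p0.+1 st.2 st2.2 by lk; apply: low_upd => //; lia.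
have c3 : chain nx st2.2 (st2.1 xptr) r.
  apply: eq_chain c2 => u ur; apply: lo2.
  by have := allP rn2 u ur; move: Bp0; rewrite /B /nx; lia.
have h3 : holds st2.2 p0.+1 (rcons q v) by apply: holds_rcons.
have pM2 : p0 + size (rcons q v) + size r + 2 < M by rewrite size_rcons; lia.
have h4 := IH (rcons q v) st2 hr2 c3 rn2 pM2 erefl h3.
apply: (tri_conseq h4) => t st' _ [ht p' h' l']; rewrite -cat_rcons; split=> //.
- by move: ht; lk; lia.
- exact: low_trans lo2 l'.
Qed.

Lemma emit_members_spec l r st : ready e n k st -> chain nx st.2 (st.1 xptr) r ->
  all (fun v => v < n) r ->
  st.1 xp = B + size l -> size l + size r + 2 <= out_max -> holds st.2 B l ->
  tri M emit_members_code st (fun t st' => let l' := l ++ size r :: r in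
    [/\ t <= 40 * (size r).+1, st'.1 xp = B + size l', holds st'.2 B l' & low B st.2 st'.2]).
Proof.
move=> hr hc rn hp hl ho.
set p0 := B + size l in hp.
have pM : p0 + (size r + 2) < M by rewrite /p0 -addnA; apply: out_lt; lia.
have Bp0 : B <= p0 by rewrite leq_addr.
apply: (tri_asgS (v := p0)) => //=.
apply: (tri_asgS (v := p0.+1)); [by lk; rewrite hp; lia | by lk; rewrite hp addn1 | ].
set st0 := (X in tri _ _ X _); have hr0 : ready e n k st0 by rdy.
have lp : tri M _ st0 _ := @members_loop_spec p0 r [::] st0 hr0 hc rn Bp0 _ _ _.
apply: (tri_seqF (lp _ _ _)) => //; first by rewrite /=; lia.
  by lk; rewrite addn0.
move=> t1 st1 fr1 [ht1 p1 h1 lo1]; rewrite /= in p1 h1.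
have P0 : st1.1 xp0 = p0 by rewrite fr1.
apply: (tri_sto (u := p0) (v := size r)).
- by [].
- by lk; rewrite P0 p1; lia.
- by lk.
- by lk; rewrite P0 p1; lia.
lk; split.
- by move: ht1; lia.
- by rewrite p1 size_cat /p0 /=; lia.
- apply: holds_cons.
  + apply: holds_skip; apply: holds_eq ho => x /andP[_ xp]; apply: lo1.
    by rewrite ltnS ltnW.
  + by rewrite /upd eqxx.
  + by apply: holds_eq h1 => x /andP[xp _]; rewrite upd_neq // neq_ltn xp orbT.
- apply: low_upd => //; apply: low_le lo1; lia.
Qed.

Definition block_list (b t j : nat) : seq nat :=
  [seq b * k + i | i <- iota 0 j & odd (t %/ 2 ^ i)].

Lemma block_listS b t j : block_list b t j.+1 =
  if odd (t %/ 2 ^ j) then rcons (block_list b t j) (b * k + j) else block_list b t j.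
Proof.
rewrite /block_list -(addn1 j) iotaD filter_cat map_cat /= add0n.
by case: ifP; rewrite ?cats0 ?cats1.
Qed.

Lemma size_block_list b t j : size (block_list b t j) <= j.
Proof. by rewrite size_map size_filter -{2}(size_iota 0 j) count_size. Qed.

Lemma emit_block_spec l b t st : b < nb -> t < 2 ^ k -> ready e n k st ->
  st.1 xbs = b * k -> st.1 xt = t ->
  st.1 xp = B + size l -> size l + k + 2 <= out_max -> holds st.2 B l ->
  tri M emit_block_code st (fun t' st' =>
    let r := block_list b t k in let l' := l ++ size r :: r in
    [/\ t' <= 60 * k + 40, st'.1 xp = B + size l', holds st'.2 B l' & low B st.2 st'.2]).
Proof.
move=> hb ht hr hbs hxt hp hl ho.
have [nD nnD neD nenD [nkM M1 enM big]] := bounds n_gt0 k_gt0 k_small M_big.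
have bk := block_le hb.
set p0 := B + size l in hp.
have pM : p0 + (k + 2) < M by rewrite /p0 -addnA; apply: out_lt; lia.
have Bp0 : B <= p0 by rewrite leq_addr.
have tM : t < M by apply: leq_trans (leq_trans ht k_small) _; lia.
apply: (tri_asgS (v := p0)) => //=.
apply: (tri_asgS (v := p0.+1)); [by lk; rewrite hp; lia | by lk; rewrite hp addn1 | ].
apply: (tri_asgS (v := t)); [by [] | by lk | ].
apply: (tri_asgS (v := b * k)); [by [] | by lk | ].
set st0 := (X in tri _ _ X _); have hr0 : ready e n k st0 by rdy.
apply: (tri_seqF (R := fun t' st' => [/\ t' <= 50 * k + 6,
   st'.1 xp = p0.+1 + size (block_list b t k),
   holds st'.2 p0.+1 (block_list b t k) & low p0.+1 st.2 st'.2])).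
  apply: (tri_for (N := k) (f := fun=> 40) (Inv := fun j st' =>
   [/\ st'.1 xx = t %/ 2 ^ j, st'.1 xs = b * k + j,
     st'.1 xp = p0.+1 + size (block_list b t j),
     holds st'.2 p0.+1 (block_list b t j)
     & low p0.+1 st.2 st'.2])) => //.
  - by rewrite hr0.
  - by lia.
  - by rewrite expn0 divn1 addn0; split=> //; lk; rewrite addn0.
  - move=> j st1 jk fr sti [x1 s1 p1 h1 lo1].
    have xM : t %/ 2 ^ j < M by apply: leq_ltn_trans tM; apply: leq_div.
    have bE : t %/ 2 ^ j = t %/ 2 ^ j %/ 2 * 2 + odd (t %/ 2 ^ j) by rewrite -modn2 -divn_eq.
    have sj := size_block_list b t j.
    set o := odd _ in bE.
    apply: (tri_stoS (u := p0.+1 + size (block_list b t j)) (v := b * k + j)); [by [] | by [] | by lk | by lk | ].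
    apply: (tri_asgS (v := p0.+1 + size (block_list b t j.+1))).
    + by lk; rewrite x1 p1; move: (boolM n_gt0 k_gt0 k_small M_big o); case: o bE; lia.
    + by lk; rewrite x1 p1 block_listS -/o; case: o bE; rewrite ?size_rcons; lia.
    apply: (tri_asgS (v := t %/ 2 ^ j.+1)); [by lk; lia | by lk; rewrite x1 expnSr divnMA | ].
    apply: (tri_asg (v := b * k + j.+1)); [by lk; rewrite s1; lia | by lk; rewrite s1 addn1 addnS | ].
    lk; split=> //; split=> //; last by apply: low_upd => //; lia.
    by rewrite block_listS -/o; case: o {bE}; [apply: holds_rcons | apply: holds_skip].
  - move=> t' st' ht' _ [x1 s1 p1 h1 lo1]; split=> //.
    by move: ht'; rewrite sum_nat_const card_ord /=; lia.
move=> t1 st1 fr1 [ht1 p1 h1 lo1].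
have P0 : st1.1 xp0 = p0 by rewrite fr1.
have sk := size_block_list b t k.
apply: (tri_sto (u := p0) (v := size (block_list b t k))).
- by [].
- by lk; rewrite P0 p1; lia.
- by lk.
- by lk; rewrite P0 p1; lia.
lk; split.
- by move: ht1; lia.
- by rewrite p1 size_cat /p0 /=; lia.
- apply: holds_cons.
  + apply: holds_skip; apply: holds_eq ho => x /andP[_ xp]; apply: lo1.
    by rewrite ltnS ltnW.
  + by rewrite /upd eqxx.
  + by apply: holds_eq h1 => x /andP[xp _]; rewrite upd_neq // neq_ltn xp orbT.
- by apply: low_upd => //; apply: low_le lo1; lia.
Qed.

End Emit.

Lemma size_filter_iota (p : pred nat) m : size (filter p (iota 0 m)) <= m.
Proof. by rewrite size_filter -{2}(size_iota 0 m) count_size. Qed.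

Lemma sum_affine N c c' c'' (f : nat -> nat) :
  \sum_(i < N) (c + c' * f i + c'') = N * (c + c'') + c' * \sum_(i < N) f i.
Proof. by rewrite !big_split /= -big_distrr /= !sum_nat_const card_ord; lia. Qed.

Section Loops.
Variables (e n k M : nat).
Hypothesis n_gt0 : 0 < n.
Hypothesis k_gt0 : 0 < k.
Hypothesis k_small : 2 ^ k <= n.
Variable H : hypergraph e.+2 'I_n.
Let d := e.+2.
Let D := n ^ e * (n * n).
Let nb := n_blocks n k.
Let code_max := 2 * e + n + k + 10.
Let n_keys := n ^ e * (nb * 2 ^ k).
Hypothesis M_big : 16 * (e.+2 * D) + code_max * n_keys < M.
Let B := D + n + (n + 1) + 1.
Let nx := D + n.

Definition key_code (c : key) : seq nat :=
  let: (mu, b, t) := c in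
  tuple_code (digs n e mu) ++ (size (rev (members k H c)) :: rev (members k H c)) ++
  (size (block_list k b t k) :: block_list k b t k).

Definition codes (ks : seq key) : seq nat := flatten [seq key_code c | c <- ks].

Lemma size_key_code c : size (key_code c) <= code_max.
Proof.
case: c => -[mu b] t; rewrite !size_cat /= size_tuple_code size_digs /code_max.
have := size_block_list k b t k; have : size (rev (members k H (mu, b, t))) <= n.
  by rewrite size_rev size_filter_iota.
by rewrite size_rev /=; clear; lia.
Qed.

Lemma size_codes ks : size (codes ks) <= code_max * size ks.
Proof.
elim: ks => //= c ks IH; rewrite size_cat mulnS leq_add //; exact: size_key_code.
Qed.

Lemma codes_cat ks ks' : codes (ks ++ ks') = codes ks ++ codes ks'.
Proof. by rewrite /codes map_cat flatten_cat. Qed.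

Definition bucket_keys (mu b t : nat) : seq key :=
  if (t != 0) && (members k H (mu, b, t) != [::]) then [:: (mu, b, t)] else [::].

Lemma block_keysS mu b T :
  block_keys k H mu b T.+1 = block_keys k H mu b T ++ bucket_keys mu b T.
Proof.
rewrite /block_keys -(addn1 T) iotaD filter_cat map_cat /= add0n /bucket_keys.
by case: ifP.
Qed.

Lemma size_block_keys mu b T : size (block_keys k H mu b T) <= T.
Proof. by rewrite size_map size_filter_iota. Qed.

Lemma bucket_spec mu b t ks st : mu < n ^ e -> b < nb -> t < 2 ^ k -> ready e n k st ->
  st.1 xmu = mu -> st.1 xbs = b * k -> st.1 xt = t ->
  chain nx st.2 (st.2 (D + t)) (bucket k H mu b n t) ->
  size ks < n_keys -> st.1 xp = B + size (codes ks) -> st.1 xcnt = size ks ->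
  holds st.2 B (codes ks) ->
  tri M bucket_code st (fun t' st' => let ks' := ks ++ bucket_keys mu b t in
    [/\ t' <= 110 * (e + k + 2) + 40 * size (bucket k H mu b n t),
      st'.1 xp = B + size (codes ks'), st'.1 xcnt = size ks',
      holds st'.2 B (codes ks') &
      st'.2 (D + t) = 0 /\ forall x, x < B -> x != D + t -> st'.2 x = st.2 x]).
Proof.
move=> hmu hb ht hr hxm hbs hxt hc hks hp hcnt ho.
have [nD nnD neD nenD [nkM M1 enM big]] := bounds n_gt0 k_gt0 k_small M_big.
rewrite -/D in nD nnD neD nenD big.
have HD : st.1 xhd = D := hr 6 isT.
have tn : t < n := leq_trans ht k_small.
have hsz : size (codes ks) + code_max <= code_max * n_keys.
  apply: (@leq_trans (code_max * (size ks).+1)); last by rewrite leq_mul2l hks orbT.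
  by rewrite mulnS addnC leq_add2l size_codes.
have cM : size ks + 1 < M.
  have h1 : n_keys <= code_max * n_keys by rewrite leq_pmull // /code_max; lia.
  have h2 : D <= e.+2 * D by rewrite leq_pmull.
  by lia.
have key : bucket_keys mu b t = if bucket k H mu b n t == [::] then [::] else [:: (mu, b, t)].
  rewrite /bucket_keys /bucket; case: (altP (t =P 0)) => //= _.
  have -> : (rev (members k H (mu, b, t)) == [::]) = (members k H (mu, b, t) == [::]).
    by rewrite -!size_eq0 size_rev.
  by case: (_ == _).
apply: (tri_asgS (v := st.2 (D + t))).
- by lk; rewrite HD hxt; lia.
- by lk; rewrite HD hxt.
set st0 := set_var _ _ _; have hr0 : ready e n k st0 by rdy.
apply: tri_when => //= [E|E].
  have bk0 : bucket k H mu b n t = [::].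
    by move: hc; rewrite E; case: (bucket _ _ _ _ _ _) => //= v l [].
  by rewrite key bk0 eqxx cats0; split=> //; lia.
have bkE : bucket k H mu b n t = rev (members k H (mu, b, t)).
  move: hc E; rewrite /bucket; case: (altP (t =P 0)) => //= _ ->; rewrite eqxx //.
have bk0 : (bucket k H mu b n t == [::]) = false.
  by apply/negP => /eqP h; move: hc E; rewrite h /= => ->; rewrite eqxx.
rewrite key bk0 codes_cat bkE in hc *.
set r := rev (members _ _ _) in hc *.
have rn : all (fun v => v < n) r.
  by apply/allP => v; rewrite mem_rev mem_members => /andP[].
have rs : size r <= n by rewrite size_rev size_filter_iota.
apply: (tri_stoS (u := D + t) (v := 0)).
- by lk; rewrite HD hxt; lia.
- by lk; lia.
- by lk; rewrite HD hxt.
- by [].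
apply: (tri_asgS (v := size ks + 1)); [by lk; rewrite hcnt cM; lia | by lk; rewrite hcnt | ].
set st1 := set_var _ _ _; have hr1 : ready e n k st1 by rdy.
have tB : D + t < B by rewrite /B; lia.
have ho1 : holds st1.2 B (codes ks).
  by apply: holds_eq ho => x /andP[xB _]; lk; rewrite upd_neq //; lia.
have hp1 : st1.1 xp = B + size (codes ks) by [].
have sz1 : size (codes ks) + 2 * e <= code_max * n_keys by move: hsz; rewrite /code_max; lia.
have T := emit_tuple_spec n_gt0 k_gt0 k_small M_big hmu hr1 (hxm : st1.1 xmu = mu) hp1 sz1 ho1.
apply: (tri_seqF T) => t2 st2 fr2 [ht2 p2 h2 lo2].
have hr2 : ready e n k st2 by apply: ready_frame fr2 hr1 isT.
set l2 := codes ks ++ _ in p2 h2.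
have sl2 : size l2 = size (codes ks) + 2 * e by rewrite size_cat size_tuple_code size_digs.
have hc2 : chain nx st2.2 (st2.1 xptr) r.
  have -> : st2.1 xptr = st.2 (D + t) by rewrite fr2.
  apply: eq_chain hc => v vr; have := allP rn v vr => vn.
  by rewrite lo2; [lk; rewrite upd_neq //; rewrite /nx; lia | rewrite /B /nx; lia].
have sz2 : size l2 + size r + 2 <= code_max * n_keys.
  by rewrite sl2; move: hsz; rewrite /code_max; lia.
have MS := emit_members_spec n_gt0 k_gt0 k_small M_big hr2 hc2 rn p2 sz2 h2.
apply: (tri_seqF MS) => t3 st3 fr3 [ht3 p3 h3 lo3].
have hr3 : ready e n k st3 by apply: ready_frame fr3 hr2 isT.
set l3 := l2 ++ _ in p3 h3.
have sl3 : size l3 = size l2 + (size r).+1 by rewrite size_cat.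
have sz3 : size l3 + k + 2 <= code_max * n_keys.
  by rewrite sl3 sl2; move: hsz; rewrite /code_max; lia.
have bs3 : st3.1 xbs = b * k by rewrite fr3 // fr2.
have t3E : st3.1 xt = t by rewrite fr3 // fr2.
have BS := emit_block_spec n_gt0 k_gt0 k_small M_big hb ht hr3 bs3 t3E p3 sz3 h3.
apply: (tri_conseq BS) => t4 st4 fr4 [ht4 p4 h4 lo4].
set l4 := l3 ++ _ in p4 h4.
have l4E : l4 = codes ks ++ codes [:: (mu, b, t)].
  by rewrite /l4 /l3 /l2 /codes /= cats0 -!catA.
have lo : low B st1.2 st4.2 := low_trans (low_trans lo2 lo3) lo4.
rewrite -l4E; split=> //.
- by move: ht2 ht3 ht4; clear; rewrite /=; lia.
- by rewrite fr4 // fr3 // fr2 //; lk; rewrite size_cat.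
- split; first by rewrite lo // /st1; lk; rewrite /upd eqxx.
  by move=> x xB xt; rewrite lo //; lk; rewrite upd_neq.
Qed.

Definition clean (m : nat -> nat) : Prop := forall t, t < 2 ^ k -> m (D + t) = 0.

(** The invariant of the main loops, when the cliques with keys [ks] are written. *)
Definition emitted (ks : seq key) (st : state) : Prop :=
  [/\ inp H st.2, clean st.2, st.1 xp = B + size (codes ks), st.1 xcnt = size ks
    & holds st.2 B (codes ks)].

Lemma sum_bucket mu b : \sum_(t < 2 ^ k) size (bucket k H mu b n t) <= n.
Proof.
apply: leq_trans (_ : \sum_(t < 2 ^ k) \sum_(a < n) (nbr_mask k H mu b a == t) <= _).
  apply: leq_sum => t _; rewrite /bucket; case: ifP => //= _.
  rewrite size_rev size_filter -sum1_count -{1}[n]subn0 big_mkord big_mkcond /=.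
  by apply: leq_sum => a _; case: (_ == _).
rewrite exchange_big /= -[X in _ <= X]muln1 -[X in _ <= X * 1](card_ord n) -sum_nat_const.
apply: leq_sum => a _; under eq_bigr => t _ do rewrite eq_sym.
exact: sum_eq_le1.
Qed.

(** The sum counts the [a] that pass the check, each of which costs [k] reads.  The
    buckets are visited once for each mask and have at most [n] members in all. *)
Lemma block_spec mu b ks st : mu < n ^ e -> b < nb -> ready e n k st ->
  st.1 xmu = mu -> st.1 xb = b -> size ks + 2 ^ k <= n_keys -> emitted ks st ->
  tri M (block_code d) st (fun t st' =>
    t <= 300 * (e.+1 * n) + 150 * ((e + k + 2) * 2 ^ k) + 120 * k * \sum_(a < n) qc e n k mu b a
    /\ emitted (ks ++ block_keys k H mu b (2 ^ k)) st').
Proof.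
move=> hmu hb hr hxm hxb hks [hi hcl hp hcnt ho].
have [nD nnD neD nenD [nkM M1 enM big]] := bounds n_gt0 k_gt0 k_small M_big.
rewrite -/D in nD nnD neD nenD big.
have bk := block_le hb.
apply: (tri_asgS (v := b * k)).
- by lk; rewrite hxb (hr 2 isT) /=; lia.
- by lk; rewrite hxb (hr 2 isT).
set st0 := set_var _ _ _; have hr0 : ready e n k st0 by rdy.
apply: (tri_seqF (R := fun t st' => [/\
    t <= \sum_(a < n) (180 * e.+1 + 120 * k * qc e n k mu b a + 10) + 6, inp H st'.2,
    buckets k H st'.2 mu b n & holds st'.2 B (codes ks)])).
  apply: (tri_for (N := n) (f := fun a => 180 * e.+1 + 120 * k * qc e n k mu b a)
    (Inv := fun a st' => [/\ inp H st'.2, buckets k H st'.2 mu b a & holds st'.2 B (codes ks)])) => //.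
  - by rewrite (hr0 0 isT).
  - by lia.
  - split=> // t tk; lk; rewrite hcl // /bucket; by case: (_ == 0).
  - move=> a st1 an fr1 a1 [i1 b1 h1].
    have hr1 : ready e n k st1 by apply: ready_frame fr1 hr0 isT.
    have V := vertex_spec n_gt0 k_gt0 k_small M_big hmu an hb hr1 _ a1 _ _ i1 b1 h1.
    by apply: (tri_conseq (V _ _ _)) => [||| t st2 _ [ht i2 b2 h2]]; rewrite ?fr1.
  - by move=> t st' ht _ [i1 b1 h1].
move=> t1 st1 fr1 [ht1 i1 b1 h1].
have hr1 : ready e n k st1 by apply: ready_frame fr1 hr0 isT.
pose f t := 110 * (e + k + 2) + 40 * size (bucket k H mu b n t).
pose K T := ks ++ block_keys k H mu b T.
apply: (tri_for (N := 2 ^ k) (f := f) (Inv := fun T st' =>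
  [/\ st'.1 xp = B + size (codes (K T)), st'.1 xcnt = size (K T), holds st'.2 B (codes (K T)),
    (forall t, t < T -> st'.2 (D + t) = 0) &
    (forall x, x < B -> x < D \/ D + T <= x -> st'.2 x = st1.2 x)])) => //.
- by rewrite (hr1 3 isT).
- by lia.
- rewrite /K /block_keys /= cats0; split=> //; lk; by rewrite fr1.
- move=> t st2 tk fr2 t2 [p2 c2 h2 z2 s2].
  have hr2 : ready e n k st2 by apply: ready_frame fr2 hr1 isT.
  have sK : size (K t) < n_keys.
    rewrite size_cat; have := size_block_keys mu b t; move: hks tk; clear; lia.
  have tn := leq_trans tk k_small.
  have hc : chain nx st2.2 (st2.2 (D + t)) (bucket k H mu b n t).
    rewrite s2; [|by rewrite /B; lia | by right].
    apply: eq_chain (b1 t tk) => v /mem_bucket vn; apply: s2.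
      by rewrite /B /nx; lia.
    by right; rewrite /nx; lia.
  have mu2 : st2.1 xmu = mu by rewrite fr2 // fr1.
  have bs2 : st2.1 xbs = b * k by rewrite fr2 // fr1.
  have BS := bucket_spec hmu hb tk hr2 mu2 bs2 t2 hc sK p2 c2 h2.
  apply: (tri_conseq BS) => t' st3 fr3 [ht3 p3 c3 h3 [z3 s3]].
  rewrite -catA -block_keysS -/(K t.+1) in p3 c3 h3.
  split=> //; split=> //.
  + move=> u; rewrite ltnS leq_eqVlt => /predU1P[->|ut]; first exact: z3.
    by lk; rewrite s3 ?z2 ?eqn_add2l ?ltn_eqF //; move: tn ut; rewrite /B; clear; lia.
  + move=> x xB hx; lk; rewrite s3 //; last by case: hx; clear; lia.
    by rewrite s2 //; case: hx; [left | right; lia].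
move=> t2 st2 ht2 fr2 [p2 c2 h2 z2 s2]; split; last first.
  split=> // x xD; rewrite s2 ?i1 //; [by rewrite /B; lia | by left].
have := sum_bucket mu b; move: ht1 ht2; rewrite /f.
rewrite (sum_affine n _ _ _ (fun a => qc e n k mu b a)) (sum_affine _ _ _ _ (fun t => size (bucket k H mu b n t))).
set S := \sum_(_ < n) _; set S2 := \sum_(_ < 2 ^ k) _.
move=> h1' h2' h3.
have q1 : n <= e.+1 * n by rewrite leq_pmull.
have q2 : 2 ^ k <= (e + k + 2) * 2 ^ k by rewrite leq_pmull //; lia.
have q3 : n * (180 * e.+1 + 10) = 180 * (e.+1 * n) + 10 * n by clear; lia.
have q4 : 2 ^ k * (110 * (e + k + 2) + 10) = 110 * ((e + k + 2) * 2 ^ k) + 10 * 2 ^ k by clear; lia.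
rewrite q3 in h1'; rewrite q4 in h2'.
move: h1' h2' h3 q1 q2 n_gt0; clear.
move: (e.+1 * n) ((e + k + 2) * 2 ^ k) (2 ^ k) (120 * k * S) => x1 x2 x3 x4; rewrite /=; lia.
Qed.

End Loops.

Section Setup.
Variable M : nat.

Lemma log_spec (x l N : nat) (st : state) : x != l -> x != xy -> l != xy -> st.1 x = N -> 0 < N -> 2 * N + 2 < M ->
  tri M (log_code x l) st (fun t st' =>
    [/\ t <= 20 * N + 10, st'.2 = st.2 & st'.1 l = trunc_log 2 N]).
Proof.
move=> xl xny ly hx N0 NM.
apply: (tri_asgS (v := N)) => //=.
apply: (tri_asgS (v := 0)) => //=; first lia.
set st0 := set_var _ _ _.
have y0 : st0.1 xy = N by lk; rewrite eq_sym (negPf ly).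
have l0 : st0.1 l = 0 by lk; rewrite eqxx.
suff loop z v c st1 : v <= z -> st1.1 xy = v -> st1.1 l = c -> 0 < v -> c + 2 * v + 2 < M ->
    tri M (While (Bin Lt (Cst 1) (Var xy))
       (Seq (Asg xy (Bin Div (Var xy) (Cst 2))) (Asg l (Bin Add (Var l) (Cst 1))))) st1
     (fun t st' => [/\ t <= 20 * v, st'.2 = st1.2 & st'.1 l = c + trunc_log 2 v]).
  have h := loop N N 0 st0 (leqnn _) y0 l0 N0 NM.
  by apply: (tri_conseq h) => t st' _ [h1 -> ->]; split=> //; lia.
elim: z v c st1 => [|z IH] v c st1 vz hy hl v0 vM; first lia.
apply: tri_while => /=; first lia.
  rewrite hy => E; have -> : v = 1 by lia.
  by rewrite trunc_log1 addn0; split=> //; lia.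
rewrite hy => E; have v1 : 1 < v by lia.
have hv : v %/ 2 < v by rewrite ltn_Pdiv.
have hv0 : 0 < v %/ 2 by rewrite divn_gt0.
apply: (tri_asgS (v := v %/ 2)); [by lk; lia | by lk; rewrite hy | ].
apply: (tri_asg (v := c + 1)); [by lk; rewrite (negPf ly) hl; lia | by lk; rewrite (negPf ly) hl | ].
set st2 := set_var _ _ _.
have h2 : v %/ 2 * 2 <= v := leq_divM v 2.
have := IH (v %/ 2) (c + 1) st2; case; first lia.
- by lk; rewrite eq_sym (negPf ly).
- by lk; rewrite eqxx.
- by [].
- by lia.
move=> t [st3 [r [ht hm hl3]]]; exists t, st3; split=> //; split=> //.
  by move: ht; lk; lia.
by rewrite hl3 [in RHS]trunc_log2S // -divn2 addn1 addSnnS.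
Qed.

Lemma power_spec (x b i m N c : nat) (st : state) : x \notin [:: b; i; m] -> i != b -> i != m ->
  st.1 b = N -> st.1 m = c -> 0 < N -> c < M -> 1 < M -> N ^ c < M ->
  tri M (power_code x b i m) st (fun t st' =>
    [/\ t <= 20 * c + 10, st'.2 = st.2 & st'.1 x = N ^ c]).
Proof.
rewrite !inE !negb_or => /and3P[xb xi xm] ib im hb hm N0 cM M1 NM.
apply: (tri_asgS (v := 1)) => //=.
set st0 := set_var _ _ _.
apply: (tri_for (N := c) (f := fun=> 4) (Inv := fun j st' => st'.2 = st.2 /\ st'.1 x = N ^ j)) => //.
- by rewrite inE eq_sym.
- by rewrite !inE negb_or eq_sym im eq_sym.
- by lk; rewrite eq_sym (negPf xm).
- by lk; rewrite (negPf xi) eqxx.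
- move=> j st1 jc fr i1 [m1 x1].
  have B1 : st1.1 b = N by rewrite fr ?inE ?negb_or 1?eq_sym ?ib 1?eq_sym ?xb //; lk; rewrite eq_sym (negPf xb).
  have jM : N ^ j.+1 < M by apply: leq_ltn_trans NM; rewrite leq_pexp2l.
  apply: (tri_asg (v := N ^ j.+1)).
  + by lk; rewrite x1 B1 mulnC -expnS.
  + by lk; rewrite x1 B1 mulnC -expnS.
  by lk; rewrite (negPf xi) eqxx.
- move=> t st' ht _ [m1 x1]; split=> //.
  by move: ht; rewrite sum_nat_const card_ord /=; lia.
Qed.

Variables (e n : nat).
Let L := trunc_log 2 n.
Let LL := trunc_log 2 L.
(** The block size [k].  It makes [2 ^ k] at most [n / 4 ^ l], where [l] is the rounded
    logarithm of the rounded logarithm of [n]. *)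
Definition block_size := L - (LL + LL).
Let k := block_size.
Hypothesis n_gt0 : 0 < n.
Hypothesis k_gt0 : 0 < k.
Let D := n ^ e * (n * n).
Let nb := n_blocks n k.
Variable out_max : nat.
Hypothesis M_big : 16 * (e.+2 * D) + out_max < M.
Let B := D + n + (n + 1) + 1.

Lemma block_size_small : 2 ^ k <= n.
Proof.
apply: leq_trans (_ : 2 ^ L <= _); first by rewrite leq_exp2l // leq_subr.
by rewrite -[X in _ <= X]/n trunc_logP.
Qed.

Lemma setup_spec st : st.1 xn = n ->
  tri M (setup_code e) st (fun t st' => [/\ t <= 100 * (n + e) + 200, ready e n k st',
    st'.2 = st.2, st'.1 xp = B & st'.1 xcnt = 0]).
Proof.
move=> hn; have k_small := block_size_small.
have [nD nnD neD nenD [nkM M1 enM big]] := bounds n_gt0 k_gt0 k_small M_big.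
rewrite -/D in nD nnD neD nenD big.
have kn := k_lt_n k_small.
have Ln : L < n by apply: leq_trans (ltn_expl L (ltnSn 1)) _; apply: trunc_logP.
have L0 : 0 < L by move: k_gt0; rewrite /k /block_size; lia.
have eD : e.+2 <= e.+2 * D by rewrite leq_pmulr //; lia.
apply: (tri_seqF (log_spec (x := xn) (l := xlg) isT isT isT hn n_gt0 _)); first lia.
move=> t1 st1 fr1 [ht1 m1 l1]; rewrite -/L in l1.
apply: (tri_seqF (log_spec (x := xlg) (l := xlglg) isT isT isT l1 L0 _)); first lia.
move=> t2 st2 fr2 [ht2 m2 l2]; rewrite -/LL in l2.
have lg2 : st2.1 xlg = L by rewrite fr2.
have n2 : st2.1 xn = n by rewrite fr2 // fr1.
apply: (tri_asgS (v := k)).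
- by lk; rewrite lg2 l2; move: k_gt0; rewrite /k /block_size; lia.
- by lk; rewrite lg2 l2.
apply: (tri_asgS (v := e)); [by lk; lia | by lk | ].
apply: (tri_asgS (v := 2)); [by lk; lia | by lk | ].
set st3 := set_var _ _ _.
apply: (tri_seqF (power_spec (N := 2) (c := k) (st := st3) _ _ _ _ _ _ _ _ _)) => //; try lia.
move=> t4 st4 fr4 [ht4 m4 p4].
have n4 : st4.1 xn = n by rewrite fr4.
apply: (tri_seqF (power_spec (N := n) (c := e) (st := st4) _ _ _ _ _ _ _ _ _)) => //; try lia.
  by rewrite fr4.
move=> t5 st5 fr5 [ht5 m5 p5].
have n5 : st5.1 xn = n by rewrite fr5.
have e5 : st5.1 xe = e by rewrite fr5 // fr4.
have k5 : st5.1 xk = k by rewrite fr5 // fr4.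
have pk5 : st5.1 xpk = 2 ^ k by rewrite fr5.
have nbn : n %/ k <= n by apply: leq_div.
apply: (tri_asgS (v := nb)); [by lk; rewrite n5 k5; lia | by lk; rewrite n5 k5 | ].
apply: (tri_asgS (v := D)); [by lk; rewrite n5 p5 -/D; lia | by lk; rewrite n5 p5 | ].
apply: (tri_asgS (v := D + n)); [by lk; rewrite n5; lia | by lk; rewrite n5 | ].
apply: (tri_asgS (v := D + n + (n + 1))); [by lk; rewrite n5; lia | by lk; rewrite n5 | ].
apply: (tri_asgS (v := B)); [by lk; lia | by [] | ].
apply: (tri_asg (v := 0)); [by lk; lia | by [] | ].
split=> //.
- by move: ht1 ht2 ht4 ht5 Ln kn; rewrite /=; clear; lia.
- case=> [|[|[|[|[|[|[|[|[|//]]]]]]]]] _ //.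
- have E : st5.2 = st2.2 by rewrite m5 m4.
  by lk; rewrite E m2 m1.
Qed.

End Setup.

Section Main.
Variables (e n M : nat).
Let k := block_size n.
Hypothesis n_gt0 : 0 < n.
Hypothesis k_gt0 : 0 < k.
Variable H : hypergraph e.+2 'I_n.
Let d := e.+2.
Let D := n ^ e * (n * n).
Let nb := n_blocks n k.
Let code_max := 2 * e + n + k + 10.
Let n_keys := n ^ e * (nb * 2 ^ k).
Hypothesis M_big : 16 * (e.+2 * D) + code_max * n_keys < M.
Let B := D + n + (n + 1) + 1.

Definition row_keys (mu b : nat) : seq key :=
  flatten [seq block_keys k H mu i (2 ^ k) | i <- iota 0 b].
Definition rows_keys (mu : nat) : seq key := flatten [seq row_keys i nb | i <- iota 0 mu].

Lemma rowS mu b : row_keys mu b.+1 = row_keys mu b ++ block_keys k H mu b (2 ^ k).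
Proof. by rewrite /row_keys -(addn1 b) iotaD map_cat flatten_cat /= cats0. Qed.

Lemma rowsS mu : rows_keys mu.+1 = rows_keys mu ++ row_keys mu nb.
Proof. by rewrite /rows_keys -(addn1 mu) iotaD map_cat flatten_cat /= cats0. Qed.

Lemma size_row mu b : size (row_keys mu b) <= b * 2 ^ k.
Proof.
elim: b => [|b IH] //; rewrite rowS size_cat mulSn addnC leq_add //.
exact: size_block_keys.
Qed.

Lemma size_rows mu : size (rows_keys mu) <= mu * (nb * 2 ^ k).
Proof.
by elim: mu => [|mu IH] //; rewrite rowsS size_cat mulSn addnC leq_add ?size_row.
Qed.

Definition block_time mu b :=
  300 * (e.+1 * n) + 150 * ((e + k + 2) * 2 ^ k) + 120 * k * \sum_(a < n) qc e n k mu b a.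

Lemma main_spec st : st.1 xn = n -> inp H st.2 -> (forall x, D <= x -> st.2 x = 0) ->
  tri M (main_code d) st (fun t st' =>
    [/\ t <= 100 * (n + e) + 250 +
          \sum_(mu < n ^ e) (\sum_(b < nb) (block_time mu b + 10) + 6 + 10),
        st'.1 xn = D + n + (n + 1) &
        holds st'.2 (D + n + (n + 1)) (size (keys k H) :: codes k H (keys k H))]).
Proof.
move=> hn hi hz; have k_small := block_size_small n_gt0.
have [nD nnD neD nenD [nkM M1 enM big]] := bounds n_gt0 k_gt0 k_small M_big.
rewrite -/D in nD nnD neD nenD big.
have S := setup_spec n_gt0 k_gt0 M_big hn.
apply: (tri_seqF S) => t0 st0 fr0 [ht0 hr0 m0 p0 c0]; rewrite -/k in hr0 p0.
pose E ks st := emitted (e := e) k H ks st.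
have E0 : E [::] st0.
  split; rewrite ?m0 //; last by rewrite p0 addn0.
  by move=> t _; rewrite hz // leq_addr.
have neM : n ^ e < M by lia.
have nbM : nb < M.
  by rewrite /nb /n_blocks; have := leq_div n k; lia.
apply: (tri_seqF (R := fun t st' =>
    t <= \sum_(mu < n ^ e) (\sum_(b < nb) (block_time mu b + 10) + 6 + 10) + 6 /\
    E (rows_keys (n ^ e)) st')).
  apply: (tri_for (N := n ^ e) (f := fun mu => \sum_(b < nb) (block_time mu b + 10) + 6)
    (Inv := fun mu st' => E (rows_keys mu) st')) => //.
  - exact: (hr0 4 isT).
  - move=> mu st1 hmu fr1 i1 E1.
    have hr1 : ready e n k st1 by apply: ready_frame fr1 hr0 isT.
    apply: (tri_for (N := nb) (f := block_time mu)
      (Inv := fun b st' => E (rows_keys mu ++ row_keys mu b) st')) => //.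
    + exact: (hr1 5 isT).
    + by rewrite /row_keys /= cats0.
    + move=> b st2 hb fr2 i2 E2.
      have hr2 : ready e n k st2 by apply: ready_frame fr2 hr1 isT.
      have mu2 : st2.1 xmu = mu by rewrite fr2.
      have sz : size (rows_keys mu ++ row_keys mu b) + 2 ^ k <= n_keys.
        rewrite size_cat; apply: (@leq_trans (mu.+1 * (nb * 2 ^ k))); last by rewrite leq_mul2r hmu orbT.
        have a1 := size_rows mu; have a2 := size_row mu b.
        have a3 : b.+1 * 2 ^ k <= nb * 2 ^ k by rewrite leq_mul2r hb orbT.
        rewrite mulSn in a3 *; move: a1 a2 a3; clear.
        by move: (nb * 2 ^ k) => X; lia.
      have BS := block_spec n_gt0 k_gt0 k_small M_big hmu hb hr2 mu2 i2 sz E2.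
      by apply: (tri_conseq BS) => t st3 _ [ht E3]; split=> //; rewrite rowS catA.
    + by move=> t st2 ht _ E2; split=> //; rewrite rowsS.
move=> t1 st1 fr1 [ht1 [i1 cl1 p1 c1 h1]].
have hr1 : ready e n k st1 by apply: ready_frame fr1 hr0 isT.
have O1 : st1.1 xout = D + n + (n + 1) := hr1 8 isT.
apply: (tri_stoS (u := D + n + (n + 1)) (v := size (rows_keys (n ^ e)))) => //=.
apply: (tri_asg (v := D + n + (n + 1))) => //.
split=> //.
- by move: ht0 ht1; rewrite /=; clear; lia.
- have -> : keys k H = rows_keys (n ^ e) by [].
  set ks := rows_keys _ in h1 *; lk; set m' := upd _ _ _.
  have HC := @holds_cons m' (D + n + (n + 1)) [::] (size ks) (codes k H ks).
  rewrite /= addn0 in HC; apply: HC => //; first by rewrite /m' /upd eqxx.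
  rewrite -addn1; apply: holds_eq h1 => x /andP[xB _].
  by rewrite /m' upd_neq //; move: xB; clear; lia.
Qed.

End Main.

Section Machine.
Variables (e n w : nat).
Let k := block_size n.
Hypothesis n_gt0 : 0 < n.
Hypothesis k_gt0 : 0 < k.
Variable H : hypergraph e.+2 'I_n.
Let d := e.+2.
Let D := n ^ e * (n * n).
Let nb := n_blocks n k.
Let code_max := 2 * e + n + k + 10.
Let n_keys := n ^ e * (nb * 2 ^ k).
Hypothesis M_big : 16 * (e.+2 * D) + code_max * n_keys < 2 ^ w.

Lemma clique_code_listing c : c \in keys k H -> clique_code (listing k H c) = key_code k H c.
Proof.
move=> cK; pose g i := size (part k H c i) :: part k H c i.
have -> : clique_code (listing k H c) = flatten [seq g i | i <- iota 0 d].
  rewrite /clique_code -val_enum_ord -map_comp; congr flatten; apply: eq_map => i /=.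
  by rewrite size_listing // val_listing.
case: c cK @g => -[mu b] t cK g.
rewrite /d -addn2 iotaD map_cat flatten_cat /= cats0 add0n.
rewrite ltnn eqxx [e.+1 < e]ltnNge leqnSn /= [e.+1 == e]eqn_leq ltnn /=; congr (_ ++ _).
rewrite /tuple_code; congr flatten; apply: (@eq_from_nth _ [::]).
  by rewrite !size_map size_digs size_iota.
move=> i; rewrite size_map size_iota => ie.
rewrite (nth_map 0) ?size_iota // nth_iota // (nth_map 0) ?size_digs //.
by rewrite /g /part ie.
Qed.

Lemma output_code_cliques :
  output_code (cliques k H) = size (keys k H) :: codes k H (keys k H).
Proof.
rewrite /output_code /cliques size_map -map_comp; congr (_ :: flatten _).
by apply/eq_in_map => c cK; apply: clique_code_listing.
Qed.

Lemma inp_init : inp H (mem (init H)).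
Proof.
move=> x xD; rewrite /init /= /cell.
have -> : x < n ^ e.+2 by rewrite !expnSr -mulnA.
suff -> : [set y : 'I_n | [exists i : 'I_e.+2, (x %/ n ^ i) %% n == y]] = vs n (digs n d x) by [].
apply/setP => y; rewrite !in_set.
apply/existsP/(nthP 0) => [[i /eqP E]|[i]].
  by exists i; rewrite ?size_digs // nth_digs // E.
rewrite size_digs => id; rewrite nth_digs // => E.
by exists (Ordinal id); rewrite /= E.
Qed.

Theorem main_computes : exists t,
  t <= 100 * (n + e) + 250 +
    \sum_(mu < n ^ e) (\sum_(b < nb) (block_time e n mu b + 10) + 6 + 10) /\
  computes_within w (compile 0 (main_code d)) t H (clique_family k H).
Proof.
have [nD _ _ _ [_ M1 _ _]] := bounds n_gt0 k_gt0 (block_size_small n_gt0) M_big.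
have w0 : 0 < w by case: w M1.
pose st : state := (reg (init H), mem (init H)).
have zero x : D <= x -> st.2 x = 0.
  by move=> Dx; rewrite /st /init /= ltnNge !expnSr -mulnA Dx.
have [t [st' [r [ht h0 hh]]]] :=
  main_spec n_gt0 k_gt0 M_big (erefl : st.1 0 = n) inp_init zero.
exists t; split=> //.
have P0 : code_at (compile 0 (main_code d)) 0 (compile 0 (main_code d)) by [].
have bd : bounded w st.
  split=> [x|x] /=; last by case: (_ && _); lia.
  by case: eqP => _; [rewrite -/D in nD; lia | lia].
have [r' [R a' b']] := compileP w0 r P0 (wf_main d) (fun x _ => erefl) bd.
have {}R : iter t (step w (compile 0 (main_code d))) (init H) =
  Config (0 + slen (main_code d)) r' st'.2 := R.
rewrite /computes_within R; split; first by rewrite /halted size_comp.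
exists (cliques k H); split.
- by move=> L /mapP[c _ ->] i; apply: uniq_listing.
- exact: uniq_cliques.
- by [].
- rewrite output_code_cliques /= a' // h0.
  have := size_codes k H (keys k H); have := size_keys k H.
  rewrite -/nb -/n_keys -/code_max => h1 h2.
  have h3 : code_max * size (keys k H) <= code_max * n_keys by rewrite leq_mul2l h1 orbT.
  have h4 : D <= e.+2 * D by rewrite leq_pmull.
  by rewrite -/D in nD *; lia.
- by move=> i; rewrite output_code_cliques /= a' // h0 => il; apply: hh.
Qed.

End Machine.

(** * Sizes *)

Lemma square_le_exp L : L.+1 * L.+1 <= 4 * 2 ^ L.
Proof.
elim: L => [|L IH] //; rewrite expnS.
case: L IH => [|[|L]] // IH.
move: IH; move: (2 ^ L.+2) => X; lia.
Qed.

Lemma poly_le_exp l : 8 <= l -> l.+1 * (2 * l + 1) + 2 * l <= 2 ^ l.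
Proof.
elim: l => // l IH; rewrite leq_eqVlt => /predU1P[<-//|l8].
have {}IH := IH l8; rewrite expnS; move: IH; move: (2 ^ l) => X; nia.
Qed.

Section Sizes.
Variable n : nat.
Let L := trunc_log 2 n.
Let l := trunc_log 2 L.
Let k := block_size n.
Let nb := n_blocks n k.
Hypothesis l8 : 8 <= l.

Lemma log_gt0 : 0 < L.
Proof. by rewrite lt0n; apply/eqP => L0; move: l8; rewrite /l L0. Qed.

Lemma size_gt0 : 0 < n.
Proof. by rewrite lt0n; apply/eqP => n0; move: log_gt0; rewrite /L n0. Qed.

Lemma exp_log : 2 ^ L <= n < 2 ^ L.+1.
Proof. by rewrite trunc_logP ?size_gt0 // trunc_log_ltn. Qed.

Lemma log_lt : L.+1 <= 2 ^ l.+1.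
Proof. exact: trunc_log_ltn. Qed.

Lemma block_ge : l.+1 * (2 * l + 1) <= k.
Proof.
have := poly_le_exp l8; have : 2 ^ l <= L by apply: trunc_logP => //; apply: log_gt0.
by rewrite /k /block_size -/L -/l; lia.
Qed.

Lemma block_gt0 : 0 < k.
Proof. by apply: leq_trans block_ge; rewrite muln_gt0 addn1. Qed.

Lemma logE : L = k + 2 * l.
Proof. by have := block_gt0; rewrite /k /block_size -/L -/l; lia. Qed.

Lemma exp_block : 2 ^ k * (2 ^ l * 2 ^ l) <= n.
Proof.
by have /andP[h _] := exp_log; rewrite -!expnD addnn -mul2n -logE.
Qed.

Lemma log_le : L.+1 <= 3 * k.
Proof. by have := block_ge; rewrite logE; nia. Qed.

Lemma square_log_le : L.+1 * L.+1 <= 4 * n.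
Proof.
by apply: leq_trans (square_le_exp L) _; have /andP[h _] := exp_log; rewrite leq_mul2l h orbT.
Qed.

Lemma n_blocks_le : k * nb <= 2 * n.
Proof.
have := k_lt_n (block_size_small size_gt0); rewrite -/k => kn.
rewrite /nb /n_blocks mulnDr muln1 mulnC; have := leq_divM n k; lia.
Qed.

Lemma square_log_block : 2 ^ k * (L.+1 * L.+1) <= 4 * n.
Proof.
have h := exp_block; have h2 : L.+1 * L.+1 <= 2 ^ l.+1 * 2 ^ l.+1 by rewrite leq_mul ?log_lt.
apply: (@leq_trans (2 ^ k * (2 ^ l.+1 * 2 ^ l.+1))); first by rewrite leq_mul2l h2 orbT.
rewrite !expnS; move: h; move: (2 ^ k) (2 ^ l) => x y; lia.
Qed.

(** As [lg n < L + 1], [L = k + 2 l] and [(l + 1) (2 l + 1) <= k], the quotient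
    [(L + 1) / k] is at most [1 + 1 / (l + 1)].  Up to constants, the other two
    terms are smaller than [n / (L + 1)] by a factor [l + 1]. *)
Lemma degree_numeric c1 c2 :
  (n %/ k + c1 + c2 * 2 ^ k) * (L.+1 * l.+1) <= n * (l.+1 + (1 + 4 * c1 + 2 * c2)).
Proof.
have a1 : n %/ k * (L.+1 * l.+1) <= n * (l.+1 + 1).
  have h := block_ge; have h1 : L.+1 * l.+1 <= k * (l.+1 + 1) by rewrite logE; nia.
  apply: (@leq_trans (n %/ k * (k * (l.+1 + 1)))); first by rewrite leq_mul2l h1 orbT.
  by rewrite mulnA leq_mul2r leq_divM orbT.
have lL : l <= L by rewrite logE; lia.
have a2 : L.+1 * l.+1 <= 4 * n.
  by apply: leq_trans square_log_le; rewrite leq_mul2l ltnS lL orbT.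
have a3 : 2 ^ k * (L.+1 * l.+1) <= 2 * n.
  have l2 : l.+1 <= 2 ^ l by apply: ltn_expl.
  apply: leq_trans (_ : 2 ^ k * (2 ^ l.+1 * 2 ^ l) <= _).
    by rewrite leq_mul2l leq_mul ?log_lt ?orbT.
  by have := exp_block; rewrite expnS; move: (2 ^ k) (2 ^ l) => x y; lia.
rewrite !mulnDl [n * _]mulnDr.
have -> : n * (1 + 4 * c1 + 2 * c2) = n + c1 * (4 * n) + c2 * (2 * n) by lia.
rewrite !addnA; apply: leq_add; last by rewrite -mulnA leq_mul2l a3 orbT.
apply: leq_add; last by rewrite leq_mul2l a2 orbT.
by move: a1; rewrite mulnDr muln1.
Qed.

(** Here [k] is at least a third of [L + 1], and [2 ^ k] at most
    [4 n / (L + 1) ^ 2]. *)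
Lemma cliques_numeric : nb * 2 ^ k * (L.+1 * (L.+1 * L.+1)) <= 24 * (n * n).
Proof.
have h1 := log_le; have h2 := n_blocks_le; have h3 := square_log_block.
have -> : nb * 2 ^ k * (L.+1 * (L.+1 * L.+1)) = (L.+1 * nb) * (2 ^ k * (L.+1 * L.+1)).
  by move: L.+1 (2 ^ k) nb => x y z; lia.
have h4 : L.+1 * nb <= 6 * n.
  apply: (@leq_trans (3 * k * nb)); first by rewrite leq_mul2r h1 orbT.
  by rewrite -mulnA; lia.
apply: (@leq_trans (6 * n * (4 * n))); first exact: leq_mul.
lia.
Qed.

Section Uniformity.
Variable e : nat.
Let d := e.+2.
Hypothesis l_big : 50 * (d`! * (e + 5)) <= l.

(** All addresses and numbers fit into words of [(e + 10) lg n] bits. *)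
Lemma space_numeric w : n ^ (e + 10) <= 2 ^ w ->
  16 * (e.+2 * (n ^ e * (n * n))) +
  (2 * e + n + k + 10) * (n ^ e * (nb * 2 ^ k)) < 2 ^ w.
Proof.
apply: leq_trans.
have f0 : 0 < d`! by apply: fact_gt0.
have ks := block_size_small size_gt0; rewrite -/k in ks.
have kn := k_lt_n ks.
have lk : l <= k by apply: leq_trans block_ge; rewrite -[X in X <= _]muln1 leq_mul // addn1.
have en : 50 * (e + 5) <= n.
  apply: leq_trans (ltnW kn); apply: leq_trans lk; apply: leq_trans l_big.
  by rewrite leq_mul2l leq_pmull.
have nbn : nb <= n.
  have k2 : 2 <= k by apply: leq_trans lk; apply: leq_trans l8.
  by rewrite -(leq_pmul2l (ltn0Sn 1)); apply: leq_trans n_blocks_le; rewrite leq_mul2r k2 orbT.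
have ne : 0 < n ^ e by rewrite expn_gt0 size_gt0.
have b1 : 16 * (e.+2 * (n ^ e * (n * n))) <= n ^ e * (n * n) * n.
  have en' : 16 * e.+2 <= n by lia.
  rewrite mulnA mulnC leq_mul2l; apply/orP; right; exact: en'.
have b2 : (2 * e + n + k + 10) * (n ^ e * (nb * 2 ^ k)) <= 4 * n * (n ^ e * (n * n)).
  by apply: leq_mul; [lia | rewrite leq_mul2l leq_mul ?orbT].
have -> : n ^ (e + 10) = n ^ e * (n * n) * n * n ^ 7 by rewrite expnD -!mulnA -!expnS.
have n7 : n <= n ^ 7 by rewrite -{1}(expn1 n) leq_pexp2l ?size_gt0.
set X := n ^ e * (n * n) in b1 b2 *.
have X0 : 0 < X by rewrite /X !muln_gt0 ne size_gt0.
apply: (@leq_trans (X * n * 6)).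
  have Xn : 0 < X * n by rewrite muln_gt0 X0 size_gt0.
  by move: b1 b2 Xn; clear; move: (16 * _) (_ * (n ^ e * _)) => y z; lia.
rewrite leq_mul2l; apply/orP; right; apply: leq_trans n7.
by move: en; clear; lia.
Qed.

(** The term with [qc] dominates: by [count_qc] it is at most about [120 n ^ d].
    Each of the others is smaller by a factor of at least [k], [4 ^ l] or [n] up to
    a constant that depends on [d], and [l] exceeds that constant. *)
Lemma time_numeric :
  d`! * (100 * (n + e) + 250 +
    \sum_(mu < n ^ e) (\sum_(b < nb) (block_time e n mu b + 10) + 6 + 10)) <=
  400 * n ^ d.
Proof.
have f0 : 0 < d`! by apply: fact_gt0.
have n0 := size_gt0; have k0 := block_gt0.
set S := \sum_(a < n) \sum_(mu < n ^ e) \sum_(b < nb) qc e n k mu b a.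
have hS : d`! * S <= n * (n ^ e * (nb + 1 + 2 * d + 3 * d`!)).
  rewrite /S big_distrr -[n in X in _ <= X](card_ord n) -sum_nat_const.
  by apply: leq_sum => a _; rewrite card_ord; apply: count_qc.
pose U := 300 * (e.+1 * n) + 150 * ((e + k + 2) * 2 ^ k).
have -> : \sum_(mu < n ^ e) (\sum_(b < nb) (block_time e n mu b + 10) + 6 + 10) =
    n ^ e * (nb * (U + 10) + 16) + 120 * k * S.
  have -> : S = \sum_(mu < n ^ e) \sum_(b < nb) \sum_(a < n) qc e n k mu b a.
    rewrite /S exchange_big; apply: eq_bigr => mu _; exact: exchange_big.
  rewrite -(addn0 (nb * (U + 10) + 16)) -(sum_affine _ _ _ _ (fun mu => \sum_(b < nb) \sum_(a < n) qc e n k mu b a)).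
  apply: eq_bigr => mu _; rewrite addn0 -addnA addnAC; congr (_ + _).
  by rewrite -(sum_affine _ _ _ _ (fun b => \sum_(a < n) qc e n k mu b a)).
have ks := block_size_small size_gt0; rewrite -/k in ks.
have kn := ltnW (k_lt_n ks); have knb := n_blocks_le.
set F := d`! in f0 hS *; set N := n ^ e in hS *.
have -> : n ^ d = N * (n * n) by rewrite /d /N !expnSr mulnA.
have N0 : 0 < N by rewrite expn_gt0 n0.
have FE : F <= F * (e + 5) by rewrite leq_pmulr // addnC.
have lF : 50 * (F * (e + 5)) <= l by [].
have kF : 800 * (F * (e + 5)) <= k.
  apply: leq_trans block_ge; move: (F * (e + 5)) lF => X lF.
  have h : 8 * (100 * X) <= l.+1 * (2 * l + 1).
    by apply: leq_mul; [apply: leqW | move: lF; clear; lia].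
  by apply: leq_trans h; clear; lia.
have q0 : 50 * (F * (e + 5)) <= 2 ^ l by apply: leq_trans lF (ltnW (ltn_expl _ _)).
have Fe1 : F * e.+1 <= F * (e + 5) by rewrite leq_mul2l; apply/orP; right; clear; lia.
have Fe3 : F * (e + 3) <= F * (e + 5) by rewrite leq_mul2l; apply/orP; right; clear; lia.
have a1 : F * (300 * (e.+1 * n)) * nb <= n * n.
  have h : 2 * (300 * (F * e.+1)) <= k by apply: leq_trans kF; move: Fe1; clear; lia.
  have h2 : 2 * (300 * (F * e.+1)) * nb <= 2 * n.
    by apply: leq_trans knb; rewrite leq_mul2r h orbT.
  have {}h2 : 300 * (F * e.+1) * nb <= n by move: h2; rewrite -mulnA leq_pmul2l.
  apply: leq_trans (_ : 300 * (F * e.+1) * nb * n <= _); last by rewrite leq_mul2r h2 orbT.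
  by clear; lia.
have a2 : F * (150 * ((e + k + 2) * 2 ^ k)) * nb <= n * n.
  have h1 : e + k + 2 <= (e + 3) * k.
    by rewrite mulnDl; have := leq_pmulr e k0; move: k0; clear; lia.
  have h2 : 300 * (F * (e + 3)) <= 2 ^ l * 2 ^ l.
    apply: leq_trans (_ : (50 * (F * (e + 5))) * (2 ^ l) <= _); last by rewrite leq_mul2r q0 orbT.
    have q8 : 8 <= 2 ^ l by apply: leq_trans l8 (ltnW (ltn_expl _ _)).
    apply: leq_trans (_ : 50 * (F * (e + 5)) * 8 <= _); last by rewrite leq_mul2l q8 orbT.
    by move: Fe3; clear; lia.
  apply: leq_trans (_ : F * (150 * ((e + 3) * k * 2 ^ k)) * nb <= _).
    by rewrite leq_mul2r !leq_mul2l leq_mul2r h1 !orbT.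
  have -> : F * (150 * ((e + 3) * k * 2 ^ k)) * nb = 150 * (F * (e + 3)) * 2 ^ k * (k * nb).
    by move: (2 ^ k) => x; clear; lia.
  apply: leq_trans (_ : 150 * (F * (e + 3)) * 2 ^ k * (2 * n) <= _).
    by rewrite leq_mul2l knb orbT.
  apply: leq_trans (_ : 300 * (F * (e + 3)) * 2 ^ k * n <= _).
    by move: (2 ^ k) => x; clear; lia.
  rewrite leq_mul2r; apply/orP; right; apply: leq_trans exp_block.
  by rewrite mulnC leq_mul2l h2 orbT.
have nF : 800 * (F * (e + 5)) <= n by apply: leq_trans kn.
have nbn : nb <= n.
  have k2 : 2 <= k by apply: leq_trans kF; move: f0 FE; clear; lia.
  by rewrite -(leq_pmul2l (ltn0Sn 1)); apply: leq_trans knb; rewrite leq_mul2r k2 orbT.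
have a3 : F * 10 * nb <= n * n.
  by apply: leq_mul => //; apply: leq_trans nF; move: FE; clear; lia.
have a4 : F * 16 <= n * n.
  apply: leq_trans (leq_pmulr n n0); apply: leq_trans nF; move: FE; clear; lia.
have a5 : F * (100 * (n + e) + 250) <= N * (n * n).
  apply: leq_trans (leq_pmull (n * n) N0).
  apply: leq_trans (_ : 800 * (F * (e + 5)) * n <= _); last by rewrite leq_mul2r nF orbT.
  have h : 100 * (n + e) + 250 <= 800 * ((e + 5) * n).
    by rewrite mulnDl; have := leq_pmulr e n0; move: n0; clear; lia.
  have -> : 800 * (F * (e + 5)) * n = F * (800 * ((e + 5) * n)) by clear; lia.
  by rewrite leq_mul2l h orbT.
have a6 : F * (120 * k * S) <= 360 * (N * (n * n)).
  have c1 : 4 * (1 + 2 * d + 3 * F) <= L.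
    have lL : l <= L by rewrite logE; clear; lia.
    apply: leq_trans lL; apply: leq_trans lF.
    have : e + 5 <= F * (e + 5) by rewrite leq_pmull.
    by move: FE; rewrite /d; clear; lia.
  have c2 : k * (1 + 2 * d + 3 * F) <= n.
    rewrite -(leq_pmul2l (isT : 0 < 4)); apply: leq_trans square_log_le.
    rewrite mulnCA; apply: leq_mul; last by apply: leqW.
    by apply: leqW; rewrite logE leq_addr.
  have -> : F * (120 * k * S) = 120 * k * (F * S) by rewrite mulnCA.
  apply: leq_trans (_ : 120 * k * (n * (N * (nb + 1 + 2 * d + 3 * F))) <= _).
    by rewrite leq_mul2l hS orbT.
  have -> : 120 * k * (n * (N * (nb + 1 + 2 * d + 3 * F))) =
     120 * (N * (n * (k * nb + k * (1 + 2 * d + 3 * F)))) by clear; lia.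
  have -> : 360 * (N * (n * n)) = 120 * (N * (n * (3 * n))) by clear; lia.
  rewrite !leq_mul2l; do 3![apply/orP; right].
  by move: knb c2; clear; lia.
have -> : F * (100 * (n + e) + 250 + (N * (nb * (U + 10) + 16) + 120 * k * S)) =
    F * (100 * (n + e) + 250) + N * (F * (300 * (e.+1 * n)) * nb +
      F * (150 * ((e + k + 2) * 2 ^ k)) * nb + F * 10 * nb + F * 16) + F * (120 * k * S).
  by rewrite /U; move: (300 * _) (150 * _) (100 * _ + _) (120 * k * S) => x1 x2 x3 x4; clear; lia.
have b : N * (F * (300 * (e.+1 * n)) * nb + F * (150 * ((e + k + 2) * 2 ^ k)) * nb +
    F * 10 * nb + F * 16) <= N * (4 * (n * n)).
  by rewrite leq_mul2l; apply/orP; right; move: a1 a2 a3 a4; clear; lia.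
move: a5 a6 b; clear; move: (F * (100 * _ + _)) (F * (120 * k * S)) => x1 x2.
by rewrite [N * (4 * _)]mulnCA; move: (N * (_ + _)) (N * (n * n)) => x3 x4; lia.
Qed.

End Uniformity.
End Sizes.

Unset Implicit Arguments.
Set Strict Implicit.
Set Printing Implicit Defensive.

From mathcomp Require Import all_boot all_order all_algebra ring.
From mathcomp Require Import all_classical all_reals all_analysis.
Import Order.TTheory GRing.Theory Num.Theory.
Import numFieldNormedType.Exports.
Local Open Scope classical_set_scope.
Local Open Scope ring_scope.

(** * Asymptotics *)

Definition loglog (n : nat) : nat := trunc_log 2 (trunc_log 2 n).

(** Collects the lower order terms of [degree_numeric] with the constants of
    [count_qc] and [family_degree]. *)
Definition error_const (e : nat) : nat :=
  (1 + 4 * (2 + 2 * e.+2 + 3 * (e.+2)`!) + 2 * ((e.+2)`! * e.+1))%N.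

Lemma loglog_large (Z : nat) : \forall n \near \oo, (Z <= loglog n)%N.
Proof.
exists (2 ^ 2 ^ Z)%N => // n /= h.
rewrite -{1}(trunc_expnK Z (isT : 1 < 2)%N) -(trunc_expnK (2 ^ Z) (isT : 1 < 2)%N).
by rewrite /loglog !leq_trunc_log.
Qed.

Lemma degree_nat (e n : nat) (H : hypergraph e.+2 'I_n) (x : 'I_n) : (8 <= loglog n)%N ->
  ((e.+2)`! * clique_degree (clique_family (block_size n) H) x *
     ((trunc_log 2 n).+1 * (loglog n).+1) <=
  n ^ e.+1 * ((loglog n).+1 + error_const e))%N.
Proof.
move=> l8; have n0 := size_gt0 l8; have k0 := block_gt0 l8.
set k := block_size n in k0 *; set d := e.+2.
have nbn : (n_blocks n k <= n)%N.
  have := n_blocks_le l8; rewrite -/k => h.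
  have k2 : (2 <= k)%N.
    by have := block_ge l8; rewrite -/k; move: l8; rewrite /loglog; nia.
  by rewrite -(leq_pmul2l (ltn0Sn 1)); apply: leq_trans h; rewrite leq_mul2r k2 orbT.
have h1 := family_degree n0 k0 H x nbn.
have h2 := count_qc e n0 k0 (ltn_ord x).
have h3 := degree_numeric l8 (2 + 2 * d + 3 * d`!) (d`! * e.+1).
rewrite -/k -/(loglog n) in h1 h2 h3.
have h4 : (d`! * clique_degree (clique_family k H) x <=
    n ^ e * (n %/ k + (2 + 2 * d + 3 * d`!) + d`! * e.+1 * 2 ^ k))%N.
  apply: leq_trans (leq_mul (leqnn d`!) h1) _; rewrite mulnDr.
  apply: leq_trans (leq_add h2 (leqnn _)) _; rewrite /n_blocks -/d.
  by move: (n ^ e)%N (2 ^ k)%N (n %/ k)%N (d`!) => x1 x2 x3 x4; lia.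
apply: leq_trans (leq_mul h4 (leqnn _)) _.
by rewrite expnSr -[X in (X <= _)%N]mulnA -[X in (_ <= X)%N]mulnA leq_mul2l h3 orbT.
Qed.

Section Real.
Variable R : realType.

Lemma lg_bounds n : (8 <= loglog n)%N -> 0 < lg R n <= (trunc_log 2 n).+1%:R.
Proof.
move=> l8; have /andP[_ nL] := exp_log l8; have n0 := size_gt0 l8.
have n1 : (1 < n)%N.
  by rewrite ltnNge; apply/negP => n1; move: l8; rewrite /loglog; case: n n1 {nL n0} => [|[|]].
have ln2 : 0 < ln (2 : R) by rewrite ln_gt0 // ltr1n.
rewrite /lg divr_gt0 ?ln_gt0 ?ltr1n //= ler_pdivrMr //.
rewrite -[X in X * _]mulr_natr mul1r mulr_natl -lnXn ?ltr0n // ler_ln ?posrE ?ltr0n ?exprn_gt0 //.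
by rewrite -natrX ler_nat ltnW.
Qed.

Definition error (e n : nat) : R :=
  (error_const e)%:R / (e.+2)`!%:R * ((loglog n).+1%:R)^-1.

Lemma cvg_error e : error e n @[n --> \oo] --> (0 : R).
Proof.
rewrite -[X in _ --> X](mulr0 ((error_const e)%:R / (e.+2)`!%:R)).
apply: cvgMl_tmp; apply: (@cvg_comp _ _ _ loglog (@harmonic R)); last exact: cvg_harmonic.
by apply/cvgnyPge => Z; apply: loglog_large.
Qed.

Lemma degree_real e n (H : hypergraph e.+2 'I_n) : (8 <= loglog n)%N ->
  realizes (clique_family (block_size n) H) (lmp_bound e.+2 (error e) n).
Proof.
move=> l8 x; have h := degree_nat e n H x l8; have /andP[lg0 lgL] := lg_bounds n l8.
rewrite /lmp_bound /error /=; set D := clique_degree _ _ in h *.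
set F : nat := (e.+2)`! in h *; set L := (trunc_log 2 n).+1 in h lgL.
set l := (loglog n).+1 in h *; set C := error_const e in h *.
have F0 : 0 < F%:R :> R by rewrite ltr0n fact_gt0.
have l0 : 0 < l%:R :> R by rewrite ltr0n.
have L0 : 0 < L%:R :> R by rewrite ltr0n.
apply: (@le_trans _ _ ((F%:R^-1 + C%:R / F%:R / l%:R) * (n%:R ^+ e.+1 / L%:R))).
  rewrite mulrA ler_pdivlMr //.
  have -> : F%:R^-1 + C%:R / F%:R / l%:R = (l + C)%:R / (F * l)%:R :> R.
    by rewrite natrD natrM; field; rewrite !gt_eqF.
  rewrite mulrAC ler_pdivlMr ?ltr0n ?muln_gt0 ?fact_gt0 //.
  by rewrite -natrX -!natrM ler_nat; move: h; rewrite [(_ * (l + C))%N]mulnC; lia.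
apply: ler_wpM2l.
  by rewrite addr_ge0 ?invr_ge0 ?mulr_ge0 ?invr_ge0 ?ler0n.
by apply: ler_wpM2l; rewrite ?exprn_ge0 ?ler0n // lef_pV2 ?posrE.
Qed.

Lemma maxn_le (I : finType) (F : I -> nat) (b : R) : 0 <= b ->
  (forall i, (F i)%:R <= b) -> (\max_i F i)%:R <= b.
Proof.
move=> b0 h; apply: (big_ind (fun m : nat => m%:R <= b)) => // x y hx hy.
by rewrite /maxn; case: ifP.
Qed.

End Real.

(** Both [lmp] and [lmp_max] are extrema over finitely many objects. *)
Lemma lmp_real (R : realType) e n (b : R) : (0 < n)%N ->
  (forall H : hypergraph e.+2 'I_n, exists2 Q, clique_partition H Q & realizes Q b) ->
  (lmp_max e.+2 n)%:R <= b.
Proof.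
move=> n0 hQ.
have b0 : 0 <= b.
  have H0 : [forall E in (finset.set0 : {set {set 'I_n}}), #|E| == e.+2].
    by apply/forall_inP => E; rewrite finset.in_set0.
  by have [Q _ /(_ (Ordinal n0))] := hQ (Hypergraph H0); apply: le_trans; rewrite ler0n.
apply: maxn_le => // H; have [Q QH Qb] := hQ H.
rewrite /lmp; case: ex_minnP => m _ /(_ (\max_x clique_degree Q x)%N) h.
apply: (@le_trans _ _ (\max_x clique_degree Q x)%:R); last exact: maxn_le.
rewrite ler_nat; apply: h; apply/existsP; exists Q; rewrite QH.
by apply/forallP => x; apply: leq_bigmax.
Qed.

Lemma card_real (R : realType) e n (H : hypergraph e.+2 'I_n) : (8 <= loglog n)%N ->
  (#|clique_family (block_size n) H|)%:R <= 24%:R * (n%:R ^+ e.+2 / lg R n ^+ 3).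
Proof.
move=> l8; have /andP[lg0 lgL] := lg_bounds R n l8.
have h := cliques_numeric l8; have hc := card_clique_family (block_size n) H.
set L := (trunc_log 2 n).+1 in lgL h; set c := #|_| in hc *.
have {}h : (c * (L * (L * L)) <= 24 * n ^ e.+2)%N.
  apply: leq_trans (leq_mul hc (leqnn _)) _; rewrite -mulnA.
  apply: leq_trans (leq_mul (leqnn (n ^ e)%N) h) _.
  by rewrite !expnSr; move: (n ^ e)%N => x; lia.
rewrite mulrA ler_pdivlMr ?exprn_gt0 //.
apply: (@le_trans _ _ (c%:R * L%:R ^+ 3)).
  apply: ler_wpM2l; first by rewrite ler0n.
  by apply: lerXn2r; rewrite // nnegrE ?ler0n // ltW.
have L3 : (L ^ 3 = L * (L * L))%N by rewrite !expnS expn0 muln1.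
by rewrite -!natrX -!natrM ler_nat L3.
Qed.

Lemma word_real (R : realType) e n w : (8 <= loglog n)%N ->
  (e + 10)%:R * lg R n <= w%:R -> (n ^ (e + 10) <= 2 ^ w)%N.
Proof.
move=> l8; have n0 := size_gt0 l8.
have ln2 : 0 < ln (2 : R) by rewrite ln_gt0 // ltr1n.
rewrite /lg mulrA ler_pdivrMr // mulr_natl mulr_natl -!lnXn ?ltr0n //.
by rewrite ler_ln ?posrE ?exprn_gt0 ?ltr0n // -!natrX ler_nat.
Qed.

Theorem mainTheorem7 (R : realType) :
  exists2 C : R, 0 < C &
  forall d : nat, (2 <= d)%N ->
  exists2 eps : nat -> R, eps n @[n --> \oo] --> (0 : R) &
  [/\ \forall n \near \oo, (lmp_max d n)%:R <= lmp_bound d eps n,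

      exists K : R, \forall n \near \oo, forall H : hypergraph d 'I_n,
        exists Q : {set parts d 'I_n},
          [/\ clique_partition H Q,
              realizes Q (lmp_bound d eps n)
            & #|Q|%:R <= K * (n%:R ^+ d / lg R n ^+ 3)]

    & exists (P : program) (kappa : R), 0 < kappa /\
        forall K : R, \forall n \near \oo,
        forall w : nat, kappa * lg R n <= w%:R <= K * lg R n ->
        forall H : hypergraph d 'I_n,
        exists (t : nat) (Q : {set parts d 'I_n}),
          [/\ t%:R <= C * (n%:R ^+ d / d`!%:R),
              computes_within w P t H Q,
              clique_partition H Q
            & realizes Q (lmp_bound d eps n)]].
Proof.
(* 360 for the dominant term of [time_numeric], with room for the others. *)
exists 400%:R; first by rewrite ltr0n.
case=> [|[|e]] // _; exists (error R e); first exact: cvg_error.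
have large := loglog_large 8; split.
- apply: filterS large => n l8; apply: lmp_real; first exact: size_gt0 l8.
  move=> H; exists (clique_family (block_size n) H); last exact: degree_real.
  exact: clique_family_partition (size_gt0 l8) (block_gt0 l8) H.
- exists 24%:R; apply: filterS large => n l8 H.
  exists (clique_family (block_size n) H); split.
  + exact: clique_family_partition (size_gt0 l8) (block_gt0 l8) H.
  + exact: degree_real.
  + exact: card_real.
- exists (compile 0 (main_code e.+2)), (e + 10)%:R; split; first by rewrite ltr0n addn_gt0 orbT.
  move=> K; apply: filterS2 large (loglog_large (50 * ((e.+2)`! * (e + 5)))) => n l8 lbig.
  move=> w /andP[hw _] H; have n0 := size_gt0 l8; have k0 := block_gt0 l8.
  have sp := space_numeric l8 lbig (word_real R e n w l8 hw).
  have [t [ht hc]] := main_computes n0 k0 H sp.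
  exists t, (clique_family (block_size n) H); split=> //.
  + rewrite mulrA ler_pdivlMr ?ltr0n ?fact_gt0 // -natrX -!natrM ler_nat mulnC.
    by apply: leq_trans (time_numeric l8 lbig); rewrite leq_mul2l ht orbT.
  + exact: clique_family_partition n0 k0 H.
  + exact: degree_real.
Qed.
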